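(* Let $X=(X_t)_{t\ge 0}$ be a real-valued Markov chain with initial distribution $\lambda$, let $Z_t=f_0(X_t)+W_t$ for $t\ge0$ with $f_0:\mathbb{R}\to\mathbb{R}$, and let $x_0\in\mathbb{R}$. Let $\mathcal{F}_n=\sigma(X_0,\dots,X_n)$. Assume: (1) $X$ is a Harris recurrent, aperiodic, irreducible Markov chain which is either positive recurrent or $\beta$-null recurrent ($\beta\in(0,1)$), and whose kernel satisfies $P(x,A)\ge s(x)\nu(A)$ for all $x\in E$, $A\in\mathcal{E}$, where $s$ is measurable with $0\le s\le1$, $\nu$ is a probability measure and $\int_E s\,d\nu>0$. (2) For each $n$, $W_0,\dots,W_n$ are conditionally independent given $\mathcal{F}_n$, $\mathbb{E}(W_t\mid\mathcal{F}_n)=0$ and $\operatorname{Var}(W_t\mid\mathcal{F}_n)\le\sigma^2$ for some $\sigma>0$. (3) There is $\delta>0$ such that $C=[x_0-\delta,x_0+\delta]$ is a small set. (4) $x_0$ belongs to the interior of the support of the chain (the support of $\pi$). (5) $f_0$ is non-increasing, and $f_0$ and $F(y)=\pi(C\cap(-\infty,y])/\pi(C)$ are differentiable on $C$, with derivatives $f_0'$ and $F'$ bounded, in absolute value, above and away from zero on $C$. (6) There exist a constant $K$ and a neighborhood $V$ of $0$ in $[0,\infty)$ such that for all $\gamma\in V$ $$\mathbb{E}_\lambda\Big(\sum_{t=0}^{\tau_{\check\alpha}}\big(\mathbb{I}\{X_t\in C,\,X_t\le x_0+\gamma\}-\mathbb{I}\{X_t\in C,\,X_t\le x_0-\gamma\}\big)\Big)\le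 K\gamma .$$ (7) $\ell_C(\mathcal{B}_1)=\sum_{t\in\mathcal{B}_1}\mathbb{I}\{X_t\in C\}$, the number of visits to $C$ during one regeneration block, has a finite second moment. Let $\hat f_n$ be the localized non-increasing least squares estimator. Then, as $n\to\infty$, $$\hat f_n(x_0)=f_0(x_0)+O_P\big(u(n)^{-1/3}\big),$$ where $u(n)=n$ if $X$ is positive recurrent and $u(n)=n^\beta L(n)$ if $X$ is $\beta$-null recurrent.
   Context: Chain. $E\subseteq\mathbb{R}$ is the state space with countably generated $\sigma$-algebra $\mathcal{E}$ (Borel sets), $P(x,A)$ the transition kernel, $\psi$ the maximal irreducibility measure. Harris recurrent: for all $x\in E$ and $A\in\mathcal{E}$ with $\psi(A)>0$, $\mathbb{P}(X_n\in A\text{ infinitely often}\mid X_0=x)=1$. Such a chain has a $\sigma$-finite invariant measure $\pi$, unique up to a multiplicative constant; it is positive recurrent if $\pi(E)<\infty$ and null recurrent otherwise. A function $h\ge0$ with $\psi(\{h>0\})>0$ is small if there are an integer $m_0\ge1$ and a nonzero positive measure $\nu'$ with $P^{m_0}(x,B)\ge h(x)\nu'(B)$ for all $x,B$; a set is small if its indicator is a small function; a small set $A$ satisfies $0<\pi(A)<\infty$. A null recurrent chain is $\beta$-null recurrent if there are a small nonnegative function $h$, a probability measure $\mu$, $\beta\in(0,1)$ and a slowly varying function $L_h$ such that $\mathbb{E}_\mu(\sum_{t=0}^n h(X_t))\sim\frac{1}{\Gamma(1+\beta)}n^\beta L_h(n)$ as $n\to\infty$. Split chain. The split chain $(X_n,\xi_n)_{n\ge0}$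 on $E\times\{0,1\}$ is defined by: given the past and $X_n=x$, $\xi_n$ is Bernoulli with parameter $s(x)$; given $X_n=x,\xi_n=1$, $X_{n+1}\sim\nu$; given $X_n=x,\xi_n=0$, $X_{n+1}\sim(P(x,\cdot)-s(x)\nu)/(1-s(x))$. The first coordinate has the law of $X$, and $\check\alpha=E\times\{1\}$ is an atom. $\tau_{\check\alpha}=\tau_{\check\alpha}(1)=\inf\{n\ge1:\xi_n=1\}$ and $\tau_{\check\alpha}(k)$ is the $k$-th return time to $\check\alpha$. The regeneration blocks are $\mathcal{B}_j=(X_{\tau_{\check\alpha}(j)+1},\dots,X_{\tau_{\check\alpha}(j+1)})$, $j\ge1$; they are i.i.d. In the $\beta$-null recurrent case $L$ is the slowly varying function such that $\mathbb{P}_{\check\alpha}(\tau_{\check\alpha}>n)\sim \frac{1}{\Gamma(1-\beta)n^\beta L(n)}$. Estimator. One observes $(X_t,Z_t)_{t=0}^n$. Let $Y_1<\dots<Y_m$ be the ordered distinct values among the $X_t$, $0\le t\le n$, lying in $C$ (there are such values for all large $n$ a.s.). $\hat f_n$ is the minimizer of $f\mapsto\sum_{0\le t\le n,\,X_t\in C}(Z_t-f(X_t))^2$ over non-increasing functions $f:\mathbb{R}\to\mathbb{R}$; it is uniquely determined at $Y_1,\dots,Y_m$, and is taken to be constant on each $(Y_{k-1},Y_k]$, $k=2,\dots,m$, on $(-\infty,Y_1]$ and on $[Y_m,\infty)$. *)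

(* Defs.v *)
From HB Require Import structures.
From mathcomp Require Import all_boot all_order all_algebra.
From mathcomp Require Import all_classical all_reals all_analysis.

Set Implicit Arguments.
Unset Strict Implicit.
Unset Printing Implicit Defensive.

Import Order.TTheory GRing.Theory Num.Theory.
Import numFieldNormedType.Exports.

Local Open Scope classical_set_scope.
Local Open Scope ring_scope.

Definition slowly_varying (R : realType) (L : R -> R) : Prop :=
  [/\ measurable_fun setT L,
      \forall x \near +oo, 0 < L x
    & forall c, 0 < c -> L (c * x) / L x @[x --> +oo] --> (1 : R)].

Definition Gamma (R : realType) (a : R) : R :=
  \int[lebesgue_measure]_(x in `]0, +oo[) (x `^ (a - 1) * expR (- x)).

(* [V n = O_P(a n)].  The exceptional event is only required to be contained in
   a measurable event of small probability, so that [V n] need not be measurable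
   (the estimator below is unconstrained while [C] has not been visited). *)
Definition bigO_P (R : realType) d (T : measurableType d) (Pr : probability T R)
    (V : nat -> T -> R) (a : nat -> R) : Prop :=
  forall e : R, 0 < e -> exists2 M : R, 0 < M &
    \forall n \near \oo, exists B : set T,
      [/\ measurable B, (Pr B <= e%:E)%E
        & forall w, ~ B w -> `|V n w| <= M * a n].

Definition is_cond_exp (R : realType) d (T : measurableType d)
    (Pr : probability T R) (G : set (set T)) (U V : T -> R) : Prop :=
  [/\ Pr.-integrable setT (EFin \o U), Pr.-integrable setT (EFin \o V),
      forall A, measurable A -> G (V @^-1` A)
    & forall B, G B ->
        (\int[Pr]_(w in B) (V w)%:E = \int[Pr]_(w in B) (U w)%:E)%E].

Definition is_cond_var (R : realType) d (T : measurableType d)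
    (Pr : probability T R) (G : set (set T)) (U V : T -> R) : Prop :=
  exists2 m : T -> R, is_cond_exp Pr G U m
    & is_cond_exp Pr G (fun w => (U w - m w) ^+ 2) V.

Definition cond_independent (R : realType) d (T : measurableType d)
    (Pr : probability T R) (G : set (set T)) n (W : 'I_n -> T -> R) : Prop :=
  forall (A : 'I_n -> set R) (p : 'I_n -> T -> R),
    (forall i, measurable (A i)) ->
    (forall i, is_cond_exp Pr G (\1_(W i @^-1` A i)) (p i)) ->
    is_cond_exp Pr G (\1_(\bigcap_(i in [set: 'I_n]) W i @^-1` A i))
      (fun w => \prod_i p i w).

(* A measure on the Borel sets of [E] is represented by a Borel measure on [R]
  that vanishes on [~` E], and a kernel on [E] by a kernel on [R] whose values
  at the points of [E] are carried by [E]; its values outside [E] are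
  irrelevant. *)

Section chains.
Context {R : realType}.
Implicit Types (E : set R) (P : R.-pker R ~> R).

Fixpoint kernel_pow P (n : nat) (x : R) (A : set R) : \bar R :=
  if n is m.+1 then (\int[P x]_y kernel_pow P m y A)%E else \d_x A.

Definition irreducibility_measure E P
    (phi : {sigma_finite_measure set R -> \bar R}) : Prop :=
  [/\ (0 < phi E)%E, phi (~` E) = 0%E
    & forall x A, E x -> measurable A -> (0 < phi A)%E ->
        exists2 n, (0 < n)%N & (0 < kernel_pow P n x A)%E].

Definition maximal_irreducibility_measure E P
    (psi : {sigma_finite_measure set R -> \bar R}) : Prop :=
  irreducibility_measure E P psi /\
  forall phi : {sigma_finite_measure set R -> \bar R},
    irreducibility_measure E P phi -> phi `<< psi.

Definition aperiodic E P (psi : {sigma_finite_measure set R -> \bar R}) : Prop :=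
  ~ exists (d : nat) (D : nat -> set R),
      [/\ (1 < d)%N,
          forall i, (i < d)%N -> measurable (D i) /\ D i `<=` E,
          trivIset `I_d D,
          forall i x, (i < d)%N -> D i x -> P x (D (i.+1 %% d)%N) = 1%E
        & psi (E `\` \bigcup_(i in `I_d) D i) = 0%E].

Definition small_function E P (psi : {sigma_finite_measure set R -> \bar R})
    (h : R -> R) : Prop :=
  [/\ measurable_fun setT h, forall x, 0 <= h x,
      (0 < psi [set x | (0 < h x)%R])%E
    & exists (m0 : nat) (nu' : {measure set R -> \bar R}),
      [/\ (0 < m0)%N, (0 < nu' setT)%E
        & forall x B, E x -> measurable B ->
            ((h x)%:E * nu' B <= kernel_pow P m0 x B)%E]].

Definition small_set E P (psi : {sigma_finite_measure set R -> \bar R})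
    (A : set R) : Prop :=
  [/\ measurable A, A `<=` E & small_function E P psi (\1_A)].

Definition invariant_measure E P
    (pi : {sigma_finite_measure set R -> \bar R}) : Prop :=
  [/\ (0 < pi E)%E, pi (~` E) = 0%E
    & forall A, measurable A -> pi A = (\int[pi]_x P x A)%E].

Definition measure_support (mu : {measure set R -> \bar R}) : set R :=
  [set x | forall U, open U -> U x -> (0 < mu U)%E].

Definition markov_chain P (mu : probability R R)
    d (T : measurableType d) (Pr : probability T R) (X : nat -> T -> R) : Prop :=
  [/\ forall n, measurable_fun setT (X n),
      forall A, measurable A -> Pr (X 0%N @^-1` A) = mu A
    & forall n B A, g_sigma_preimage (fun i : 'I_n.+1 => X i) B -> measurable A ->
        Pr (B `&` X n.+1 @^-1` A) = (\int[Pr]_(w in B) P (X n w) A)%E].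

(* The usual family of laws [P_mu], indexed by the initial distribution. *)
Definition markov_family P d (T : measurableType d) (X : nat -> T -> R)
    (PP : probability R R -> probability T R) : Prop :=
  forall mu, markov_chain P mu (PP mu) X.

Definition harris_recurrent E (psi : {sigma_finite_measure set R -> \bar R})
    d (T : measurableType d) (X : nat -> T -> R)
    (PP : probability R R -> probability T R) : Prop :=
  forall x A, E x -> measurable A -> A `<=` E -> (0 < psi A)%E ->
    PP \d_x (lim_sup_set (fun n => X n @^-1` A)) = 1%E.

Definition beta_null_recurrent E P
    (psi pi : {sigma_finite_measure set R -> \bar R})
    d (T : measurableType d) (X : nat -> T -> R)
    (PP : probability R R -> probability T R) (beta : R) : Prop :=
  [/\ pi E = +oo%E, 0 < beta, beta < 1
    & exists (h : R -> R) (mu : probability R R) (Lh : R -> R),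
      [/\ small_function E P psi h, mu E = 1%E, slowly_varying Lh
        & (fun n : nat => fine ('E_(PP mu)[fun w => \sum_(t < n.+1) h (X t w)]))
          ~_\oo
          (fun n : nat => 1 / Gamma (1 + beta) * n%:R `^ beta * Lh n%:R)]].

(* sigma(X_0, ..., X_{n-1}, xi_0, ..., xi_{m-1}) *)
Definition split_history d (T : measurableType d) (X : nat -> T -> R)
    (xi : nat -> T -> bool) (n m : nat) : set (set T) :=
  <<s g_sigma_preimage (fun i : 'I_n => X i) `|`
      g_sigma_preimage (fun i : 'I_m => xi i) >>.

(* The transition mechanism of [(X_n, xi_n)], without initial condition.
   The quotient in the third clause is only evaluated where [xi_n = 0], an event
   on which [s (X_n) < 1] almost surely. *)
Definition split_chain P (s : R -> R) (nu : probability R R)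
    d (T : measurableType d) (Pr : probability T R)
    (X : nat -> T -> R) (xi : nat -> T -> bool) : Prop :=
  [/\ forall n, measurable_fun setT (X n) /\ measurable_fun setT (xi n),
      forall n B A, split_history X xi n.+1 n.+1 B -> measurable A ->
        (Pr (B `&` [set w | xi n w] `&` X n.+1 @^-1` A) =
         Pr (B `&` [set w | xi n w]) * nu A)%E,
      forall n B A, split_history X xi n.+1 n.+1 B -> measurable A ->
        (Pr (B `&` [set w | ~~ xi n w] `&` X n.+1 @^-1` A) =
         \int[Pr]_(w in B `&` [set w | ~~ xi n w])
           ((fine (P (X n w) A) - s (X n w) * fine (nu A)) /
            (1 - s (X n w)))%:E)%E
    & forall n B, split_history X xi n.+2 n.+1 B ->
        (Pr (B `&` [set w | xi n.+1 w]) =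
         \int[Pr]_(w in B) (s (X n.+1 w))%:E)%E].

Definition split_start (s : R -> R) (mu : probability R R)
    d (T : measurableType d) (Pr : probability T R)
    (X : nat -> T -> R) (xi : nat -> T -> bool) : Prop :=
  forall A, measurable A ->
    Pr (X 0%N @^-1` A) = mu A /\
    (Pr (X 0%N @^-1` A `&` [set w | xi 0%N w]) = \int[mu]_(x in A) (s x)%:E)%E.

(* [xi_0 = 1]: the split chain is started in the atom [E x {1}]. *)
Definition atom_start E d (T : measurableType d) (Pr : probability T R)
    (X : nat -> T -> R) (xi : nat -> T -> bool) : Prop :=
  Pr (X 0%N @^-1` E `&` [set w | xi 0%N w]) = 1%E.

(* [return_time xi k] is the k-th return time to the atom for [k >= 1], with
   value +oo when there is none; [return_time xi 0 = 0]. *)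
Fixpoint return_time (T : Type) (xi : nat -> T -> bool) (k : nat) (w : T) :
    \bar R :=
  if k is j.+1 then
    ereal_inf [set n%:R%:E | n in
      [set n : nat | (return_time xi j w < n%:R%:E)%E /\ xi n w]]
  else 0%E.

Definition block_visits (T : Type) (X : nat -> T -> R) (xi : nat -> T -> bool)
    (C : set R) (j : nat) (w : T) : \bar R :=
  (\sum_(0 <= t <oo | (return_time xi j w < t%:R%:E <= return_time xi j.+1 w)%E)
     (\1_C (X t w))%:E)%E.

Definition atom_tail d (T : measurableType d) (Pr : probability T R)
    (xi : nat -> T -> bool) (beta : R) (L : R -> R) : Prop :=
  (fun n : nat => fine (Pr [set w | (n%:R%:E < return_time xi 1 w)%E]))
  ~_\oo
  (fun n : nat => 1 / (Gamma (1 - beta) * n%:R `^ beta * L n%:R)).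

(* [l] is the derivative at [x] of the restriction of [f] to [C]: one-sided at
   the end points of an interval [C]. *)
Definition is_derive_on (C : set R) (f : R -> R) (x l : R) : Prop :=
  (f y - f x) / (y - x) @[y --> within (C `\ x) (nbhs x)] --> l.

Definition bounded_derive_on (C : set R) (f : R -> R) : Prop :=
  exists f' : R -> R, (forall x, C x -> is_derive_on C f x (f' x)) /\
    exists a b : R, 0 < a /\ forall x, C x -> a <= `|f' x| <= b.

Definition localized_cdf (pi : {measure set R -> \bar R}) (C : set R) (y : R) : R :=
  fine (pi (C `&` `]-oo, y])) / fine (pi C).

(* The ordered distinct values Y_1 < ... < Y_m among the x_t, t <= n, in [C]. *)
Definition visited (C : interval R) (n : nat) (x : nat -> R) : seq R :=
  sort <=%R (undup [seq y <- [seq x t | t <- iota 0 n.+1] | y \in C]).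

Definition rss (C : interval R) (n : nat) (x z : nat -> R) (f : R -> R) : R :=
  \sum_(t < n.+1 | x t \in C) (z t - f (x t)) ^+ 2.

Definition isotonic_lse (C : interval R) (n : nat) (x z : nat -> R)
    (f : R -> R) : Prop :=
  let Y := visited C n x in
  [/\ nonincreasing_fun f,
      forall g : R -> R, nonincreasing_fun g -> rss C n x z f <= rss C n x z g
    & (0 < size Y)%N ->
      [/\ forall y, y <= head 0 Y -> f y = f (head 0 Y),
          forall k y, (k.+1 < size Y)%N -> nth 0 Y k < y -> y <= nth 0 Y k.+1 ->
            f y = f (nth 0 Y k.+1)
        & forall y, last 0 Y <= y -> f y = f (last 0 Y)]].

End chains.

(* Main.v *)
Require Import Defs.
From HB Require Import structures.
From mathcomp Require Import all_boot all_order all_algebra.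
From mathcomp Require Import all_classical all_reals all_analysis.
From mathcomp Require Import measurable_realfun ring lra zify.

Set Implicit Arguments.
Unset Strict Implicit.
Unset Printing Implicit Defensive.

Import Order.TTheory GRing.Theory Num.Theory.
Import numFieldNormedType.Exports.

Local Open Scope classical_set_scope.
Local Open Scope ring_scope.

(** Least squares makes the estimator at [x0] an average of observations over a
    block of consecutive points, and the chain enters only through a lower bound
    for the number of points in that block.

    Deterministic part. Put [r = u n `^ (- 1/3)] and let [J] be the set of times
    at which the chain is in [C], right of [x0 - r], and the fit is at least its
    value at [x0]. Lowering the fit on [J] cannot decrease the sum of squares, so
    the average of the observations over [J] is at least the fit at [x0]
    ([lse_block_ge]); as the regression function is non-increasing, that average
    is at most [f0 (x0 - r)] plus the average noise over [J] ([fit_le]). The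
    reflected argument gives the lower bound ([fit_ge]), and [f0 (x0 - r)] is
    within a multiple of [r] of [f0 x0]. It remains to bound average noises over
    [J] by a multiple of [r].

    Noise. The block [J] depends on the noise, but it is always an initial segment
    of the visits to [C] right of [x0 - r], ordered by the values of the chain
    ([initial_segment]). A maximal inequality for partial sums in a fixed order
    ([hajek_renyi]), applied on each of the finitely many events on which the
    order is fixed, shows that with large probability all averages over initial
    segments with at least [m] points are at most [M * m `^ (- 1/2)]
    ([block_noise]). Conditional independence is used there in the following form:
    given the chain, a variable is centered on every event that involves the other
    ones only ([other_events_integral]).

    Number of visits. The block [J] contains every visit to the part of
    [`]x0 - r, x0]] in [C], a set of invariant measure at least [b * r]
    ([localized_mass]). So one needs that sets [B] in [C] of measure at least
    [b * u n `^ (- 1/3)] receive, with large probability, at least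
    [g * u n `^ (2/3)] visits before time [n] ([visits_lower_bound]); then
    [m `^ (- 1/2)] is of order [r].

    Those visits are counted by regenerations. Suppose that a kernel [U] with the
    same invariant measure dominates [s] times a probability [nu], so that a step
    of [U] is a regeneration with probability [s]; let [K] be [U] minus this part
    and let [tail_prob n] be the [nu]-integral of [K^n 1], the probability that a
    block is longer than [n]. Two estimates are used. The time needed for [k]
    regenerations is at most of order [k] times the sum of [tail_prob t] over
    [t < n] ([few_regenerations]). The visits to [B] minus [a] times the number of
    regenerations form a martingale up to a bounded term, by the Poisson equation
    [1_B - a s = h - P h], where [a] is the mean number of visits to [B] in a block
    ([poisson_equation], [few_visits]); and [a] is at least the invariant measure of
    [B] over that of [s] ([inv_le_block_visits]).

    It is convenient to treat the two kinds of recurrence with different kernels. A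
    positive recurrent chain is observed at independent geometric times: this [U] is
    minorized on the small set [C] itself, and the sums of [tail_prob] are bounded
    since the total invariant mass is finite ([positive_often_visited]). In the null
    recurrent case [U] is the kernel of the chain with its given minorization; then
    [tail_prob] is the tail of the return time to the atom ([atom_tailE]), whose
    regular variation gives both that [u n] tends to infinity and that the sum of
    the tails up to [n] is at most of order [n / u n] ([regular_tail],
    [null_often_visited]). Harris recurrence makes blocks finite and makes the chain
    regenerate from every starting point, since a bounded subharmonic function cannot
    gain at a fixed rate on a set of positive measure and a bounded harmonic one is
    constant ([subharmonic_no_gain], [harmonic_constant], [tail_prob_cvg0],
    [survival_vanishes]). *)

(** * Bounded measurable functions and their integrals *)

Section bounded_measurable.
Context {R : realType} {d : measure_display} {T : measurableType d}.
Implicit Types f g : T -> R.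

Definition bounded_measurable f :=
  measurable_fun setT f /\ exists M : R, forall x, `|f x| <= M.

Lemma bmW f M : measurable_fun setT f -> (forall x, 0 <= f x <= M) ->
  bounded_measurable f.
Proof.
move=> mf fM; split=> //; exists M => x.
by have /andP[f0 ?] := fM x; rewrite ger0_norm.
Qed.

Lemma bm_cst (a : R) : bounded_measurable (fun _ : T => a).
Proof. by split; [exact: measurable_cst|exists `|a|]. Qed.

Lemma bmD f g : bounded_measurable f -> bounded_measurable g ->
  bounded_measurable (fun x => f x + g x).
Proof.
move=> [mf [M fM]] [mg [N gN]]; split; first exact: measurable_funD.
by exists (M + N) => x; rewrite (le_trans (ler_normD _ _))// lerD.
Qed.

Lemma bmM f g : bounded_measurable f -> bounded_measurable g ->
  bounded_measurable (fun x => f x * g x).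
Proof.
move=> [mf [M fM]] [mg [N gN]]; split; first exact: measurable_funM.
by exists (M * N) => x; rewrite normrM ler_pM.
Qed.

Lemma bmZ a f : bounded_measurable f -> bounded_measurable (fun x => a * f x).
Proof. exact/bmM/bm_cst. Qed.

Lemma bmN f : bounded_measurable f -> bounded_measurable (fun x => - f x).
Proof.
move=> [mf [M fM]]; split; first exact: measurableT_comp.
by exists M => x; rewrite normrN.
Qed.

Lemma bmB f g : bounded_measurable f -> bounded_measurable g ->
  bounded_measurable (fun x => f x - g x).
Proof. by move=> bf /bmN bg; exact: bmD. Qed.

Lemma bm_sum (I : Type) (r : seq I) (F : I -> T -> R) :
  (forall i, bounded_measurable (F i)) ->
  bounded_measurable (fun x => \sum_(i <- r) F i x).
Proof.
move=> bF; elim: r => [|i r IH].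
  by under eq_fun do rewrite big_nil; exact: bm_cst.
by under eq_fun do rewrite big_cons; exact: bmD.
Qed.

Lemma bm_indic (A : set T) : measurable A -> bounded_measurable (\1_A : T -> R).
Proof.
by move=> mA; apply: (@bmW _ 1) => // x; rewrite indicE ler0n lern1 leq_b1.
Qed.

Lemma bm_limit (F : nat -> T -> R) f M :
  (forall n, bounded_measurable (F n)) -> (forall n x, `|F n x| <= M) ->
  (forall x, F ^~ x @ \oo --> f x) -> bounded_measurable f.
Proof.
move=> bF FM Ff; split.
  by apply: measurable_fun_cvg => [n|x _]; [have [] := bF n|exact: Ff].
exists M => x; have /cvg_norm Fx := Ff x.
rewrite -(cvg_lim _ Fx)//; apply: limr_le; first by apply/cvg_ex; eexists; exact: Fx.
exact: nearW.
Qed.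

Section integral.
Variable m : {measure set T -> \bar R}.
Hypothesis m1 : m setT = 1%E.

Lemma bm_integrable f : bounded_measurable f -> m.-integrable setT (EFin \o f).
Proof.
move=> [mf [M fM]]; apply: measurable_bounded_integrable => //.
  by rewrite m1 ltry.
by exists M; split; [exact: num_real|move=> x Mx y _ /=; exact: le_trans (ltW Mx)].
Qed.

Lemma bm_integralE f : bounded_measurable f ->
  ((\int[m]_x f x)%:E = \int[m]_x (f x)%:E)%E.
Proof. by move=> /bm_integrable/(integrable_fin_num measurableT)/fineK. Qed.

Lemma bm_integral_cst (a : R) : \int[m]_x a = a.
Proof. by rewrite Rintegral_cst// m1 mulr1. Qed.

Lemma bm_integralD f g : bounded_measurable f -> bounded_measurable g ->
  \int[m]_x (f x + g x) = \int[m]_x f x + \int[m]_x g x.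
Proof. by move=> bf bg; apply: RintegralD => //; exact: bm_integrable. Qed.

Lemma bm_integralB f g : bounded_measurable f -> bounded_measurable g ->
  \int[m]_x (f x - g x) = \int[m]_x f x - \int[m]_x g x.
Proof. by move=> bf bg; apply: RintegralB => //; exact: bm_integrable. Qed.

Lemma bm_integralZ a f : bounded_measurable f ->
  \int[m]_x (a * f x) = a * \int[m]_x f x.
Proof. by move=> bf; apply: RintegralZl => //; exact: bm_integrable. Qed.

Lemma bm_integral_sum (I : Type) (r : seq I) (F : I -> T -> R) :
  (forall i, bounded_measurable (F i)) ->
  \int[m]_x (\sum_(i <- r) F i x) = \sum_(i <- r) \int[m]_x F i x.
Proof.
move=> bF; elim: r => [|i r IH].
  by under eq_Rintegral do rewrite big_nil; rewrite big_nil bm_integral_cst.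
under eq_Rintegral do rewrite big_cons.
by rewrite bm_integralD ?IH ?big_cons//; exact: bm_sum.
Qed.

Lemma bm_integral_le f g : bounded_measurable f -> bounded_measurable g ->
  (forall x, f x <= g x) -> \int[m]_x f x <= \int[m]_x g x.
Proof. by move=> bf bg fg; apply: le_Rintegral => //; exact: bm_integrable. Qed.

Lemma bm_integral_cvg (F : nat -> T -> R) f M :
  (forall n, bounded_measurable (F n)) -> (forall n x, `|F n x| <= M) ->
  (forall x, F ^~ x @ \oo --> f x) ->
  \int[m]_x F n x @[n --> \oo] --> \int[m]_x f x.
Proof.
move=> bF FM Ff; have bf := bm_limit bF FM Ff.
have := @dominated_convergence _ _ _ m setT measurableT (fun n => EFin \o F n)
  (EFin \o f) (fun=> M%:E).
case.
- by move=> n; apply/measurable_EFinP; have [] := bF n.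
- by apply/measurable_EFinP; have [] := bf.
- by apply: aeW => x _; apply: cvg_EFin; [exact: nearW|exact: Ff].
- exact: (bm_integrable (bm_cst M)).
- by apply: aeW => x n _; rewrite lee_fin.
- move=> _ _ /=.
  rewrite -(bm_integralE bf); under eq_fun do rewrite -(bm_integralE (bF _)).
  by move/fine_cvg.
Qed.

Lemma bm_integral_indic (A : set T) : measurable A ->
  (\int[m]_x \1_A x)%:E = m A.
Proof.
by move=> mA; rewrite bm_integralE ?integral_indic ?setIT//; exact: bm_indic.
Qed.

Lemma full_measureC (E : set T) : measurable E -> m E = 1%E -> m (~` E) = 0%E.
Proof.
move=> mE mE1; have mC : measurable (~` E) by exact: measurableC.
have : (1 = m E + m (~` E))%E by rewrite -m1 -(setUv E) measureU// setICr.
rewrite mE1.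
have : (m (~` E) <= 1)%E by rewrite -m1; apply: le_measure; rewrite ?inE.
case: (m (~` E)) (measure_ge0 m (~` E)) => [r| |]//= _ _.
by move=> /(congr1 fine)/= h; congr EFin; lra.
Qed.

Lemma bm_integral_eq (E : set T) f g : measurable E -> m E = 1%E ->
  bounded_measurable f -> bounded_measurable g ->
  (forall x, E x -> f x = g x) -> \int[m]_x f x = \int[m]_x g x.
Proof.
move=> mE mE1 bf bg fg; congr fine; apply: ae_eq_integral => //.
- by apply/measurable_EFinP; have [] := bf.
- by apply/measurable_EFinP; have [] := bg.
exists (~` E); split; first exact: measurableC.
- exact: full_measureC.
move=> x /=; apply: contra_not => Ex _ /=; by rewrite fg.
Qed.

End integral.
End bounded_measurable.
(** * Positive contractions of the space of bounded measurable functions *)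

Section submarkov.
Context {R : realType}.
Implicit Types (Q : (R -> R) -> R -> R) (f g : R -> R).
Local Notation bm := (@bounded_measurable R _ R).

(** Kernels, differences of kernels and resolvents are treated alike through
    their action on bounded functions; the last field stands for countable
    additivity. *)
Record submarkov Q : Prop := Submarkov {
  sm_bm : forall f, bm f -> bm (Q f);
  sm_lin : forall a f g, bm f -> bm g -> forall x,
    Q (fun y => a * f y + g y) x = a * Q f x + Q g x;
  sm_ge0 : forall f, bm f -> (forall x, 0 <= f x) -> forall x, 0 <= Q f x;
  sm_le1 : forall x, Q (fun=> 1) x <= 1;
  sm_cvg : forall (F : nat -> R -> R) f (M : R), (forall n, bm (F n)) ->
    (forall n x, `|F n x| <= M) -> (forall x, F ^~ x @ \oo --> f x) ->
    forall x, Q (F n) x @[n --> \oo] --> Q f x }.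

Section theory.
Variable Q : (R -> R) -> R -> R.
Hypothesis smQ : submarkov Q.

Lemma smD f g x : bm f -> bm g -> Q (fun y => f y + g y) x = Q f x + Q g x.
Proof.
move=> bf bg; have := sm_lin smQ 1 bf bg x; rewrite mul1r => <-.
by congr (Q _ x); apply/funext => y; rewrite mul1r.
Qed.

Lemma sm_zero x : Q (fun=> 0) x = 0.
Proof.
have /= := smD x (bm_cst 0) (bm_cst 0).
rewrite (_ : (fun=> 0 + 0) = (fun=> 0)); last by apply/funext => y; rewrite addr0.
by move=> /eqP; rewrite -subr_eq subrr => /eqP.
Qed.

Lemma smZ a f x : bm f -> Q (fun y => a * f y) x = a * Q f x.
Proof.
move=> bf; have := sm_lin smQ a bf (bm_cst 0) x; rewrite sm_zero addr0 => <-.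
by congr (Q _ x); apply/funext => y; rewrite addr0.
Qed.

Lemma smB f g x : bm f -> bm g -> Q (fun y => f y - g y) x = Q f x - Q g x.
Proof.
move=> bf bg; have := sm_lin smQ (-1) bg bf x; rewrite mulN1r addrC => <-.
by congr (Q _ x); apply/funext => y; rewrite mulN1r addrC.
Qed.

Lemma sm_le f g x : bm f -> bm g -> (forall y, f y <= g y) -> Q f x <= Q g x.
Proof.
move=> bf bg fg; rewrite -subr_ge0 -smB//; apply: (sm_ge0 smQ); first exact: bmB.
by move=> y; rewrite subr_ge0.
Qed.

Lemma sm_le_cst f M x : bm f -> 0 <= M -> (forall y, f y <= M) -> Q f x <= M.
Proof.
move=> bf M0 fM; apply: (le_trans (sm_le x bf (bm_cst M) fM)).
rewrite (_ : (fun=> M) = (fun y => M * (fun=> 1) y)); last first.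
  by apply/funext => y; rewrite mulr1.
by rewrite smZ ?ler_piMr ?(sm_le1 smQ)//; exact: bm_cst.
Qed.

Lemma sm_norm f M x : bm f -> (forall y, `|f y| <= M) -> `|Q f x| <= M.
Proof.
move=> bf fM; have M0 : 0 <= M by exact: le_trans (fM x).
have Nf : Q (fun y => - f y) x = - Q f x.
  have := smZ (-1) x bf; rewrite mulN1r => <-.
  by congr (Q _ x); apply/funext => y; rewrite mulN1r.
rewrite ler_norml lerNl -Nf !sm_le_cst//.
- by move=> y; exact: le_trans (ler_norm _) (fM y).
- exact: bmN.
- by move=> y; rewrite (le_trans (ler_norm _))// normrN.
Qed.

Lemma sm_sum (I : Type) (r : seq I) (F : I -> R -> R) x : (forall i, bm (F i)) ->
  Q (fun y => \sum_(i <- r) F i y) x = \sum_(i <- r) Q (F i) x.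
Proof.
move=> bF; elim: r => [|i r IH].
  by under eq_fun do rewrite big_nil; rewrite sm_zero big_nil.
under eq_fun do rewrite big_cons.
by rewrite smD ?IH ?big_cons//; exact: bm_sum.
Qed.

End theory.

Lemma submarkov_iter Q n : submarkov Q -> submarkov (iter n Q).
Proof.
move=> smQ; elim: n => [|n IH]; first by split=> // x; rewrite lexx.
split=> /= [f bf|a f g bf bg x|f bf f0 x|x|F f M bF FM Ff x].
- exact/(sm_bm smQ)/(sm_bm IH).
- rewrite -(sm_lin smQ); [|exact: (sm_bm IH)|exact: (sm_bm IH)].
  by congr (Q _ x); apply/funext => y; rewrite (sm_lin IH).
- by apply: (sm_ge0 smQ); [exact: (sm_bm IH)|exact: (sm_ge0 IH)].
- apply: (sm_le_cst smQ); [exact/(sm_bm IH)/bm_cst|by []|exact: (sm_le1 IH)].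
- apply: (@sm_cvg _ smQ _ _ M) => [n0|n0 y|].
  + exact: (sm_bm IH).
  + exact: (sm_norm IH).
  + exact: (sm_cvg IH bF FM Ff).
Qed.

(** The mean of [iter J Q] over a geometric time [J]; it is the identity for
    [e = 0] and the normalized resolvent of [Q] in general. *)
Definition geometric_mean (e : R) Q f (x : R) : R :=
  limn (series (fun j => (1 - e) * e ^+ j * iter j Q f x)).

Section geometric_mean.
Variables (Q : (R -> R) -> R -> R) (e : R).
Hypotheses (smQ : submarkov Q) (e0 : 0 <= e) (e1 : e < 1).
Let S f N x := series (fun j => (1 - e) * e ^+ j * iter j Q f x) N.

Let SS f N x : bm f -> S f N.+1 x = (1 - e) * f x + e * Q (S f N) x.
Proof.
move=> bf; rewrite /S /series /= big_nat_recl//= expr0 mulr1; congr (_ + _).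
rewrite sm_sum//; last by move=> j; apply/bmZ/(sm_bm (submarkov_iter j smQ)).
rewrite mulr_sumr; apply: eq_bigr => j _.
rewrite smZ//; last exact: (sm_bm (submarkov_iter j smQ)).
by rewrite exprS; ring.
Qed.

Let bS f N : bm f -> bm (S f N).
Proof.
by move=> bf; apply: bm_sum => j; apply/bmZ/(sm_bm (submarkov_iter j smQ)).
Qed.

Let tail_le f (M : R) m n x : bm f -> (forall y, `|f y| <= M) -> (m <= n)%N ->
  `|S f n x - S f m x| <= M * e ^+ m.
Proof.
move=> bf fM mn; have M0 : 0 <= M by exact: le_trans (fM x).
rewrite /S sub_series_geq// (le_trans (ler_norm_sum _ _ _))//.
apply: (@le_trans _ _ (\sum_(m <= k < n) M * (e ^+ k - e ^+ k.+1))).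
  apply: ler_sum => k _.
  rewrite normrM ger0_norm ?mulr_ge0 ?exprn_ge0 ?subr_ge0 ?(ltW e1)//.
  rewrite exprS -{2}[e ^+ k]mul1r -mulrBl mulrC ler_wpM2r//.
    by rewrite mulr_ge0 ?exprn_ge0 ?subr_ge0 ?(ltW e1).
  by apply: sm_norm => //; exact: submarkov_iter.
rewrite -mulr_sumr ler_wpM2l// (telescope_sumr_eq (fun k => - e ^+ k))//.
  by rewrite opprK addrC gerBl exprn_ge0.
by move=> k _; rewrite opprK addrC.
Qed.

Let S_cvg f x : bm f -> cvgn (fun N => S f N x).
Proof.
move=> bf; have [_ [M fM]] := bf; apply: normed_cvg.
apply: (@series_le_cvg _ _ (geometric (M * (1 - e)) e)) => [j|j|j|] /=.
- exact: normr_ge0.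
- have M0 : 0 <= M by exact: le_trans (fM x).
  by rewrite mulr_ge0 ?exprn_ge0// mulr_ge0// subr_ge0 ltW.
- rewrite normrM ger0_norm ?mulr_ge0 ?exprn_ge0 ?subr_ge0 ?(ltW e1)//.
  rewrite -[leRHS]mulrA [leRHS]mulrC ler_wpM2l//.
    by rewrite mulr_ge0 ?exprn_ge0 ?subr_ge0 ?(ltW e1).
  by apply: sm_norm => //; exact: submarkov_iter.
- by apply: is_cvg_geometric_series; rewrite ger0_norm.
Qed.

Lemma geometric_mean_cvg f x : bm f ->
  S f N x @[N --> \oo] --> geometric_mean e Q f x.
Proof. exact: S_cvg. Qed.

Let S_norm f (M : R) N x : bm f -> (forall y, `|f y| <= M) -> `|S f N x| <= M.
Proof.
move=> bf fM; have := @tail_le f M 0 N x bf fM (leq0n _).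
by rewrite (_ : S f 0 x = 0) ?subr0 ?expr0 ?mulr1//; rewrite /S /series /= big_geq.
Qed.

Let mean_tail f (M : R) m x : bm f -> (forall y, `|f y| <= M) ->
  `|geometric_mean e Q f x - S f m x| <= M * e ^+ m.
Proof.
move=> bf fM.
have /cvg_norm cv : S f N x - S f m x @[N --> \oo] --> geometric_mean e Q f x - S f m x.
  by apply: cvgB; [exact: geometric_mean_cvg|exact: cvg_cst].
rewrite -(cvg_lim _ cv)//; apply: limr_le; first by apply/cvg_ex; eexists; exact: cv.
by exists m => // n /= mn; exact: tail_le.
Qed.

(** With probability [1 - e] the geometric time is [0]; otherwise it is one step
    followed by an independent copy of it. *)
Lemma geometric_meanE f x : bm f ->
  geometric_mean e Q f x = (1 - e) * f x + e * Q (geometric_mean e Q f) x.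
Proof.
move=> bf; have [_ [M fM]] := bf.
have cv1 : S f N.+1 x @[N --> \oo] --> geometric_mean e Q f x.
  by rewrite (cvg_shiftS (fun N => S f N x)); exact: geometric_mean_cvg.
rewrite -(cvg_lim _ cv1)//; apply/cvg_lim => //.
under eq_fun do rewrite SS//.
apply: cvgD; first exact: cvg_cst.
apply: cvgM; first exact: cvg_cst.
apply: (@sm_cvg _ smQ (S f) _ M) => [N|N y|y]; first exact: bS.
- exact: S_norm.
- exact: geometric_mean_cvg.
Qed.

Lemma submarkov_geometric_mean : submarkov (geometric_mean e Q).
Proof.
have bmG f : bm f -> bm (geometric_mean e Q f).
  move=> bf; have [_ [M fM]] := bf.
  apply: (@bm_limit _ _ _ (S f) _ M) => [N|N y|y]; first exact: bS.
  - exact: S_norm.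
  - exact: geometric_mean_cvg.
split=> // [a f g bf bg x|f bf f0 x|x|F f M bF FM Ff x].
- apply/cvg_lim => //.
  rewrite (_ : series _ = (fun N => a * S f N x + S g N x)).
    apply: cvgD; last exact: geometric_mean_cvg.
    by apply: cvgM; [exact: cvg_cst|exact: geometric_mean_cvg].
  apply/funext => N.
  rewrite /S /series /= mulr_sumr -big_split /=; apply: eq_bigr => j _.
  by rewrite (sm_lin (submarkov_iter j smQ))//; ring.
- apply: limr_ge; first exact: S_cvg.
  apply: nearW => N; apply: sumr_ge0 => j _.
  apply: mulr_ge0; first by rewrite mulr_ge0 ?exprn_ge0 ?subr_ge0 ?(ltW e1).
  exact: (sm_ge0 (submarkov_iter j smQ)).
- apply: (le_trans (ler_norm _)).
  have := @mean_tail (fun=> 1) 1 0 x (bm_cst 1) _.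
  rewrite (_ : S _ 0 x = 0) ?subr0 ?expr0 ?mulr1; last by rewrite /S /series /= big_geq.
  by apply=> y; rewrite normr1.
- have M0 : 0 <= M by exact: le_trans (FM 0 x).
  have bf := bm_limit bF FM Ff.
  have fM y : `|f y| <= M.
    rewrite -(cvg_lim _ (cvg_norm (Ff y)))//; apply: limr_le.
      by apply/cvg_ex; eexists; exact: cvg_norm (Ff y).
    exact: nearW.
  apply/cvgrPdist_lt => r r0.
  have [m Mm] : exists m, M * e ^+ m < r / 3.
    have : M * e ^+ m @[m --> \oo] --> M * 0.
      by apply: cvgM; [exact: cvg_cst|apply: cvg_expr; rewrite ger0_norm].
    rewrite mulr0 => /cvgrPdist_lt/(_ (r / 3)) [|m _ /(_ m (leqnn _))].
      by rewrite divr_gt0.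
    by rewrite sub0r normrN ger0_norm ?mulr_ge0 ?exprn_ge0//; exists m.
  have SF : S (F n) m x @[n --> \oo] --> S f m x.
    apply: cvg_big => [|j _]; first exact: add_continuous.
    apply: cvgM; first exact: cvg_cst.
    exact: (sm_cvg (submarkov_iter j smQ) bF FM Ff).
  have /cvgrPdist_lt/(_ (r / 3)) := SF; rewrite divr_gt0// => /(_ isT).
  apply: filterS => n Sn.
  have h1 := mean_tail m x bf fM.
  have h2 := mean_tail m x (bF n) (FM n).
  rewrite distrC in h2.
  rewrite (_ : _ - _ = (geometric_mean e Q f x - S f m x) + (S f m x - S (F n) m x)
    + (S (F n) m x - geometric_mean e Q (F n) x)); last by ring.
  apply: (le_lt_trans (ler_normD _ _)); rewrite -ltrBrDr.
  apply: (le_lt_trans (ler_normD _ _)).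
  move: h1 h2 Sn Mm; set a := `|_ - _|; set b := `|_ - _|; set c := `|_ - _|.
  by move: a b c => a b c; lra.
Qed.

End geometric_mean.

(** Applying [Q] to the partial sums shifts them by one term, and continuity along
    bounded sequences passes this to the limit. *)
Lemma potential_bounded Q f (G : R) : submarkov Q -> bm f -> (forall x, 0 <= f x) ->
  (forall n x, \sum_(t < n) iter t Q f x <= G) ->
  exists g, [/\ bm g, forall x, 0 <= g x <= G, forall x, g x = f x + Q g x &
    forall x, \sum_(t < n) iter t Q f x @[n --> \oo] --> g x].
Proof.
move=> smQ bf f0 fG; pose S n x := \sum_(t < n) iter t Q f x.
have it0 t x : 0 <= iter t Q f x by exact: (sm_ge0 (submarkov_iter t smQ)).
have S0 n x : 0 <= S n x by exact: sumr_ge0.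
have bS n : bm (S n) by apply: bm_sum => t; exact: (sm_bm (submarkov_iter t smQ)).
have Snorm n x : `|S n x| <= G by rewrite ger0_norm ?fG.
pose g x := limn (fun n => S n x).
have Sg x : S n x @[n --> \oo] --> g x.
  apply: nondecreasing_is_cvgn.
    apply/nondecreasing_seqP => n; rewrite /S big_ord_recr/=.
    by rewrite lerDl.
  by exists G => _ [n _ <-]; exact: fG.
exists g; split=> //.
- exact: bm_limit Snorm Sg.
- move=> x; apply/andP; split.
    by apply: limr_ge; [apply/cvg_ex; eexists; exact: Sg|exact: nearW].
  by apply: limr_le; [apply/cvg_ex; eexists; exact: Sg|apply: nearW => n; exact: fG].
- move=> x; have cv1 : S n.+1 x @[n --> \oo] --> g x.
    by rewrite (cvg_shiftS (fun n => S n x)); exact: Sg.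
  rewrite -(cvg_lim _ cv1)//; apply/cvg_lim => //.
  rewrite (_ : (fun n => S n.+1 x) = (fun n => f x + Q (S n) x)).
    apply: cvgD; first exact: cvg_cst.
    exact: (sm_cvg smQ bS Snorm Sg).
  apply/funext => n; rewrite /S big_ord_recl/= sm_sum//.
  by move=> t; exact: (sm_bm (submarkov_iter t smQ)).
Qed.

End submarkov.
(** * Measurability with respect to the past, and the Markov property *)

Section induction.
Context {R : realType} {d : measure_display} {T : measurableType d}.
Local Notation bm := (@bounded_measurable R d T).
Implicit Types (f g : T -> R) (Phi : (T -> R) -> Prop).
Import HBNNSimple.

(** Approximation by simple functions; the version for nonnegative functions keeps
    the approximation monotone, for use with measures of infinite mass. *)
Lemma bm_ge0_induction Phi :
  Phi (fun=> 0) ->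
  (forall a A g, 0 <= a -> measurable A -> bm g -> (forall x, 0 <= g x) ->
    Phi g -> Phi (fun x => a * \1_A x + g x)) ->
  (forall (F : nat -> T -> R) f (M : R), (forall n, bm (F n)) ->
    (forall n x, 0 <= F n x <= M) -> (forall x, nondecreasing_seq (F ^~ x)) ->
    (forall x, F ^~ x @ \oo --> f x) -> (forall n, Phi (F n)) -> Phi f) ->
  forall f, bm f -> (forall x, 0 <= f x) -> Phi f.
Proof.
move=> Phi0 PhiD Phil f [mf [M fM]] f0.
have mEf : measurable_fun setT (EFin \o f) by exact/measurable_EFinP.
pose h := nnsfun_approx measurableT mEf.
have Ef0 x : setT x -> (0 <= (EFin \o f) x)%E by move=> _; rewrite lee_fin.
have hf x : h n x @[n --> \oo] --> f x.
  have /= := cvg_nnsfun_approx measurableT mEf Ef0 (x := x) I.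
  by move/fine_cvgP => [_].
have hle n x : h n x <= f x.
  have cvh : cvgn (fun n => h n x) by apply/cvg_ex; eexists; exact: hf.
  rewrite -(cvg_lim _ (hf x))//; apply: nondecreasing_cvgn_le => //.
  by move=> a b ab; exact/lefP/nd_nnsfun_approx.
have h_bm n : bm (h n).
  by apply: (@bmW _ _ _ _ M) => // x; rewrite fun_ge0 (le_trans (hle n x))// (le_trans (ler_norm _)).
apply: (@Phil (fun n => h n : T -> R) f M) => // [n x|x a b ab|n].
- by rewrite fun_ge0 (le_trans (hle n x))// (le_trans (ler_norm _)).
- exact/lefP/nd_nnsfun_approx.
rewrite (_ : (h n : T -> R) = (fun x =>
    \sum_(y <- finmap.enum_fset (fset_set (range (h n)))) (y * \1_(h n @^-1` [set y]) x))); last first.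
  by apply/funext => x; rewrite fimfunE fsbig_finite.
have ge0 y : y \in finmap.enum_fset (fset_set (range (h n))) -> 0 <= y.
  by rewrite in_fset_set// inE => -[x _ <-]; exact: fun_ge0.
elim: (finmap.enum_fset _) ge0 => [|y s IH] ge0.
  by under eq_fun do rewrite big_nil.
under eq_fun do rewrite big_cons.
have ge0s z : z \in s -> 0 <= z by move=> zs; apply: ge0; rewrite inE zs orbT.
apply: PhiD.
- by apply: ge0; rewrite inE eqxx.
- exact: measurable_funPTI.
- by apply: bm_sum => z; apply/bmZ/bm_indic; exact: measurable_funPTI.
- by move=> x; rewrite big_seq; apply: sumr_ge0 => z zs; apply: mulr_ge0; [exact: ge0s|rewrite indicE ler0n].
- exact: IH.
Qed.

Lemma bm_induction Phi :
  (forall A, measurable A -> Phi \1_A) ->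
  (forall a f g, bm f -> bm g -> Phi f -> Phi g -> Phi (fun x => a * f x + g x)) ->
  (forall (F : nat -> T -> R) f (M : R), (forall n, bm (F n)) ->
    (forall n x, `|F n x| <= M) -> (forall x, F ^~ x @ \oo --> f x) ->
    (forall n, Phi (F n)) -> Phi f) ->
  forall f, bm f -> Phi f.
Proof.
move=> PhiI PhiD Phil.
have Phi1 : Phi (fun=> 1).
  by rewrite (_ : (fun=> 1) = \1_setT)//; [exact: PhiI|rewrite indicT].
have Phi0 : Phi (fun=> 0).
  rewrite (_ : (fun=> 0) = \1_set0)//; [exact: PhiI|by rewrite indic0].
have Phi_ge0 : forall f, bm f -> (forall x, 0 <= f x) -> Phi f.
  apply: bm_ge0_induction => // [a A g _ mA bg _ Pg|F f M bF F0M _].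
    by apply: PhiD => //; [exact: bm_indic|exact: PhiI].
  apply: (@Phil F f M bF) => n x; have /andP[F0 FM] := F0M n x.
  by rewrite ger0_norm.
move=> f bf; have [mf [M fM]] := bf.
rewrite (_ : f = (fun x => (- M) * (fun=> 1) x + (f x + M))); last first.
  by apply/funext => x; rewrite mulr1; ring.
have bfM : bm (fun x => f x + M) by apply: bmD => //; exact: bm_cst.
apply: PhiD => //; first exact: bm_cst.
by apply: Phi_ge0 => // x; have := fM x; rewrite ler_norml => /andP[]; lra.
Qed.

End induction.

(** Minorizations of kernels are given on events, and used on functions. *)
Lemma minorization_on_events {R : realType} (Q : (R -> R) -> R -> R)
    (m : probability R R) (c x : R) : submarkov Q ->
  (forall B, measurable B -> c * \int[m]_y \1_B y <= Q \1_B x) ->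
  forall f, bounded_measurable f -> (forall y, 0 <= f y) ->
  c * \int[m]_y f y <= Q f x.
Proof.
have m1 : m setT = 1%E by exact: probability_setT.
move=> smQ h; apply: bm_ge0_induction.
- by rewrite (bm_integral_cst m1) mulr0 (sm_zero smQ).
- move=> a B g a0 mB bg g0 IH; have bB := bm_indic (R := R) mB.
  rewrite (sm_lin smQ)// (bm_integralD m1)//; last exact: bmZ.
  rewrite (bm_integralZ m1)// mulrDr lerD// mulrCA ler_wpM2l//.
  exact: h.
- move=> F f M bF F0M _ Ff IH; have FM n y : `|F n y| <= M.
    by have /andP[? ?] := F0M n y; rewrite ger0_norm.
  have c1 := bm_integral_cvg m1 bF FM Ff.
  have := sm_cvg smQ bF FM Ff => /(_ x) c2.
  rewrite -(cvg_lim _ c2)// -(cvg_lim _ (cvgM (cvg_cst c) c1))//.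
  apply: ler_lim; [apply: is_cvgM; [exact: is_cvg_cst|]| |]; try by apply/cvg_ex; eexists; eassumption.
  by apply: nearW => n; exact: IH.
Qed.

Section factor.
Context {R : realType} {d : measure_display} {T : measurableType d}.
Variables (m : {measure set T -> \bar R}) (G : set (set T)).
Hypothesis Gm : <<s G >> `<=` measurable.
Local Notation GT := (g_sigma_algebraType G).

Lemma Rintegral_indicM (A : set T) (U : T -> R) :
  \int[m]_(w in A) U w = \int[m]_w (\1_A w * U w).
Proof.
rewrite Rintegral_mkcond; apply: eq_Rintegral => w _.
by rewrite patchE indicE; case: (w \in A); rewrite ?mul1r ?mul0r.
Qed.

Lemma bm_sub (H : T -> R) :
  @bounded_measurable R _ GT H -> @bounded_measurable R _ T H.
Proof. by move=> [mH bH]; split=> // _ B mB; apply: Gm; exact: mH. Qed.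

Lemma integrable_bmM (H U : T -> R) : @bounded_measurable R _ T H ->
  m.-integrable setT (EFin \o U) ->
  m.-integrable setT (EFin \o (fun w => H w * U w)).
Proof.
move=> [mH [M HM]] iU.
have mU : measurable_fun setT U by apply/measurable_EFinP; case/integrableP: iU.
apply: (@le_integrable _ _ _ _ _ measurableT _ (fun w => M%:E * `|(U w)%:E|)%E).
- by apply/measurable_EFinP; exact: measurable_funM.
- move=> w _ /=; rewrite lee_fin normrM [leRHS]ger0_norm.
    by rewrite ler_wpM2r.
  by rewrite mulr_ge0// (le_trans _ (HM w)).
- by apply: integrableZl => //; exact: integrable_abse.
Qed.

(** The form in which conditional expectations are used: the bounded factor [H]
    is known to the sub-sigma-algebra. *)
Lemma integral_factor (U V : T -> R) :
  m.-integrable setT (EFin \o U) -> m.-integrable setT (EFin \o V) ->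
  (forall B, <<s G >> B -> \int[m]_(w in B) U w = \int[m]_(w in B) V w) ->
  forall H, @bounded_measurable R _ GT H ->
  \int[m]_w (H w * U w) = \int[m]_w (H w * V w).
Proof.
move=> iU iV UV; apply: bm_induction.
- move=> A mA; have := UV A mA; rewrite (Rintegral_indicM A U) (Rintegral_indicM A V).
  exact.
- move=> a f g /bm_sub bf /bm_sub bg fE gE.
  have lin W : m.-integrable setT (EFin \o W) -> \int[m]_w ((a * f w + g w) * W w) =
      a * \int[m]_w (f w * W w) + \int[m]_w (g w * W w).
    move=> iW; under eq_Rintegral do rewrite mulrDl -mulrA.
    rewrite RintegralD//; last exact: integrable_bmM.
      by rewrite RintegralZl//; exact: integrable_bmM.
    exact: (integrableZl _ _ (integrable_bmM bf iW)).
  by rewrite !lin// fE gE.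
- move=> F f M bF FM Ff FE.
  have bf := bm_limit bF FM Ff.
  have lim W : m.-integrable setT (EFin \o W) ->
      \int[m]_w (F n w * W w) @[n --> \oo] --> \int[m]_w (f w * W w).
    move=> iW.
    have mW : measurable_fun setT W by apply/measurable_EFinP; case/integrableP: iW.
    have := @dominated_convergence _ _ _ m setT measurableT
      (fun n w => (F n w * W w)%:E) (fun w => (f w * W w)%:E)
      (fun w => (M%:E * `|(W w)%:E|)%E).
    case.
    + by move=> n; apply/measurable_EFinP/measurable_funM => //; have [] := bm_sub (bF n).
    + by apply/measurable_EFinP/measurable_funM => //; have [] := bm_sub bf.
    + apply: aeW => w _; apply: cvg_EFin; first exact: nearW.
      by apply: cvgM; [exact: Ff|exact: cvg_cst].
    + by apply: integrableZl => //; exact: integrable_abse.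
    + apply: aeW => w n _ /=; rewrite lee_fin normrM ler_wpM2r//.
    + move=> _ _ /=.
      have := integrable_fin_num measurableT (integrable_bmM (bm_sub bf) iW).
      by move=> /fineK <- /fine_cvg.
  by rewrite -(cvg_lim _ (lim U iU))// -(cvg_lim _ (lim V iV))//; under eq_fun do rewrite FE.
Qed.

End factor.

Section kernel_operator.
Context {R : realType}.
Variable P : R.-pker R ~> R.
Local Notation bm := (@bounded_measurable R _ R).

Definition kernel_op (f : R -> R) (x : R) : R := \int[P x]_y f y.

Let P1 x : P x setT = 1%E. Proof. exact: prob_kernel. Qed.

Lemma kernel_op1 x : kernel_op (fun=> 1) x = 1.
Proof. exact: bm_integral_cst. Qed.

Lemma submarkov_kernel : submarkov kernel_op.
Proof.
split=> [f bf|a f g bf bg x|f bf f0 x|x|F f M bF FM Ff x].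
- have [mf [M fM]] := bf.
  have bM : bm (fun y => f y + M) by apply: bmD => //; exact: bm_cst.
  split.
    rewrite (_ : kernel_op f = (fun x => kernel_op (fun y => f y + M) x - M)).
      apply: measurable_funB => //; apply: measurableT_comp => //.
      apply: measurable_fun_integral_kernel => //.
      + by move=> U mU; exact: measurable_kernel.
      + by move=> z; rewrite lee_fin; have := fM z; rewrite ler_norml => /andP[]; lra.
      + by apply/measurable_EFinP; have [] := bM.
    apply/funext => x; rewrite /kernel_op bm_integralD//; last exact: bm_cst.
    by rewrite (bm_integral_cst (P1 x)) addrK.
  exists M => x; rewrite (le_trans (le_normr_Rintegral _ _))//; first exact: bm_integrable.
  rewrite -[leRHS](bm_integral_cst (P1 x)); apply: bm_integral_le => //.
    by split; [exact: measurableT_comp|exists M => y; rewrite normr_id].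
  exact: bm_cst.
- rewrite /kernel_op bm_integralD ?bm_integralZ//.
  exact: bmZ.
- by apply: Rintegral_ge0 => y _; exact: f0.
- by rewrite kernel_op1.
- exact: (bm_integral_cvg (P1 x) bF FM Ff).
Qed.

Lemma kernel_opE f x : bm f -> ((kernel_op f x)%:E = \int[P x]_y (f y)%:E)%E.
Proof. by move=> bf; rewrite -bm_integralE. Qed.

Lemma kernel_op_indic A x : measurable A -> (kernel_op \1_A x)%:E = P x A.
Proof. exact: bm_integral_indic. Qed.

Lemma kernel_powE n x A : measurable A ->
  kernel_pow P n x A = (iter n kernel_op \1_A x)%:E.
Proof.
move=> mA; elim: n x => [|n IH] x /=; first by rewrite diracE indicE.
rewrite kernel_opE; last first.
  exact/(sm_bm (submarkov_iter n submarkov_kernel))/bm_indic.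
by apply: eq_integral => y _; rewrite IH.
Qed.

Lemma iter_kernel_op_eq0 (E : set R) f : measurable E ->
  (forall x, E x -> P x E = 1%E) -> bm f -> (forall x, E x -> f x = 0) ->
  forall n x, E x -> iter n kernel_op f x = 0.
Proof.
move=> mE PE bf f0; elim=> [|n IH] x Ex /=; first exact: f0.
rewrite /kernel_op (bm_integral_eq (P1 x) mE (PE x Ex) (g := fun=> 0)).
- exact: bm_integral_cst.
- exact: (sm_bm (submarkov_iter n submarkov_kernel)).
- exact: bm_cst.
- exact: IH.
Qed.

End kernel_operator.

Section markov_property.
Context {R : realType} {d : measure_display} {T : measurableType d}.
Variables (P : R.-pker R ~> R) (mu : probability R R) (Pr : probability T R)
  (X : nat -> T -> R).
Hypothesis hX : markov_chain P mu Pr X.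

Definition past (Y : nat -> T -> R) n : set (set T) :=
  g_sigma_preimage (fun i : 'I_n.+1 => Y i).

Lemma past_sigma Y n : sigma_algebra setT (past Y n).
Proof. exact: smallest_sigma_algebra. Qed.

Lemma past_id Y n : <<s past Y n >> = past Y n.
Proof. exact/sigma_algebra_id/past_sigma. Qed.

Lemma past_gen Y n t A : (t <= n)%N -> measurable A -> past Y n (Y t @^-1` A).
Proof.
move=> tn mA; apply: sub_sigma_algebra.
rewrite -bigcup_mkord_ord/=.
exists t; first by rewrite /= ltnS.
by exists A => //; rewrite setTI inordK.
Qed.

Lemma past_minimal Y n (G : set (set T)) : sigma_algebra setT G ->
  (forall t A, (t <= n)%N -> measurable A -> G (Y t @^-1` A)) -> past Y n `<=` G.
Proof.
move=> sG YG; apply: smallest_sub => // B; rewrite -bigcup_mkord_ord.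
move=> -[t /= tn [A mA <-]]; rewrite setTI inordK//.
exact: YG.
Qed.

Lemma past_measurable n : (forall t, measurable_fun setT (X t)) ->
  past X n `<=` measurable.
Proof.
move=> mX; apply: past_minimal => [|t A _ mA]; first exact: sigma_algebra_measurable.
by rewrite -[X in measurable X]setTI; exact: mX.
Qed.

Lemma past_mono Y n m : (n <= m)%N -> past Y n `<=` past Y m.
Proof.
move=> nm; apply: past_minimal; first exact: past_sigma.
by move=> t A tn mA; apply: past_gen => //; exact: leq_trans nm.
Qed.

(** The bound makes products of adapted functions integrable. *)
Definition adapted Y n (H : T -> R) :=
  @bounded_measurable R _ (g_sigma_algebraType (past Y n)) H.

Lemma adapted_mono Y n m H : (n <= m)%N -> adapted Y n H -> adapted Y m H.
Proof.
move=> nm [mH bH]; split=> // _ A mA.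
have := mH measurableT A mA; rewrite /measurable /= !past_id.
exact: past_mono.
Qed.

Lemma adapted_comp Y n t (f : R -> R) : (t <= n)%N -> bounded_measurable f ->
  adapted Y n (fun w => f (Y t w)).
Proof.
move=> tn [mf [M fM]]; split; last by exists M.
move=> _ A mA; rewrite setTI; apply: sub_sigma_algebra.
rewrite (_ : _ @^-1` _ = Y t @^-1` (f @^-1` A))//.
by apply: past_gen => //; rewrite -[X in measurable X]setTI; exact: mf.
Qed.

Let mX n : measurable_fun setT (X n). Proof. by have [] := hX. Qed.

Lemma adapted_bm n H : adapted X n H -> bounded_measurable H.
Proof. by apply: bm_sub; rewrite past_id; exact: past_measurable. Qed.

Lemma chain_bm n (f : R -> R) : bounded_measurable f -> bounded_measurable (fun w => f (X n w)).
Proof. by move=> bf; apply: (@adapted_bm n); exact: adapted_comp. Qed.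

Lemma markov_property n H (f : R -> R) : adapted X n H -> bounded_measurable f ->
  \int[Pr]_w (H w * f (X n.+1 w)) = \int[Pr]_w (H w * kernel_op P f (X n w)).
Proof.
move=> aH bf; have Pr1 : Pr setT = 1%E by exact: probability_setT.
have smP := submarkov_kernel P.
apply: (@integral_factor R d T Pr (past X n)) => //.
- by rewrite past_id; exact: past_measurable.
- by apply: bm_integrable => //; exact: chain_bm.
- apply: bm_integrable => //.
  by apply: (@chain_bm n (kernel_op P f)); exact: (sm_bm smP).
rewrite past_id => B pB; have mB := past_measurable mX pB.
move: f bf; apply: bm_induction.
- move=> A mA; have [_ _ /(_ n B A pB mA)] := hX.
  under eq_integral do rewrite -kernel_op_indic//.
  move=> h; rewrite /Rintegral -h.
  rewrite (_ : (fun w => (\1_A (X n.+1 w))%:E) = (fun w => (\1_(X n.+1 @^-1` A) w)%:E))//.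
  have mXA : measurable (X n.+1 @^-1` A).
    by rewrite -[X in measurable X]setTI; exact: mX.
  by rewrite integral_indic// (setIC B).
- move=> a f g bf bg fE gE.
  have ib (h : R -> R) k : bounded_measurable h ->
      Pr.-integrable B (EFin \o (fun w => h (X k w))).
    move=> bh; apply: (integrableS measurableT) => //.
    by apply: bm_integrable => //; exact: chain_bm.
  rewrite RintegralD ?RintegralZl//; try exact: ib; last first.
    by apply: (ib (fun x => a * f x)); exact: bmZ.
  under [RHS]eq_Rintegral do rewrite (sm_lin smP)//.
  rewrite RintegralD ?RintegralZl//; try (by apply: (ib _ _ (sm_bm smP _))); last first.
    by apply: (ib (fun x => a * kernel_op P f x)); exact/bmZ/(sm_bm smP).
  by rewrite fE gE.
- move=> F f M bF FM Ff FE; have bf := bm_limit bF FM Ff.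
  have lim (F' : nat -> R -> R) f' k : (forall n, bounded_measurable (F' n)) ->
     (forall n x, `|F' n x| <= M) -> (forall x, F' ^~ x @ \oo --> f' x) ->
     \int[Pr]_(w in B) F' n (X k w) @[n --> \oo] --> \int[Pr]_(w in B) f' (X k w).
    move=> bF' F'M F'f'; rewrite Rintegral_indicM.
    under eq_fun do rewrite Rintegral_indicM.
    apply: (@bm_integral_cvg _ _ _ _ Pr1 _ _ M) => [j|j w|w].
    + by apply: bmM; [exact: bm_indic|exact: chain_bm].
    + rewrite normrM (le_trans _ (F'M j (X k w)))// ler_piMl//.
      by rewrite indicE ger0_norm ?ler0n// lern1 leq_b1.
    + by apply: cvgM; [exact: cvg_cst|exact: F'f'].
  rewrite -(cvg_lim _ (lim F f n.+1 bF FM Ff))//.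
  rewrite -(cvg_lim _ (lim (fun j => kernel_op P (F j)) (kernel_op P f) n _ _ _))//.
  + by under eq_fun do rewrite FE.
  + by move=> j; exact: (sm_bm smP).
  + by move=> j x; exact: (sm_norm smP).
  + by move=> x; exact: (sm_cvg smP bF FM Ff).
Qed.

End markov_property.
(** * Subharmonic functions of a Harris recurrent chain *)

Section chain_support.
Context {R : realType} {d : measure_display} {T : measurableType d}.
Variables (P : R.-pker R ~> R) (mu : probability R R) (Pr : probability T R)
  (X : nat -> T -> R).
Hypothesis hX : markov_chain P mu Pr X.
Let mX n : measurable_fun setT (X n). Proof. by have [] := hX. Qed.
Let Pr1 : Pr setT = 1%E. Proof. exact: probability_setT. Qed.

Lemma chain_init (f : R -> R) : bounded_measurable f ->
  \int[Pr]_w f (X 0%N w) = \int[mu]_x f x.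
Proof.
move=> bf; congr fine.
have -> : (\int[mu]_x (f x)%:E = \int[pushforward Pr (X 0%N)]_x (f x)%:E)%E.
  apply: eq_measure_integral => A mA _.
  by have [_ h0 _] := hX; exact: (esym (h0 A mA)).
rewrite integral_pushforward ?preimage_setT//.
  by apply/measurable_EFinP; have [] := bf.
by apply: bm_integrable => //; exact: (chain_bm hX).
Qed.

Lemma chain_preimage_measurable n A : measurable A -> measurable (X n @^-1` A).
Proof. by move=> mA; rewrite -[Z in measurable Z]setTI; exact: mX. Qed.

Lemma chain_in (E : set R) : measurable E -> (forall x, E x -> P x E = 1%E) ->
  mu E = 1%E -> forall n, Pr (X n @^-1` E) = 1%E.
Proof.
move=> mE PE muE; elim=> [|n IH]; first by have [_ ->] := hX.
have mpE := chain_preimage_measurable n mE.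
have bmP : bounded_measurable (fun w => kernel_op P \1_E (X n w)).
  apply: (chain_bm hX); apply: (sm_bm (submarkov_kernel P)); exact: bm_indic.
rewrite -(bm_integral_indic Pr1); last exact: chain_preimage_measurable.
have /= := markov_property hX (n := n) (H := fun=> 1) (bm_cst 1) (bm_indic mE).
under eq_Rintegral do rewrite mul1r.
under [RHS]eq_Rintegral do rewrite mul1r.
rewrite (bm_integral_eq Pr1 mpE IH bmP (bm_cst 1)) ?bm_integral_cst//.
  by move=> <-.
move=> w Ew; have := kernel_op_indic P (X n w) mE.
by rewrite PE// => -[].
Qed.

End chain_support.

Section harris.
Context {R : realType} {d : measure_display} {T : measurableType d}.
Variables (E : set R) (P : R.-pker R ~> R)
  (psi : {sigma_finite_measure set R -> \bar R}) (X : nat -> T -> R)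
  (PP : probability R R -> probability T R).
Hypotheses (mE : measurable E) (PE : forall x, E x -> P x E = 1%E)
  (psiE : (0 < psi E)%E) (hPP : markov_family P X PP)
  (hH : harris_recurrent E psi X PP).
Local Notation Pop := (kernel_op P).
Let smP := submarkov_kernel P.
Let PP1 x : PP \d_x setT = 1%E. Proof. exact: probability_setT. Qed.

Let unhit A n (w : T) : R := \prod_(t < n) (1 - \1_A (X t w)).

Let unhitS A n w : unhit A n.+1 w = unhit A n w * (1 - \1_A (X n w)).
Proof. by rewrite /unhit big_ord_recr. Qed.

Let unhit01 A n w : unhit A n w = 0 \/ unhit A n w = 1.
Proof.
elim: n => [|n IH]; first by right; rewrite /unhit big_ord0.
rewrite unhitS indicE; case: (_ \in _); first by left; rewrite subrr mulr0.
by rewrite subr0 mulr1.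
Qed.

Let unhit_adapted A n : measurable A -> adapted X n (unhit A n.+1).
Proof.
move=> mA; have bA : bounded_measurable (fun x : R => 1 - \1_A x : R).
  by apply: bmB; [exact: bm_cst|exact: bm_indic].
have h k : (k <= n.+1)%N -> adapted X n (unhit A k).
  elim: k => [_|k IH kn].
    rewrite (_ : unhit A 0 = (fun=> 1)); first exact: bm_cst.
    by apply/funext => w; rewrite /unhit big_ord0.
  rewrite (_ : unhit A k.+1 = (fun w => unhit A k w * (1 - \1_A (X k w)))).
    by apply: bmM; [exact/IH/ltnW|exact: (@adapted_comp _ _ _ X n k _ kn bA)].
  by apply/funext => w; rewrite unhitS.
exact: h.
Qed.

Let unhit_cvg x A : E x -> measurable A -> A `<=` E -> (0 < psi A)%E ->
  \int[PP \d_x]_w unhit A n w @[n --> \oo] --> (0 : R).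
Proof.
move=> Ex mA AE psiA; have hX := hPP \d_x.
pose f (w : T) : R := `[< forall t, ~ A (X t w) >]%:R.
have bu n : bounded_measurable (unhit A n).
  case: n => [|n]; last by apply: (adapted_bm hX (n := n)); exact: unhit_adapted.
  rewrite (_ : unhit A 0 = (fun=> 1)); first exact: bm_cst.
  by apply/funext => w; rewrite /unhit big_ord0.
have u1 n w : `|unhit A n w| <= 1.
  by case: (unhit01 A n w) => ->; rewrite ?normr0 ?normr1.
have uf w : unhit A n w @[n --> \oo] --> f w.
  rewrite /f; case: asboolP => [h|].
    rewrite (_ : (fun n => _) = (fun=> 1)); first exact: cvg_cst.
    apply/funext => n; rewrite /unhit big1// => t _.
    by rewrite indicE memNset ?subr0.
  move=> /existsNP[t /contrapT At]; apply: cvg_near_cst.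
  exists t.+1 => // n /= tn; rewrite /unhit (bigD1 (Ordinal tn))//=.
  by rewrite indicE mem_set// subrr mul0r.
suff <- : \int[PP \d_x]_w f w = 0 by exact: (bm_integral_cvg (PP1 x) bu u1 uf).
have mXA n : measurable (X n @^-1` A) by exact: (chain_preimage_measurable hX).
rewrite (bm_integral_eq (PP1 x) _ (hH Ex mA AE psiA) _ (bm_cst 0)).
- exact: (bm_integral_cst (PP1 x)).
- by apply: bigcapT_measurable => n; apply: bigcup_measurable.
- exact: bm_limit bu u1 uf.
move=> w /(_ 0%N I)[t _ At]; rewrite /f; case: asboolP => // h.
by have := h t.
Qed.

(** Stop the submartingale [h (X_n)] when it first falls below [a]: Harris
    recurrence makes that time finite. *)
Lemma subharmonic_le (h : R -> R) (a : R) : bounded_measurable h ->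
  (forall x, E x -> h x <= Pop h x) ->
  (0 < psi (E `&` [set x | (h x < a)%R]))%E -> forall x, E x -> h x <= a.
Proof.
move=> bh hP psia x Ex; have hX := hPP \d_x; have [mh [M hM]] := bh.
set A := E `&` _ in psia.
have mA : measurable A.
  by apply: measurableI => //; rewrite -[Z in measurable Z]setTI; exact: measurable_fun_ltr.
have AE : A `<=` E by move=> y [].
have dE : (\d_x E = 1 :> \bar R)%E by rewrite diracE mem_set.
have Xin n := chain_in hX mE PE dE n.
pose c n w := unhit A n.+1 w.
have c01 n w : c n w = 0 \/ c n w = 1 by exact: unhit01.
have bc n : bounded_measurable (c n) by apply: (adapted_bm hX); exact: unhit_adapted.
have bXh k : bounded_measurable (fun w => h (X k w)) by exact: (chain_bm hX).
pose Z n w := h (X 0%N w) + \sum_(t < n) c t w * (h (X t.+1 w) - h (X t w)).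
have bdZ t : bounded_measurable (fun w => c t w * (h (X t.+1 w) - h (X t w))).
  by apply: bmM => //; exact: bmB.
have bZ n : bounded_measurable (Z n) by apply: bmD => //; exact: bm_sum.
have Zle n w : Z n w <= a * (1 - c n w) + h (X n w) * c n w.
  elim: n => [|n IH].
    rewrite /Z big_ord0 addr0 /c unhitS /unhit big_ord0 mul1r indicE.
    by case: (boolP (_ \in A)) => [/set_mem[_ /= /ltW]|_] /=; lra.
  rewrite /Z big_ord_recr/= addrA -/(Z n w).
  rewrite {2 3}/c unhitS -/(c n w) indicE.
  case: (boolP (_ \in A)) => [/set_mem[_ /= /ltW ha]|_].
    by rewrite /=; case: (c01 n w) => cE; rewrite cE in IH *; lra.
  by rewrite /=; case: (c01 n w) => cE; rewrite cE in IH *; lra.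
have EZ n : h x <= \int[PP \d_x]_w Z n w.
  have hx : \int[\d_x]_y h y = h x.
    rewrite /Rintegral integral_dirac ?diracT ?mul1e//.
    exact/measurable_EFinP.
  rewrite (bm_integralD (PP1 x))//; last exact: bm_sum.
  rewrite (chain_init hX bh) hx lerDl (bm_integral_sum (PP1 x))//.
  apply: sumr_ge0 => t _.
  under eq_Rintegral do rewrite mulrBr.
  rewrite (bm_integralB (PP1 x))//; try exact: bmM.
  rewrite (markov_property hX)//; last exact: unhit_adapted.
  have bcP : bounded_measurable (fun w => c t w * Pop h (X t w)).
    by apply: bmM => //; apply: (chain_bm hX); exact: (sm_bm smP).
  rewrite -(bm_integralB (PP1 x))//; last exact: bmM.
  have b1 : bounded_measurable (fun w => c t w * Pop h (X t w) - c t w * h (X t w)).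
    apply: bmB; apply: bmM => //; apply: (chain_bm hX); exact: (sm_bm smP).
  have mXE := chain_preimage_measurable hX t mE.
  rewrite (bm_integral_eq (PP1 x) mXE (Xin t) b1 (bmM b1 (bm_indic mXE))).
    apply: Rintegral_ge0 => w _; rewrite indicE -mulrBr.
    case: (boolP (w \in _)) => [/set_mem Ew|]; last by rewrite mulr0.
    rewrite mulr1 mulr_ge0 ?subr_ge0 ?hP//.
    by case: (c01 t w) => ->.
  by move=> w Ew; rewrite indicE mem_set// mulr1.
have lec n : h x <= a + (M + `|a|) * \int[PP \d_x]_w c n w.
  apply: (le_trans (EZ n)); rewrite -(bm_integralZ (PP1 x))//.
  rewrite -{1}(bm_integral_cst (PP1 x) a) -(bm_integralD (PP1 x))//; [|exact: bm_cst|exact: bmZ].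
  apply: (bm_integral_le (PP1 x)) => //.
    by apply: bmD; [exact: bm_cst|exact: bmZ].
  move=> w; apply: (le_trans (Zle n w)).
  have := hM (X n w); rewrite ler_norml => /andP[_ h1].
  have := ler_norm (- a); rewrite normrN => h2.
  by case: (c01 n w) => ->; lra.
have cv : a + (M + `|a|) * \int[PP \d_x]_w c n w @[n --> \oo] --> a + (M + `|a|) * 0.
  apply: cvgD; first exact: cvg_cst.
  apply: cvgM; first exact: cvg_cst.
  rewrite (cvg_shiftS (fun n => \int[PP \d_x]_w unhit A n w)).
  exact: unhit_cvg.
rewrite mulr0 addr0 in cv; rewrite -(cvg_lim _ cv)//.
by apply: limr_ge; [apply/cvg_ex; eexists; exact: cv|exact: nearW].
Qed.

Lemma kernel_op_le_on (h : R -> R) (S : R) x : bounded_measurable h ->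
  (forall y, E y -> h y <= S) -> E x -> Pop h x <= S.
Proof.
move=> bh hS Ex; have P1 : P x setT = 1%E by exact: prob_kernel.
have bg : bounded_measurable (fun y => h y * \1_E y + S * (1 - \1_E y)).
  have bE := bm_indic (R := R) mE.
  by apply: bmD; apply: bmM => //; [exact: bm_cst|apply: bmB => //; exact: bm_cst].
rewrite /kernel_op (bm_integral_eq P1 mE (PE Ex) bh bg); last first.
  by move=> y Ey; rewrite indicE mem_set// mulr1 subrr mulr0 addr0.
rewrite -[leRHS](bm_integral_cst P1); apply: bm_integral_le => //; first exact: bm_cst.
move=> y; rewrite indicE; case: (boolP (y \in E)) => [/set_mem/hS|_] /=; lra.
Qed.

(** By [subharmonic_le], [h] is within [e / 2] of its supremum almost everywhere on
    [E]; at such a point of [D] the mean of [h] after one step would exceed the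
    supremum. *)
Lemma subharmonic_no_gain (h : R -> R) (D : set R) (e : R) : bounded_measurable h ->
  (forall x, E x -> h x <= Pop h x) -> measurable D -> D `<=` E ->
  (0 < psi D)%E -> 0 < e -> ~ (forall x, D x -> h x + e <= Pop h x).
Proof.
move=> bh hP mD DE psiD e0 gain; have [mh [M hM]] := bh.
have [x0 Ex0] : E !=set0.
  apply/set0P; apply: contraTneq psiE => ->; by rewrite measure0 ltxx.
have hsE : has_sup (h @` E).
  split; first by exists (h x0), x0.
  by exists M => _ [y _ <-]; rewrite (le_trans (ler_norm _)).
pose S := sup (h @` E).
have hS y : E y -> h y <= S.
  by move=> Ey; apply: sup_upper_bound => //; exists y.
have low : psi (E `&` [set x | (h x < S - e / 2)%R]) = 0%E.
  apply/eqP; rewrite eq_le measure_ge0 andbT leNgt; apply/negP => pos.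
  have := subharmonic_le bh hP pos => le.
  have : S <= S - e / 2 by apply: ge_sup; [by exists (h x0), x0|move=> _ [y Ey <-]; exact: le].
  by move: (S) => S'; lra.
have [y Dy hy] : exists2 y, D y & S - e / 2 <= h y.
  apply: contrapT => no; move: psiD; apply/negP; rewrite -leNgt -low.
  apply: le_measure; rewrite ?inE//.
    by apply: measurableI => //; rewrite -[Z in measurable Z]setTI; exact: measurable_fun_ltr.
  move=> y Dy; split; first exact: DE.
  by rewrite /= ltNge; apply/negP => hy; apply: no; exists y.
have := kernel_op_le_on bh hS (DE _ Dy); have := gain y Dy.
by move: (S) hy (Pop h y) => S' hy p; lra.
Qed.

(** If [h y < h x], then on a set of positive measure [h] is below their midpoint, or
    else at least equal to it; [subharmonic_le] for [h], respectively [- h], forbids both. *)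
Lemma harmonic_constant (h : R -> R) : bounded_measurable h ->
  (forall x, E x -> Pop h x = h x) -> forall x y, E x -> E y -> h x = h y.
Proof.
move=> bh hP; have [mh _] := bh.
suff le x y : E x -> E y -> h x <= h y.
  by move=> x y Ex Ey; apply/eqP; rewrite eq_le !le.
move=> Ex Ey; rewrite leNgt; apply/negP => hyx.
pose a := (h x + h y) / 2.
have mlt b : measurable (E `&` [set z | (h z < b)%R]).
  by apply: measurableI => //; rewrite -[Z in measurable Z]setTI; exact: measurable_fun_ltr.
have mge b : measurable (E `&` [set z | (b <= h z)%R]).
  by apply: measurableI => //; rewrite -[Z in measurable Z]setTI; exact: measurable_fun_ler.
have := measure_ge0 psi (E `&` [set z | (h z < a)%R]).
rewrite le_eqVlt => /orP[/eqP/esym psi0|pos]; last first.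
  have hP' z : E z -> h z <= Pop h z by move=> Ez; rewrite hP.
  by have := subharmonic_le bh hP' pos Ex; rewrite /a; lra.
have pos : (0 < psi (E `&` [set z | (a <= h z)%R]))%E.
  rewrite (lt_le_trans psiE)//.
  have EU : E = (E `&` [set z | (h z < a)%R]) `|` (E `&` [set z | (a <= h z)%R]).
    rewrite -setIUr; apply/esym/setIidPl => z _ /=.
    by case: (ltP (h z) a); [left|right].
  rewrite {1}EU (le_trans (measureU2 _ (mlt a) (mge a)))//.
  by rewrite psi0 add0e.
have bN : bounded_measurable (fun z => - h z) by exact: bmN.
have PN z : Pop (fun u => - h u) z = - Pop h z.
  have := smZ smP (-1) z bh; rewrite mulN1r => <-.
  by congr (Pop _ z); apply/funext => u; rewrite mulN1r.
have := @subharmonic_le (fun z => - h z) (- ((a + h y) / 2)) bN _ _ y Ey.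
rewrite lerN2 => h1.
suff : (a + h y) / 2 <= h y by rewrite /a; lra.
apply: h1 => [z Ez|]; first by rewrite PN hP.
apply: (lt_le_trans pos); apply: le_measure; rewrite ?inE//.
  apply: measurableI => //; rewrite -[Z in measurable Z]setTI.
  by apply: measurable_fun_ltr => //; have [] := bN.
by move=> z [Ez /= az]; split => //=; rewrite ltrN2; rewrite /a in az *; lra.
Qed.

End harris.
(** * Regeneration: splitting a rank-one kernel off the resolvent *)

Section minorization.
Context {R : realType}.
Variables (P : R.-pker R ~> R) (e : R) (s : R -> R) (nu : probability R R).
Local Notation bm := (@bounded_measurable R _ R).
Local Notation Pop := (kernel_op P).

(** The chain is observed after a first step followed by a geometric number of
    further ones; [sampled] is the kernel of the observed chain. *)
Definition resolvent_mean : (R -> R) -> R -> R := geometric_mean e Pop.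
Definition sampled (f : R -> R) : R -> R := Pop (resolvent_mean f).

(** The part of the sampled kernel during which no regeneration occurs. *)
Definition taboo (f : R -> R) (x : R) : R := sampled f x - s x * \int[nu]_y f y.

Hypotheses (e0 : 0 <= e) (e1 : e < 1) (bs : bm s) (s0 : forall x, 0 <= s x).
Hypothesis minor : forall f, bm f -> (forall x, 0 <= f x) ->
  forall x, s x * \int[nu]_y f y <= sampled f x.
Local Notation A := resolvent_mean.
Local Notation U := sampled.
Local Notation K := taboo.
Let smP := submarkov_kernel P.
Let nu1 : nu setT = 1%E. Proof. exact: probability_setT. Qed.

Lemma submarkov_resolvent_mean : submarkov A.
Proof. exact: submarkov_geometric_mean. Qed.
Let smA := submarkov_resolvent_mean.

Lemma resolvent_meanE f x : bm f -> A f x = (1 - e) * f x + e * U f x.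
Proof. exact: geometric_meanE. Qed.

Lemma resolvent_mean1 x : A (fun=> 1) x = 1.
Proof.
pose h y := 1 - A (fun=> 1) y.
have bh : bm h by apply: bmB; [exact: bm_cst|exact/(sm_bm smA)/bm_cst].
have hE y : h y = e * Pop h y.
  rewrite /h resolvent_meanE; last exact: bm_cst.
  rewrite (smB smP) ?kernel_op1; [|exact: bm_cst|exact/(sm_bm smA)/bm_cst].
  by rewrite /U; ring.
have [_ [M hM]] := bh.
have hn n : forall y, `|h y| <= M * e ^+ n.
  elim: n => [|n IH] y; first by rewrite expr0 mulr1.
  rewrite hE normrM ger0_norm// exprS mulrCA ler_wpM2l//.
  exact: (sm_norm smP).
have : M * e ^+ n @[n --> \oo] --> M * 0.
  by apply: cvgM; [exact: cvg_cst|apply: cvg_expr; rewrite ger0_norm].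
rewrite mulr0 => cv.
have : `|h x| <= 0.
  rewrite -(cvg_lim _ cv)//; apply: limr_ge; last exact: nearW.
  by apply/cvg_ex; eexists; exact: cv.
by rewrite normr_le0 subr_eq0 => /eqP.
Qed.

Lemma submarkov_sampled : submarkov U.
Proof.
split=> [f bf|a f g bf bg x|f bf f0 x|x|F f M bF FM Ff x].
- exact/(sm_bm smP)/(sm_bm smA).
- rewrite /U -(sm_lin smP); [|exact: (sm_bm smA)|exact: (sm_bm smA)].
  by congr (Pop _ x); apply/funext => y; rewrite (sm_lin smA).
- by apply: (sm_ge0 smP); [exact: (sm_bm smA)|exact: (sm_ge0 smA)].
- apply: (sm_le_cst smP) => //; first exact/(sm_bm smA)/bm_cst.
  exact: (sm_le1 smA).
- apply: (@sm_cvg _ _ smP (fun n => A (F n)) _ M) => [n|n y|].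
  + exact: (sm_bm smA).
  + exact: (sm_norm smA).
  + exact: (sm_cvg smA bF FM Ff).
Qed.
Let smU := submarkov_sampled.

Lemma sampled1 x : U (fun=> 1) x = 1.
Proof.
rewrite /U (_ : A (fun=> 1) = (fun=> 1)) ?kernel_op1//.
by apply/funext => y; rewrite resolvent_mean1.
Qed.

(** The resolvent turns a Poisson equation of the sampled kernel into one of
    the chain itself. *)
Lemma resolvent_poisson f x : bm f -> A f x - Pop (A f) x = (1 - e) * (f x - U f x).
Proof. by move=> bf; rewrite resolvent_meanE// /U; ring. Qed.

Lemma submarkov_taboo : submarkov K.
Proof.
split=> [f bf|a f g bf bg x|f bf f0 x|x|F f M bF FM Ff x].
- apply: bmB; first exact: (sm_bm smU).
  by apply: bmM => //; exact: bm_cst.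
- rewrite /K (sm_lin smU)// bm_integralD// ?bm_integralZ//; first by ring.
  exact: bmZ.
- by rewrite subr_ge0 minor.
- by rewrite /K sampled1 bm_integral_cst// mulr1 gerBl.
- apply: cvgB; first exact: (sm_cvg smU bF FM Ff).
  apply: cvgM; first exact: cvg_cst.
  exact: (bm_integral_cvg nu1 bF FM Ff).
Qed.
Let smK := submarkov_taboo.
Let smKn n := submarkov_iter n smK.

Lemma taboo1 x : K (fun=> 1) x = 1 - s x.
Proof. by rewrite /K sampled1 bm_integral_cst// mulr1. Qed.

Lemma sampledE f x : U f x = K f x + s x * \int[nu]_y f y.
Proof. by rewrite /K subrK. Qed.

(** Probability that no regeneration occurs in [n] steps from [x]. *)
Definition survival n (x : R) : R := iter n K (fun=> 1) x.

Lemma bm_survival n : bm (survival n).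
Proof. exact/(sm_bm (smKn n))/bm_cst. Qed.

Lemma survival_ge0 n x : 0 <= survival n x.
Proof. by apply: (sm_ge0 (smKn n)) => //; exact: bm_cst. Qed.

Lemma survival_le1 n x : survival n x <= 1.
Proof. exact: (sm_le1 (smKn n)). Qed.

Lemma iter_survival m n x : iter m K (survival n) x = survival (m + n) x.
Proof. by rewrite /survival iterD. Qed.

Lemma survival_anti m n x : (m <= n)%N -> survival n x <= survival m x.
Proof.
move=> /subnKC <-; rewrite -iter_survival -[leRHS]addr0 addr0.
rewrite {2}/survival; apply: (sm_le (smKn m)).
- exact: bm_survival.
- exact: bm_cst.
- by move=> y; exact: survival_le1.
Qed.

Lemma iter_taboo_s t x : iter t K s x = survival t x - survival t.+1 x.
Proof.
have sE : s = (fun y => (fun=> 1) y - K (fun=> 1) y).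
  by apply/funext => y; rewrite taboo1; ring.
rewrite {1}sE (smB (smKn t)); [|exact: bm_cst|exact/(sm_bm smK)/bm_cst].
by rewrite -iterSr.
Qed.

Lemma sum_survival n j x :
  \sum_(t < n) (survival (t + j) x - survival (t + j).+1 x) <= 1.
Proof.
rewrite -(big_mkord xpredT (fun t => survival (t + j) x - survival (t + j).+1 x)).
rewrite (telescope_sumr_eq (fun t => - survival (t + j) x))//; last first.
  by move=> k _; rewrite opprK addrC addSn.
rewrite opprK add0n addrC (le_trans _ (survival_le1 j x))// gerBl.
exact: survival_ge0.
Qed.

(** [tail_prob n] is the probability that a block is longer than [n]. *)
Definition tail_prob n : R := \int[nu]_x survival n x.

Lemma tail_prob_ge0 n : 0 <= tail_prob n.
Proof. by apply: Rintegral_ge0 => x _; exact: survival_ge0. Qed.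

Lemma tail_prob_anti m n : (m <= n)%N -> tail_prob n <= tail_prob m.
Proof.
move=> mn; apply: (bm_integral_le nu1) => [||x]; [exact: bm_survival..|].
exact: survival_anti.
Qed.

Lemma survival_limit : exists q, [/\ bm q, forall x, 0 <= q x,
  forall x, survival n x @[n --> \oo] --> q x & forall x, K q x = q x].
Proof.
pose q x := limn (fun n => survival n x).
have cvq x : survival n x @[n --> \oo] --> q x.
  apply: nonincreasing_is_cvgn.
    by move=> m n mn; exact: survival_anti.
  by exists 0 => _ [n _ <-]; exact: survival_ge0.
have sn n x : `|survival n x| <= 1 by rewrite ger0_norm ?survival_ge0 ?survival_le1.
exists q; split=> // [|x|x].
- exact: bm_limit bm_survival sn cvq.
- apply: limr_ge; last by apply: nearW => n; exact: survival_ge0.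
  by apply/cvg_ex; eexists; exact: cvq.
- have c1 : survival n.+1 x @[n --> \oo] --> q x.
    by rewrite (cvg_shiftS (fun n => survival n x)); exact: cvq.
  rewrite -[RHS](cvg_lim _ c1)//; apply/esym/cvg_lim => //.
  exact: (sm_cvg smK bm_survival sn cvq).
Qed.

Section recurrence.
Variable E : set R.
Hypotheses (mE : measurable E) (PE : forall x, E x -> P x E = 1%E)
  (nuE : nu E = 1%E).

(** The probability [q] of never regenerating has [nu]-mean zero, so that it is
    invariant under [U] and not only under [K]; it is then harmonic, hence constant,
    hence equal to its mean. *)
Lemma survival_vanishes :
  (forall h, bm h -> (forall x, E x -> Pop h x = h x) ->
    forall x y, E x -> E y -> h x = h y) ->
  tail_prob n @[n --> \oo] --> (0 : R) ->
  forall x, E x -> survival n x @[n --> \oo] --> (0 : R) /\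
    A (survival n) x @[n --> \oo] --> (0 : R).
Proof.
move=> hconst tp0; have [q [bq q0 cvq Kq]] := survival_limit.
have sn n x : `|survival n x| <= 1 by rewrite ger0_norm ?survival_ge0 ?survival_le1.
have nuq : \int[nu]_x q x = 0.
  have := bm_integral_cvg nu1 bm_survival sn cvq.
  by move/cvg_lim => <-//; exact/cvg_lim.
have Uq x : U q x = q x by rewrite sampledE nuq mulr0 addr0 Kq.
have Aq x : A q x = q x by rewrite resolvent_meanE// Uq; ring.
have PA x : Pop (A q) x = A q x by rewrite Aq; exact: Uq.
have bA : bm (A q) by exact: (sm_bm smA).
have qc x y : E x -> E y -> q x = q y.
  by move=> Ex Ey; rewrite -2!Aq; apply: hconst.
have qE x : E x -> q x = 0.
  move=> Ex; rewrite -nuq -[LHS](bm_integral_cst nu1).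
  by apply: (bm_integral_eq nu1 mE nuE) => //; [exact: bm_cst|move=> y; exact: qc].
move=> x Ex; split; first by rewrite -(qE x Ex); exact: cvq.
rewrite -(qE x Ex) -Aq; exact: (sm_cvg smA bm_survival sn cvq).
Qed.

Lemma resolvent_subharmonic q : bm q -> (forall x, K q x = q x) ->
  forall x, Pop (A q) x = A q x + (1 - e) * s x * \int[nu]_y q y.
Proof.
move=> bq Kq x; have := resolvent_poisson x bq.
by rewrite sampledE Kq => /eqP; rewrite subr_eq => /eqP ->; ring.
Qed.

(** If the probability [q] of never regenerating had a positive [nu]-mean, then
    [A q] would be subharmonic and gain a fixed amount at each step from [D]. *)
Lemma tail_prob_cvg0 (D : set R) (eta : R) :
  (forall h d, bm h -> (forall x, E x -> h x <= Pop h x) -> 0 < d ->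
    ~ (forall x, D x -> h x + d <= Pop h x)) ->
  0 < eta -> (forall x, D x -> eta <= s x) ->
  tail_prob n @[n --> \oo] --> (0 : R).
Proof.
move=> nogain eta0 sD; have [q [bq q0 cvq Kq]] := survival_limit.
have sn n x : `|survival n x| <= 1 by rewrite ger0_norm ?survival_ge0 ?survival_le1.
have cv := bm_integral_cvg nu1 bm_survival sn cvq.
suff <- : \int[nu]_x q x = 0 by exact: cv.
have q_ge0 : 0 <= \int[nu]_x q x by apply: Rintegral_ge0.
apply/eqP; rewrite eq_le q_ge0 andbT leNgt; apply/negP => q_gt0.
have PA := resolvent_subharmonic bq Kq.
apply: (nogain (A q) ((1 - e) * eta * \int[nu]_y q y)).
- exact: (sm_bm smA).
- by move=> x _; rewrite PA lerDl !mulr_ge0// subr_ge0 ltW.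
- by rewrite !mulr_gt0// subr_gt0.
- by move=> x Dx; rewrite PA lerD2l ler_pM2r// ler_pM2l ?subr_gt0// sD.
Qed.

End recurrence.

Section potential.
Variables (C : set R) (c : R) (J : nat).
Hypotheses (c0 : 0 <= c)
  (dom : forall x, \1_C x <= c * (1 - survival J x)).

Lemma survival_sumE x : 1 - survival J x = \sum_(j < J) iter j K s x.
Proof.
rewrite -(big_mkord xpredT (fun j => iter j K s x)).
rewrite (telescope_sumr_eq (fun j => - survival j x))//; last first.
  by move=> k _; rewrite opprK addrC; exact: iter_taboo_s.
by rewrite opprK addrC.
Qed.

(** From [C] a regeneration occurs within [J] steps with probability at least
    [1 / c], so that a visit to [B] is charged to a regeneration at most [J] steps
    later. *)
Lemma iter_taboo_indic_le (B : set R) n x : measurable B -> B `<=` C ->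
  iter n K \1_B x <= c * \sum_(j < J) iter (n + j) K s x.
Proof.
move=> mB BC; have bJ : bm (fun y => c * \sum_(j < J) iter j K s y).
  by apply/bmZ/bm_sum => j; exact: (sm_bm (smKn j)).
apply: (@le_trans _ _ (iter n K (fun y => c * \sum_(j < J) iter j K s y) x)).
  apply: (sm_le (smKn n)) => //; first exact: bm_indic.
  move=> y; rewrite -survival_sumE (le_trans _ (dom y))//.
  by rewrite !indicE ler_nat; case: (boolP (y \in B)) => // /set_mem/BC yC; rewrite mem_set.
rewrite (smZ (smKn n)); last by apply: bm_sum => j; exact: (sm_bm (smKn j)).
rewrite (sm_sum (smKn n)); last by move=> j; exact: (sm_bm (smKn j)).
by under eq_bigr do rewrite -iterD.
Qed.

Lemma sum_iter_taboo_indic_le (B : set R) n x : measurable B -> B `<=` C ->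
  \sum_(t < n) iter t K \1_B x <= c * J%:R.
Proof.
move=> mB BC.
apply: (@le_trans _ _ (\sum_(t < n) c * \sum_(j < J) iter (t + j) K s x)).
  by apply: ler_sum => t _; exact: iter_taboo_indic_le.
rewrite -mulr_sumr ler_wpM2l// exchange_big/=.
rewrite -[J in leRHS]card_ord -sum1_card natr_sum; apply: ler_sum => j _.
by under eq_bigr do rewrite iter_taboo_s; exact: sum_survival.
Qed.

(** The expected number [g] of visits to [B] before the next regeneration is bounded
    and satisfies [g = 1_B + K g]. With [a] its [nu]-mean, the number of visits per
    block, this reads [1_B - a s = g - U g], a Poisson equation for [U], from which
    [resolvent_poisson] gives one for [P]. *)
Lemma poisson_equation (B : set R) : measurable B -> B `<=` C ->
  exists a h, [/\ \sum_(t < n) \int[nu]_x iter t K \1_B x @[n --> \oo] --> a,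
    bm h, forall x, 0 <= h x <= c * J%:R / (1 - e) &
    forall x, \1_B x - s x * a = h x - Pop h x].
Proof.
move=> mB BC; have bB := bm_indic (R := R) mB.
have [|n x|g [bg g0 gE gcv]] := @potential_bounded R K \1_B (c * J%:R) smK bB.
- by move=> x; rewrite indicE.
- exact: sum_iter_taboo_indic_le.
exists (\int[nu]_x g x), (fun x => (1 - e)^-1 * A g x); split.
- have bt t : bm (iter t K \1_B) by exact: (sm_bm (smKn t)).
  under eq_fun do rewrite -(bm_integral_sum nu1)//.
  apply: (@bm_integral_cvg _ _ _ _ nu1 _ _ (c * J%:R)) => // [n|n x].
    exact: bm_sum.
  rewrite ger0_norm ?sum_iter_taboo_indic_le//; apply: sumr_ge0 => t _.
  by apply: (sm_ge0 (smKn t)) => // y; rewrite indicE.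
- exact/bmZ/(sm_bm smA).
- move=> x; rewrite mulrC divr_ge0 ?subr_ge0 ?(ltW e1)//=; last first.
    by apply: (sm_ge0 smA) => // y; have /andP[] := g0 y.
  rewrite ler_pM2r ?invr_gt0 ?subr_gt0//; apply: (sm_le_cst smA) => //.
    by rewrite mulr_ge0.
  by move=> y; have /andP[] := g0 y.
- move=> x; rewrite (smZ smP); last exact: (sm_bm smA).
  rewrite -mulrBr resolvent_poisson// mulKf ?gt_eqF ?subr_gt0//.
  by rewrite sampledE gE; ring.
Qed.

End potential.
End minorization.
(** * The invariant measure in terms of blocks *)

Section invariant.
Context {R : realType}.
Variables (P : R.-pker R ~> R) (e : R) (s : R -> R) (nu : probability R R)
  (pi : {measure set R -> \bar R}).
Local Notation bm := (@bounded_measurable R _ R).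
Local Notation Pop := (kernel_op P).
Local Notation A := (resolvent_mean P e).
Local Notation U := (sampled P e).
Local Notation K := (taboo P e s nu).
Hypotheses (e0 : 0 <= e) (e1 : e < 1) (bs : bm s) (s0 : forall x, 0 <= s x).
Hypothesis minor : forall f, bm f -> (forall x, 0 <= f x) ->
  forall x, s x * \int[nu]_y f y <= U f x.
Hypothesis inv : forall B, measurable B -> pi B = (\int[pi]_x P x B)%E.
Let smP := submarkov_kernel P.
Let smA := submarkov_resolvent_mean P e0 e1.
Let smU := submarkov_sampled P e0 e1.
Let smK := submarkov_taboo e0 e1 bs s0 minor.
Let smKn n := submarkov_iter n smK.
Let nu1 : nu setT = 1%E. Proof. exact: probability_setT. Qed.

Let mE f : bm f -> measurable_fun setT (fun x => (f x)%:E).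
Proof. by move=> [mf _]; exact/measurable_EFinP. Qed.

(** The measure may be infinite: the monotone form of the induction on bounded
    functions is essential. *)
Lemma inv_kernel_op f : bm f -> (forall x, 0 <= f x) ->
  (\int[pi]_x (Pop f x)%:E = \int[pi]_x (f x)%:E)%E.
Proof.
move: f; apply: bm_ge0_induction.
- by under eq_integral do rewrite (sm_zero smP).
- move=> a B g a0 mB bg g0 IH.
  have bB := bm_indic (R := R) mB.
  under eq_integral do rewrite (sm_lin smP)// EFinD EFinM.
  under [RHS]eq_integral do rewrite EFinD EFinM.
  have PB0 x : (0 <= (Pop \1_B x)%:E)%E.
    by rewrite lee_fin; apply: (sm_ge0 smP) => // y; rewrite indicE.
  have Pg0 x : (0 <= (Pop g x)%:E)%E by rewrite lee_fin; exact: (sm_ge0 smP).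
  have iB0 x : (0 <= (\1_B x : R)%:E)%E by rewrite lee_fin indicE.
  rewrite !ge0_integralD//; try (by apply: measurable_funeM; apply: mE => //; exact: (sm_bm smP));
    try (by move=> x _; rewrite mule_ge0); try (by apply: mE => //; exact: (sm_bm smP));
    try (by move=> x _; rewrite lee_fin).
  rewrite IH; congr (_ + _)%E.
  rewrite !ge0_integralZl//; try (by apply: mE => //; exact: (sm_bm smP)).
  congr (_ * _)%E; under eq_integral do rewrite kernel_op_indic//.
  by rewrite -inv// integral_indic// setIT.
- move=> F f M bF F0M ndF Ff IH.
  have FM n x : `|F n x| <= M by have /andP[h1 h2] := F0M n x; rewrite ger0_norm.
  have F0 n x : 0 <= F n x by have /andP[] := F0M n x.
  have c1 : (\int[pi]_x (F n x)%:E)%E @[n --> \oo] --> (\int[pi]_x (f x)%:E)%E.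
    have /= := @cvg_monotone_convergence _ _ _ pi setT measurableT (fun n x => (F n x)%:E).
    rewrite (_ : (fun x => limn _) = (fun x => (f x)%:E)); last first.
      by apply/funext => x; apply/cvg_lim => //; apply: cvg_EFin; [exact: nearW|exact: Ff].
    apply=> [n|n x _|x _ a b ab]; [exact: mE|by rewrite lee_fin|by rewrite lee_fin ndF].
  have c2 : (\int[pi]_x (Pop (F n) x)%:E)%E @[n --> \oo] --> (\int[pi]_x (Pop f x)%:E)%E.
    have /= := @cvg_monotone_convergence _ _ _ pi setT measurableT (fun n x => (Pop (F n) x)%:E).
    rewrite (_ : (fun x => limn _) = (fun x => (Pop f x)%:E)); last first.
      apply/funext => x; apply/cvg_lim => //; apply: cvg_EFin; first exact: nearW.
      exact: (sm_cvg smP bF FM Ff).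
    apply=> [n|n x _|x _ a b ab].
    + by apply: mE; exact: (sm_bm smP).
    + by rewrite lee_fin; exact: (sm_ge0 smP).
    + by rewrite lee_fin; apply: (sm_le smP) => // y; exact: ndF.
  rewrite -(cvg_lim _ c1)// -(cvg_lim _ c2)//.
  by under eq_fun do rewrite IH.
Qed.

Definition pi_summable f :=
  [/\ bm f, forall x, 0 <= f x & pi.-integrable setT (EFin \o f)].

Lemma pi_summable_lty f : bm f -> (forall x, 0 <= f x) ->
  (\int[pi]_x (f x)%:E < +oo)%E -> pi_summable f.
Proof.
move=> bf f0 fy; split=> //; apply/integrableP; split; first exact: mE.
by under eq_integral do rewrite /= ger0_norm//.
Qed.

Lemma pi_summableE f : pi_summable f -> ((\int[pi]_x f x)%:E = \int[pi]_x (f x)%:E)%E.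
Proof. by move=> [_ _] /(integrable_fin_num measurableT)/fineK. Qed.

Lemma pi_summable_fin f : pi_summable f -> (\int[pi]_x (f x)%:E < +oo)%E.
Proof. by move=> /pi_summableE <-; exact: ltry. Qed.

Let iter_kernel j f : pi_summable f ->
  (\int[pi]_x (iter j Pop f x)%:E = \int[pi]_x (f x)%:E)%E.
Proof.
move=> [bf f0 _]; elim: j => [//|j IH] /=.
rewrite inv_kernel_op//; first exact: (sm_bm (submarkov_iter j smP)).
exact: (sm_ge0 (submarkov_iter j smP)).
Qed.

Lemma inv_resolvent_mean f : pi_summable f ->
  (\int[pi]_x (A f x)%:E = \int[pi]_x (f x)%:E)%E.
Proof.
move=> sf; have [bf f0 _] := sf.
have [_ [M fM]] := bf.
have w0 j : 0 <= (1 - e) * e ^+ j by rewrite mulr_ge0 ?exprn_ge0// subr_ge0 ltW.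
have bj j : bm (iter j Pop f) by exact: (sm_bm (submarkov_iter j smP)).
have j0 j x : 0 <= iter j Pop f x by exact: (sm_ge0 (submarkov_iter j smP)).
pose S N x := series (fun j => (1 - e) * e ^+ j * iter j Pop f x) N.
have bS N : bm (S N) by apply: bm_sum => j; exact: bmZ.
have S0 N x : 0 <= S N x by apply: sumr_ge0 => j _; rewrite mulr_ge0.
have c1 : (\int[pi]_x (S N x)%:E)%E @[N --> \oo] --> (\int[pi]_x (A f x)%:E)%E.
  have /= := @cvg_monotone_convergence _ _ _ pi setT measurableT (fun N x => (S N x)%:E).
  rewrite (_ : (fun x => limn _) = (fun x => (A f x)%:E)); last first.
    apply/funext => x; apply/cvg_lim => //; apply: cvg_EFin; first exact: nearW.
    by have := @geometric_mean_cvg _ _ _ smP e0 e1 f x bf.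
  apply=> [n|n x _|x _ a b ab]; [exact: mE|by rewrite lee_fin|].
  rewrite lee_fin; apply: (nondecreasing_series (P := xpredT)) => // j _ _.
  by rewrite mulr_ge0.
rewrite -(cvg_lim _ c1)//; apply/cvg_lim => //.
rewrite -(pi_summableE sf).
rewrite (_ : (fun N => _) = (fun N => ((1 - e ^+ N) * \int[pi]_x f x)%:E)).
  apply: cvg_EFin; first exact: nearW.
  rewrite -[X in _ --> X]mul1r -[X in X * _]subr0.
  apply: cvgM; last exact: cvg_cst.
  apply: cvgB; first exact: cvg_cst.
  by apply: cvg_expr; rewrite ger0_norm.
apply/funext => N; rewrite /S /series /=.
under eq_integral do rewrite -sumEFin.
rewrite ge0_integral_sum//; last 2 first.
- by move=> j; apply: mE; exact: bmZ.
- by move=> j x _; rewrite lee_fin mulr_ge0.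
have -> : 1 - e ^+ N = \sum_(0 <= j < N) (1 - e) * e ^+ j.
  rewrite (telescope_sumr_eq (fun j => - e ^+ j))//; first by rewrite expr0 opprK addrC.
  by move=> j _; rewrite exprS; ring.
rewrite EFinM -sumEFin ge0_sume_distrl; last by move=> j _; rewrite lee_fin.
apply: eq_bigr => j _; under eq_integral do rewrite EFinM.
rewrite ge0_integralZl//; last 3 first.
- exact: mE.
- by move=> x _; rewrite lee_fin.
- by rewrite lee_fin.
by rewrite iter_kernel// (pi_summableE sf).
Qed.

Lemma inv_sampled f : pi_summable f -> pi_summable (U f) /\
  \int[pi]_x U f x = \int[pi]_x f x.
Proof.
move=> sf; have [bf f0 _] := sf.
have A0 x : 0 <= A f x by exact: (sm_ge0 smA).
have UE : (\int[pi]_x (U f x)%:E = \int[pi]_x (f x)%:E)%E.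
  by rewrite inv_kernel_op ?inv_resolvent_mean//; exact: (sm_bm smA).
split; last by rewrite /Rintegral UE.
apply: pi_summable_lty; [exact: (sm_bm smU)|exact: (sm_ge0 smU)|].
by rewrite UE; exact: pi_summable_fin.
Qed.

Hypothesis ss : pi_summable s.

Lemma inv_taboo f : pi_summable f -> pi_summable (K f) /\
  \int[pi]_x f x = \int[pi]_x K f x + (\int[pi]_x s x) * \int[nu]_x f x.
Proof.
move=> sf; have [bf f0 _] := sf.
have [sU UE] := inv_sampled sf.
have [_ _ is_] := ss.
have K0 x : 0 <= K f x by exact: (sm_ge0 smK).
have nf0 : 0 <= \int[nu]_x f x by apply: Rintegral_ge0.
have sK : pi_summable (K f).
  split=> //; first exact: (sm_bm smK).
  have [bU U0 iU] := sU.
  apply: (le_integrable measurableT) iU; first by apply: mE; exact: (sm_bm smK).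
  move=> x _ /=; rewrite lee_fin !ger0_norm//.
  by rewrite /K gerBl mulr_ge0.
split=> //; rewrite -UE.
under eq_Rintegral do rewrite (sampledE P e s nu).
have [_ _ iK] := sK.
rewrite RintegralD//; last first.
  have /= := integrableZl measurableT (\int[nu]_x f x) is_.
  by under eq_fun do rewrite -EFinM mulrC.
by rewrite RintegralZr.
Qed.

Lemma inv_iter_taboo n f : pi_summable f -> pi_summable (iter n K f) /\
  \int[pi]_x f x = \int[pi]_x iter n K f x +
    (\int[pi]_x s x) * \sum_(t < n) \int[nu]_x iter t K f x.
Proof.
move=> sf; elim: n => [|n [sn IH]]; first by rewrite big_ord0 mulr0 addr0.
have [sK KE] := inv_taboo sn; split=> //=.
by rewrite IH KE big_ord_recr/= mulrDr; ring.
Qed.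

Lemma inv_iter_taboo_s n :
  \int[pi]_x iter n K s x = (\int[pi]_x s x) * tail_prob P e s nu n.
Proof.
have [_] := inv_iter_taboo n ss.
have -> : \sum_(t < n) \int[nu]_x iter t K s x = 1 - tail_prob P e s nu n.
  rewrite -(bm_integral_sum nu1); last by move=> t; exact: (sm_bm (smKn t)).
  under eq_Rintegral do rewrite -(survival_sumE e0 e1 bs s0 minor).
  rewrite (bm_integralB nu1); [|exact: bm_cst|exact: (bm_survival e0 e1 bs s0 minor)].
  by rewrite (bm_integral_cst nu1).
by move=> h; lra.
Qed.

(** By invariance the mass is the surviving mass plus the mass of [s] times the
    expected block length, truncated at [n]. *)
Lemma sum_tail_prob_le n : (pi setT < +oo)%E ->
  (\int[pi]_x s x) * \sum_(t < n) tail_prob P e s nu t <= fine (pi setT).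
Proof.
move=> piy.
have s1 : pi_summable (fun=> 1).
  by apply: pi_summable_lty => //; [exact: bm_cst|rewrite integral_cst// mul1e].
have [sn] := inv_iter_taboo n s1.
rewrite Rintegral_cst// mul1r => ->.
rewrite lerDr; apply: Rintegral_ge0 => x _; by have [_] := sn.
Qed.

(** The invariant measure of a subset of [C] is carried by the blocks: the mass
    that survives [n] steps without regeneration tends to zero. *)
Lemma inv_le_block_visits (C B : set R) (c : R) (J : nat) (a : R) :
  0 <= c -> (forall x, \1_C x <= c * (1 - survival P e s nu J x)) ->
  measurable B -> B `<=` C -> (pi B < +oo)%E ->
  tail_prob P e s nu n @[n --> \oo] --> (0 : R) ->
  \sum_(t < n) \int[nu]_x iter t K \1_B x @[n --> \oo] --> a ->
  fine (pi B) <= (\int[pi]_x s x) * a.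
Proof.
move=> c0 dom mB BC piB tp0 cva.
have sB : pi_summable \1_B.
  apply: pi_summable_lty; [exact: bm_indic|by move=> x; rewrite indicE|].
  by rewrite integral_indic// setIT.
have piBE : fine (pi B) = \int[pi]_x \1_B x.
  by rewrite /Rintegral integral_indic// setIT.
have S0 : 0 <= \int[pi]_x s x by apply: Rintegral_ge0.
pose tp n := tail_prob P e s nu n.
have le n : fine (pi B) <= (\int[pi]_x s x) *
    (c * J%:R * tp n + \sum_(t < n) \int[nu]_x iter t K \1_B x).
  have [[bn n0 in_] E] := inv_iter_taboo n sB.
  rewrite piBE E mulrDr lerD2r.
  pose F x := c * \sum_(j < J) iter (n + j) K s x.
  have sj j : pi_summable (iter (n + j) K s) by have [] := inv_iter_taboo (n + j) ss.
  have isum : pi.-integrable setT (EFin \o (fun x => \sum_(j < J) iter (n + j) K s x)).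
    rewrite (_ : _ \o _ = (fun x => \sum_(j < J) (iter (n + j) K s x)%:E)%E); last first.
      by apply/funext => x /=; rewrite sumEFin.
    by apply: integrable_sum => // j _; have [] := sj j.
  have iF : pi.-integrable setT (EFin \o F) by exact: (integrableZl measurableT c isum).
  apply: (@le_trans _ _ (\int[pi]_x F x)).
    apply: le_Rintegral => // x _.
    exact: (iter_taboo_indic_le e0 e1 bs s0 minor dom).
  rewrite RintegralZl// -!mulrA mulrCA ler_wpM2l//.
  rewrite /Rintegral; under eq_integral do rewrite -sumEFin.
  rewrite ge0_integral_sum//; last 2 first.
  - by move=> j; apply: mE; have [] := sj j.
  - by move=> j x _; rewrite lee_fin; have [] := sj j.
  rewrite -sum_fine; last by move=> j _; rewrite -(pi_summableE (sj j)).
  apply: (@le_trans _ _ (\sum_(j < J) (\int[pi]_x s x) * tp n)).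
    apply: ler_sum => j _.
    have := inv_iter_taboo_s (n + j); rewrite /Rintegral => ->; rewrite ler_wpM2l//.
    exact: (tail_prob_anti e0 e1 bs s0 minor (leq_addr _ _)).
  by rewrite sumr_const card_ord -[leLHS]mulr_natl [leLHS]mulrCA lexx.
have cv : (\int[pi]_x s x) * (c * J%:R * tp n +
    \sum_(t < n) \int[nu]_x iter t K \1_B x) @[n --> \oo] -->
    (\int[pi]_x s x) * (c * J%:R * 0 + a).
  apply: cvgM; first exact: cvg_cst.
  by apply: cvgD => //; apply: cvgM; [exact: cvg_cst|exact: tp0].
rewrite mulr0 add0r in cv; rewrite -(cvg_lim _ cv)//.
by apply: limr_ge; [apply/cvg_ex; eexists; exact: cv|exact: nearW].
Qed.

End invariant.
(** * Visits to small sets, stopped at a prescribed number of regenerations *)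

Section stopped_sums.
Context {R : realType}.
Implicit Types (c phi : nat -> R).

(** Abel summation; [c] is the indicator of the times before stopping. *)
Lemma stopped_telescope_le c phi n : (forall t, 0 <= c t <= 1) ->
  (forall t, c t.+1 <= c t) -> (forall t, 0 <= phi t) ->
  \sum_(t < n) c t * (phi t - phi t.+1) <= phi 0%N.
Proof.
move=> c01 cS phi0.
suff h : \sum_(t < n) c t * (phi t - phi t.+1) + c n * phi n <= phi 0%N.
  have /andP[cn _] := c01 n.
  by apply: le_trans h; rewrite lerDl mulr_ge0.
elim: n => [|n IH].
  by rewrite big_ord0 add0r ler_piMl//; have /andP[] := c01 0%N.
rewrite big_ord_recr/=; apply: le_trans IH; rewrite -addrA lerD2l.
by rewrite mulrBr -addrA gerDl addrC subr_le0 ler_wpM2r.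
Qed.

Lemma stopped_telescope_ge c phi n H : (forall t, 0 <= c t <= 1) ->
  (forall t, c t.+1 <= c t) -> (forall t, 0 <= phi t <= H) ->
  - H <= \sum_(t < n) c t * (phi t - phi t.+1).
Proof.
move=> c01 cS phiH; rewrite lerNl -sumrN.
have := @stopped_telescope_le c (fun t => H - phi t) n c01 cS.
rewrite (eq_bigr (fun t : 'I_n => - (c t * (phi t - phi t.+1)))); last first.
  by move=> t _; ring.
move=> h; apply: (le_trans (h _)); first by move=> t; rewrite subr_ge0; have /andP[] := phiH t.
by rewrite gerBl; have /andP[] := phiH 0%N.
Qed.

End stopped_sums.

Section regeneration_clock.
Context {R : realType} {d : measure_display} {T : measurableType d}.
Variables (X : nat -> T -> R) (s : R -> R) (k : R).
Hypotheses (bs : bounded_measurable s) (s01 : forall x, 0 <= s x <= 1) (k0 : 0 <= k).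

(** Regenerations are counted by the sum of their conditional probabilities, which is
    a function of the chain alone. *)
Definition clock t w : R := \sum_(i < t) s (X i w).
Definition live t w : R := \1_[set y | y < k] (clock t w).

Let clockS t w : clock t.+1 w = clock t w + s (X t w).
Proof. by rewrite /clock big_ord_recr. Qed.

Let s0 x : 0 <= s x. Proof. by have /andP[] := s01 x. Qed.

Lemma liveP t w : live t w = (clock t w < k)%R%:R.
Proof. by rewrite /live indicE mem_setE. Qed.

Lemma live01 t w : 0 <= live t w <= 1.
Proof. by rewrite liveP ler0n lern1 leq_b1. Qed.

Lemma live_anti t w : live t.+1 w <= live t w.
Proof.
rewrite !liveP ler_nat clockS.
case: (ltP (clock t w + s (X t w)) k) => // h.
by rewrite (le_lt_trans _ h)// lerDl.
Qed.

Lemma live_mono m n w : (m <= n)%N -> live n w <= live m w.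
Proof.
move=> /subnKC <-; elim: (n - m)%N => [|j IH]; first by rewrite addn0.
by rewrite addnS (le_trans (live_anti _ _)).
Qed.

Lemma live_adapted t : adapted X t (live t).
Proof.
have ac : adapted X t (clock t).
  have h m : (m <= t)%N -> adapted X t (clock m).
    elim: m => [_|m IH mt].
      by rewrite (_ : clock 0 = (fun=> 0)); [exact: bm_cst|apply/funext => w; rewrite /clock big_ord0].
    rewrite (_ : clock m.+1 = (fun w => clock m w + s (X m w))); last exact/funext/clockS.
    by apply: bmD; [exact/IH/ltnW|exact: (@adapted_comp _ _ _ X t m _ (ltnW mt) bs)].
  exact: h.
have mk : measurable [set y : R | y < k].
  by rewrite (_ : [set _ | _] = `]-oo, k[%classic)//; apply/seteqP; split=> y /=; rewrite in_itv.
apply: (@bmW _ _ _ _ 1) => [|w]; last exact: live01.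
by apply: measurableT_comp; [exact: measurable_indic|have [] := ac].
Qed.

Lemma sum_live_le n w : \sum_(t < n) live t w * s (X t w) <= k + 1.
Proof.
suff [] : \sum_(t < n) live t w * s (X t w) <= k + 1 /\
    (live n w = 1 -> \sum_(t < n) live t w * s (X t w) = clock n w) by [].
elim: n => [|n [IH1 IH2]].
  by rewrite /clock !big_ord0; split => //; rewrite addr_ge0.
rewrite !big_ord_recr/= clockS.
have /andP[_ s1] := s01 (X n w).
have [l0|l1] : live n w = 0 \/ live n w = 1 by rewrite liveP; case: ltP; [right|left].
  rewrite l0 mul0r addr0; split=> // l1; have := live_anti n w.
  by rewrite l0 l1 ler10.
rewrite l1 mul1r IH2//; split => //; rewrite lerD// ltW//.
by move: l1; rewrite liveP; case: ltP => // _ /eqP; rewrite eq_sym oner_eq0.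
Qed.

Lemma sum_live_ge n w : live n w = 0 -> k <= \sum_(t < n) live t w * s (X t w).
Proof.
suff [] : (live n w = 0 -> k <= \sum_(t < n) live t w * s (X t w)) /\
    (live n w = 1 -> \sum_(t < n) live t w * s (X t w) = clock n w) by [].
elim: n => [|n [IH1 IH2]].
  rewrite /clock !big_ord0 liveP /clock big_ord0; split => //.
  by case: ltP => // _ /eqP; rewrite oner_eq0.
rewrite !big_ord_recr/= clockS; split.
  move=> h; have [l0|l1] : live n w = 0 \/ live n w = 1.
  - by rewrite liveP; case: ltP; [right|left].
  - by rewrite l0 mul0r addr0 IH1.
  - rewrite l1 mul1r IH2// -clockS leNgt; move: h; rewrite liveP.
    by case: ltP => // _ /eqP; rewrite oner_eq0.
move=> h; have l1 : live n w = 1.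
  by apply/eqP; rewrite eq_le -{2}h live_anti andbT; have /andP[] := live01 n w.
by rewrite l1 mul1r IH2.
Qed.

End regeneration_clock.

Section visits.
Context {R : realType} {d : measure_display} {T : measurableType d}.
Variables (P : R.-pker R ~> R) (lam : probability R R) (Pr : probability T R)
  (X : nat -> T -> R).
Hypothesis hX : markov_chain P lam Pr X.
Variables (e : R) (s : R -> R) (nu : probability R R).
Local Notation bm := (@bounded_measurable R _ R).
Local Notation Pop := (kernel_op P).
Local Notation A := (resolvent_mean P e).
Local Notation U := (sampled P e).
Local Notation K := (taboo P e s nu).
Hypotheses (e0 : 0 <= e) (e1 : e < 1) (bs : bm s) (s0 : forall x, 0 <= s x).
Hypothesis minor : forall f, bm f -> (forall x, 0 <= f x) ->
  forall x, s x * \int[nu]_y f y <= U f x.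
Variable k : R.
Hypothesis k0 : 0 <= k.
Let smP := submarkov_kernel P.
Let smA := submarkov_resolvent_mean P e0 e1.
Let smU := submarkov_sampled P e0 e1.
Let smK := submarkov_taboo e0 e1 bs s0 minor.
Let smKn n := submarkov_iter n smK.
Let nu1 : nu setT = 1%E. Proof. exact: probability_setT. Qed.
Let Pr1 : Pr setT = 1%E. Proof. exact: probability_setT. Qed.
Local Notation live := (live X s k).

Let s01 x : 0 <= s x <= 1.
Proof.
rewrite s0/=; have := sm_ge0 smK (bm_cst 1) (fun=> ler01) x.
by rewrite taboo1// subr_ge0.
Qed.

Let lA t : adapted X t (live t). Proof. by apply: live_adapted. Qed.
Let bl t : bounded_measurable (live t). Proof. exact: (adapted_bm hX (lA t)). Qed.
Let bX t f : bm f -> bounded_measurable (fun w => f (X t w)).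
Proof. exact: (chain_bm hX). Qed.
Let l01 t w : 0 <= live t w <= 1. Proof. exact: live01. Qed.
Let l0 t w : 0 <= live t w. Proof. by have /andP[] := l01 t w. Qed.

(** A function [h] with [h - theta P h >= b - a s] bounds the time spent before
    [k] regenerations: until then, each step lowers [h] by [b] on average. *)
Lemma regeneration_time_bound (h : R -> R) (theta a b : R) n :
  bm h -> (forall x, 0 <= h x) -> 0 <= theta <= 1 -> 0 <= a -> 0 <= b ->
  (forall x, b - a * s x <= h x - theta * Pop h x) ->
  n%:R * theta ^+ n * b * \int[Pr]_w live n w <= \int[lam]_x h x + a * (k + 1).
Proof.
move=> bh h0 /andP[th0 th1] a0 b0 hE.
have thn t : 0 <= theta ^+ t <= 1 by rewrite exprn_ge0// exprn_ile1.
pose phi t w := theta ^+ t * h (X t w).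
have bphi t : bounded_measurable (phi t) by apply: bmZ; exact: bX.
have bPh : bm (Pop h) by exact: (sm_bm smP).
have blphi t j : bounded_measurable (fun w => live t w * phi j w) by exact: bmM.
have step t : \int[Pr]_w (live t w * (phi t w - phi t.+1 w)) =
    theta ^+ t * \int[Pr]_w (live t w * (h (X t w) - theta * Pop h (X t w))).
  have lh j (f : R -> R) : bm f -> bounded_measurable (fun w => live t w * f (X j w)).
    by move=> bf; apply: bmM => //; exact: bX.
  under eq_Rintegral do rewrite mulrBr /phi (mulrCA (live t _)) [X in _ - X]mulrCA.
  rewrite (bm_integralB Pr1)//; try (apply: bmZ; exact: lh).
  rewrite !(bm_integralZ Pr1)//; try exact: lh.
  rewrite (markov_property hX (lA t) bh).
  under [in RHS]eq_Rintegral do rewrite mulrBr (mulrCA (live t _)).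
  rewrite (bm_integralB Pr1)//; [|exact: lh|by apply: bmZ; exact: lh].
  rewrite (bm_integralZ Pr1)//; [|exact: lh].
  by rewrite exprS; ring.
have tele : \sum_(t < n) \int[Pr]_w (live t w * (phi t w - phi t.+1 w)) <= \int[lam]_x h x.
  rewrite -(bm_integral_sum Pr1); last by move=> t; apply: bmM => //; exact: bmB.
  rewrite -(chain_init hX bh); apply: (bm_integral_le Pr1).
  - by apply: bm_sum => t; apply: bmM => //; exact: bmB.
  - exact: bX.
  - move=> w; rewrite (le_trans (@stopped_telescope_le _ (fun t => live t w) (fun t => phi t w) n _ _ _))//.
    + by move=> t; apply: live_anti.
    + by move=> t; rewrite mulr_ge0//; have /andP[] := thn t.
    + by rewrite /phi expr0 mul1r.
have blow t : bounded_measurable (fun w => live t w * (b - a * s (X t w))).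
  by apply: bmM => //; apply: bmB; [exact: bm_cst|apply: bmZ; exact: bX].
have low t : theta ^+ t * \int[Pr]_w (live t w * (b - a * s (X t w))) <=
    \int[Pr]_w (live t w * (phi t w - phi t.+1 w)).
  rewrite step ler_wpM2l//; first by have /andP[] := thn t.
  apply: (bm_integral_le Pr1) => //.
    by apply: bmM => //; apply: bmB; [exact: bX|apply: bmZ; exact: bX].
  by move=> w; rewrite ler_wpM2l.
have main : \int[Pr]_w (\sum_(t < n) theta ^+ t * (live t w * (b - a * s (X t w)))) <=
    \int[lam]_x h x.
  rewrite (bm_integral_sum Pr1); last by move=> t; exact: bmZ.
  apply: le_trans tele; apply: ler_sum => t _.
  by rewrite (bm_integralZ Pr1).
rewrite -lerBlDr; apply: le_trans main.
rewrite -(bm_integralZ Pr1)// -[X in _ - X](bm_integral_cst Pr1).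
rewrite -(bm_integralB Pr1)//; [|exact: bmZ|exact: bm_cst].
apply: (bm_integral_le Pr1).
- by apply: bmB; [exact: bmZ|exact: bm_cst].
- by apply: bm_sum => t; exact: bmZ.
move=> w; rewrite lerBlDr.
have h1 : \sum_(t < n) theta ^+ t * (live t w * (a * s (X t w))) <= a * (k + 1).
  apply: (@le_trans _ _ (\sum_(t < n) a * (live t w * s (X t w)))).
    apply: ler_sum => t _; rewrite [in leRHS]mulrCA ler_piMl//.
      by rewrite mulr_ge0// mulr_ge0.
    by have /andP[] := thn t.
  by rewrite -mulr_sumr ler_wpM2l//; exact: sum_live_le.
have h2 : n%:R * theta ^+ n * b * live n w <= \sum_(t < n) theta ^+ t * (live t w * b).
  rewrite -[n in n%:R]card_ord -sum1_card natr_sum !mulr_suml.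
  apply: ler_sum => t _; rewrite mul1r -mulrA (mulrC b); apply: ler_pM => //.
  - by rewrite exprn_ge0.
  - by rewrite mulr_ge0.
  - by apply: ler_wiXn2l => //; exact: ltnW.
  - by rewrite ler_wpM2r//; apply: live_mono => //; exact: ltnW.
apply: (le_trans h2); rewrite -lerBlDl; apply: le_trans h1.
rewrite -sumrB; apply: ler_sum => t _; rewrite -mulrBr -mulrBr.
by rewrite opprB addrC subrK.
Qed.

(** [regeneration_time_bound] for a truncated and discounted expected block length:
    with [rho = 1 - 1 / (2 n)], the sum [v] of [rho ^+ t * K^t 1] over [t < n]
    satisfies [v - rho K v = 1 - rho ^+ n * K^n 1 >= 1 / 3]. Without the discount
    the right-hand side could vanish. *)
Lemma few_regenerations n : (0 < n)%N ->
  n%:R / 6 * \int[Pr]_w live n w <=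
  (1 - e)^-1 * (\sum_(t < n) \int[lam]_x A (survival P e s nu t) x) +
  (\sum_(t < n) tail_prob P e s nu t) * (k + 1).
Proof.
move=> n0; have n0R : 0 < n%:R :> R by rewrite ltr0n.
pose x : R := (2 * n%:R)^-1; pose rho := 1 - x.
have x0 : 0 < x by rewrite invr_gt0 mulr_gt0.
have nx : n%:R * x = 1 / 2 by rewrite /x; field; rewrite gt_eqF.
have x1 : x <= 1 / 2.
  by rewrite -nx -[leLHS]mul1r ler_pM2r// ler1n.
have bern (y : R) m : -1 <= y -> 1 + m%:R * y <= (1 + y) ^+ m.
  move=> y1; elim: m => [|m IH]; first by rewrite mul0r addr0 expr0.
  rewrite exprS; apply: (@le_trans _ _ ((1 + y) * (1 + m%:R * y))).
    rewrite -natr1 mulrDl mul1r mulrDl mul1r mulrDr mulr1 -addrA lerD2l.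
    by rewrite lerD2l lerDl mulrCA mulr_ge0// -expr2 sqr_ge0.
  by rewrite ler_wpM2l//; lra.
have rho01 : 0 <= rho <= 1 by rewrite /rho; lra.
have /andP[rho0 rho1] := rho01.
(* Bernoulli's inequality, for [1 - x] and for [1 + x]. *)
have rlow : 1 / 2 <= rho ^+ n.
  by have := bern (- x) n; rewrite mulrN nx -/rho; lra.
have rhigh : rho ^+ n <= 2 / 3.
  have h1 := bern x n; rewrite nx in h1.
  have h2 : rho ^+ n * (1 + x) ^+ n <= 1.
    rewrite -exprMn exprn_ile1//; first by rewrite mulr_ge0//; lra.
    rewrite /rho -[leRHS](subr0) (_ : (1 - x) * (1 + x) = 1 - x ^+ 2); last by ring.
    by rewrite lerB// sqr_ge0.
  have h3 : rho ^+ n * (3 / 2) <= 1.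
    apply: le_trans h2; rewrite ler_wpM2l ?exprn_ge0//.
    by have := h1 _; lra.
  by lra.
(* The discount of the chain that corresponds to [rho] for the sampled kernel. *)
pose theta := e + (1 - e) * rho.
have e1' : 0 < 1 - e by rewrite subr_gt0.
have th_rho : rho <= theta.
  rewrite /theta -subr_ge0 (_ : _ - _ = e * (1 - rho)); last by ring.
  by rewrite mulr_ge0// subr_ge0.
have th1 : theta <= 1.
  rewrite -subr_ge0 /theta (_ : _ - _ = (1 - e) * (1 - rho)); last by ring.
  by rewrite mulr_ge0 ?subr_ge0 ?(ltW e1).
have th0 : 0 <= theta by exact: le_trans th_rho.
pose v y := \sum_(t < n) rho ^+ t * survival P e s nu t y.
have bsv t : bm (survival P e s nu t) by exact: (bm_survival e0 e1 bs s0 minor).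
have sv0 t y : 0 <= survival P e s nu t y by exact: (survival_ge0 e0 e1 bs s0 minor).
have bv : bm v by apply: bm_sum => t; exact: bmZ.
have v0 y : 0 <= v y by apply: sumr_ge0 => t _; rewrite mulr_ge0// exprn_ge0.
have vE y : v y - rho * K v y = 1 - rho ^+ n * survival P e s nu n y.
  rewrite /v (sm_sum smK); last by move=> t; exact: bmZ.
  under [in X in _ - X]eq_bigr do rewrite (smZ smK)//.
  rewrite mulr_sumr -sumrB -(big_mkord xpredT (fun t => rho ^+ t * survival P e s nu t y -
     rho * (rho ^+ t * K (survival P e s nu t) y))).
  rewrite (telescope_sumr_eq (fun t => - (rho ^+ t * survival P e s nu t y)))//.
    by rewrite expr0 mul1r opprK addrC.
  by move=> t _; rewrite opprK addrC exprS mulrA.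
have nuv0 : 0 <= \int[nu]_y v y by apply: Rintegral_ge0.
have nuv : \int[nu]_y v y <= \sum_(t < n) tail_prob P e s nu t.
  rewrite (bm_integral_sum nu1); last by move=> t; exact: bmZ.
  apply: ler_sum => t _; rewrite (bm_integralZ nu1)// ler_piMl//.
    by apply: Rintegral_ge0.
  exact: exprn_ile1.
pose h y := (1 - e)^-1 * A v y.
have bh : bm h by exact/bmZ/(sm_bm smA).
have h0 y : 0 <= h y.
  by rewrite mulr_ge0 ?invr_ge0 ?(ltW e1')//; exact: (sm_ge0 smA).
have hE y : 1 / 3 - (\int[nu]_z v z) * s y <= h y - theta * Pop h y.
  have -> : h y - theta * Pop h y = v y - rho * U v y.
    rewrite /h (smZ smP); last exact: (sm_bm smA).
    rewrite -[Pop (A v) y]/(U v y) (resolvent_meanE P e0 e1)//.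
    by rewrite /theta; field; rewrite gt_eqF.
  rewrite (sampledE P e s nu) mulrDr opprD addrA vE.
  apply: lerB; last first.
    by rewrite [leRHS]mulrC ler_piMl// mulr_ge0.
  have : rho ^+ n * survival P e s nu n y <= rho ^+ n.
    by rewrite ler_piMr ?exprn_ge0//; exact: (survival_le1 e0 e1 bs s0 minor).
  by lra.
have th01 : 0 <= theta <= 1 by rewrite th0.
have := regeneration_time_bound n bh h0 th01 nuv0 (_ : 0 <= 1 / 3) hE.
have c3 : 0 <= 1 / 3 :> R by lra.
move=> /(_ c3) main.
have lint : 0 <= \int[Pr]_w live n w by apply: Rintegral_ge0.
apply: (@le_trans _ _ (n%:R * theta ^+ n * (1 / 3) * \int[Pr]_w live n w)).
  rewrite ler_wpM2r// -mulrA ler_wpM2l// ?ler0n//.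
  have : rho ^+ n <= theta ^+ n by apply: lerXn2r; rewrite ?nnegrE.
  by lra.
apply: (le_trans main); apply: lerD; last by rewrite ler_wpM2r// addr_ge0.
rewrite (bm_integralZ (probability_setT lam)); last exact: (sm_bm smA).
rewrite ler_wpM2l ?invr_ge0 ?(ltW e1')//.
rewrite -(bm_integral_sum (probability_setT lam)); last by move=> t; exact: (sm_bm smA).
apply: (bm_integral_le (probability_setT lam)) => [||y].
- exact: (sm_bm smA).
- by apply: bm_sum => t; exact: (sm_bm smA).
rewrite -(sm_sum smA)//; apply: (sm_le smA) => //; first exact: bm_sum.
move=> z; apply: ler_sum => t _; rewrite ler_piMl//.
exact: exprn_ile1.
Qed.

Section poisson.
Variables (B : set R) (h : R -> R) (a H : R).
Hypotheses (mB : measurable B) (bh : bm h) (hH : forall x, 0 <= h x <= H)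
  (a0 : 0 <= a) (hE : forall x, \1_B x - s x * a = h x - Pop h x).
Let bPh : bm (Pop h). Proof. exact: (sm_bm smP). Qed.
Let bB : bm \1_B. Proof. exact: bm_indic. Qed.

Let Z t w := live t w * (h (X t.+1 w) - Pop h (X t w)).
Let M n w := \sum_(t < n) Z t w.

Let Ph_le x : 0 <= Pop h x <= H.
Proof.
rewrite (sm_ge0 smP)//=; last by move=> y; have /andP[] := hH y.
have /andP[h0 hH0] := hH x; apply: (sm_le_cst smP) => //; first exact: le_trans hH0.
by move=> y; have /andP[] := hH y.
Qed.

Let Z_adapted t : adapted X t.+1 (Z t).
Proof.
apply: bmM; first exact: (adapted_mono (leqnSn t) (lA t)).
apply: bmB; first exact: (@adapted_comp _ _ _ X t.+1 t.+1).
exact: (@adapted_comp _ _ _ X t.+1 t).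
Qed.

Let M_adapted n : adapted X n (M n).
Proof.
elim: n => [|n IH].
  by rewrite (_ : M 0 = (fun=> 0)); [exact: bm_cst|apply/funext => w; rewrite /M big_ord0].
rewrite (_ : M n.+1 = (fun w => M n w + Z n w)); last first.
  by apply/funext => w; rewrite /M big_ord_recr.
by apply: bmD; [exact: (adapted_mono (leqnSn n) IH)|exact: Z_adapted].
Qed.

Let bZ t : bounded_measurable (Z t). Proof. exact: (adapted_bm hX (Z_adapted t)). Qed.
Let bM n : bounded_measurable (M n). Proof. exact: (adapted_bm hX (M_adapted n)). Qed.

(** The increments of [M] are orthogonal to the past. *)
Let Z_orth t G : adapted X t G -> \int[Pr]_w (G w * Z t w) = 0.
Proof.
move=> aG; have bG := adapted_bm hX aG.
have aGl : adapted X t (fun w => G w * live t w) by exact: (bmM aG (lA t)).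
under eq_Rintegral do rewrite mulrA mulrBr.
rewrite (bm_integralB Pr1).
- by rewrite (markov_property hX aGl bh) subrr.
- by apply: bmM; [exact: (adapted_bm hX aGl)|exact: bX].
- by apply: bmM; [exact: (adapted_bm hX aGl)|exact: bX].
Qed.

Let live_sq t w : live t w * live t w = live t w.
Proof. by rewrite liveP; case: ltP => _; rewrite ?mulr1 ?mulr0. Qed.

Let Z_sq t : \int[Pr]_w (Z t w * Z t w) =
  \int[Pr]_w (live t w * (h (X t.+1 w) ^+ 2 - Pop h (X t w) ^+ 2)).
Proof.
have bl1 : bounded_measurable (fun w => live t w * (h (X t.+1 w) ^+ 2 - Pop h (X t w) ^+ 2)).
  apply: bmM => //; under eq_fun do rewrite !expr2.
  by apply: bmB; apply: bmM; exact: bX.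
have aP : adapted X t (fun w => 2 * Pop h (X t w)).
  by apply: bmZ; exact: (@adapted_comp _ _ _ X t t).
rewrite -[RHS]subr0 -(Z_orth aP) -(bm_integralB Pr1)//; last first.
  by apply: bmM => //; exact: (adapted_bm hX aP).
apply: eq_Rintegral => w _; rewrite /Z mulrACA live_sq; ring.
Qed.

Let live_visits_le n : \int[Pr]_w (\sum_(t < n) live t w * \1_B (X t w)) <= a * (k + 1) + H.
Proof.
have EM : \int[Pr]_w M n w = 0.
  rewrite (bm_integral_sum Pr1)// big1// => t _.
  have := Z_orth (t := t) (G := fun=> 1) (bm_cst 1).
  by under eq_Rintegral do rewrite mul1r.
have -> : a * (k + 1) + H = \int[Pr]_w (a * (k + 1) + H + M n w).
  by rewrite (bm_integralD Pr1) ?EM ?addr0 ?(bm_integral_cst Pr1)//; exact: bm_cst.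
apply: (bm_integral_le Pr1).
- by apply: bm_sum => t; apply: bmM => //; exact: bX.
- by apply: bmD => //; exact: bm_cst.
move=> w.
have -> : \sum_(t < n) live t w * \1_B (X t w) = a * (\sum_(t < n) live t w * s (X t w)) +
    \sum_(t < n) live t w * (h (X t w) - h (X t.+1 w)) + M n w.
  rewrite mulr_sumr -!big_split/=; apply: eq_bigr => t _; rewrite /Z.
  have -> : \1_B (X t w) = s (X t w) * a + (h (X t w) - Pop h (X t w)) :> R by rewrite -hE; ring.
  by ring.
rewrite lerD2r; apply: lerD; first by rewrite ler_wpM2l//; exact: sum_live_le.
apply: (le_trans (@stopped_telescope_le _ (fun t => live t w) (fun t => h (X t w)) n _ _ _)) => //.
- by move=> t; apply: live_anti.
- by move=> t; have /andP[] := hH (X t w).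
- by have /andP[] := hH (X 0%N w).
Qed.

Let EM2 n : \int[Pr]_w (M n w * M n w) = \sum_(t < n) \int[Pr]_w (Z t w * Z t w).
Proof.
elim: n => [|n IH].
  rewrite big_ord0; under eq_Rintegral do rewrite /M big_ord0 mulr0.
  exact: (bm_integral_cst Pr1).
rewrite big_ord_recr/= -IH.
have aM2 : adapted X n (fun w => 2 * M n w) by exact: (bmZ 2 (M_adapted n)).
rewrite -[RHS]addr0 -(Z_orth aM2) -!(bm_integralD Pr1); last 4 first.
- by apply: bmD; exact: bmM.
- by apply: bmM => //; exact: bmZ.
- exact: bmM.
- exact: bmM.
apply: eq_Rintegral => w _; rewrite /M big_ord_recr/=; ring.
Qed.

Let EM2_le n : \int[Pr]_w (M n w * M n w) <= 3 * H ^+ 2 + 2 * H * a * (k + 1).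
Proof.
rewrite EM2; under eq_bigr do rewrite Z_sq.
have bsq (f : R -> R) t : bm f -> bounded_measurable (fun w => f (X t w) ^+ 2).
  by move=> bf; under eq_fun do rewrite expr2; apply: bmM; exact: bX.
have bt t : bounded_measurable (fun w => live t w * (h (X t.+1 w) ^+ 2 - Pop h (X t w) ^+ 2)).
  by apply: bmM => //; apply: bmB; exact: bsq.
have bv t : bounded_measurable (fun w => live t w * \1_B (X t w)).
  by apply: bmM => //; exact: bX.
have H0 : 0 <= H by have /andP[h1 h2] := hH 0; exact: le_trans h2.
rewrite -(bm_integral_sum Pr1)//.
apply: (@le_trans _ _ (\int[Pr]_w (H ^+ 2 + 2 * H * \sum_(t < n) live t w * \1_B (X t w)))); last first.
  rewrite (bm_integralD Pr1); [|exact: bm_cst|by apply/bmZ/bm_sum].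
  rewrite (bm_integral_cst Pr1) (bm_integralZ Pr1); last exact: bm_sum.
  rewrite (_ : 3 * H ^+ 2 + _ = H ^+ 2 + 2 * H * (a * (k + 1) + H)); last by ring.
  by rewrite lerD2l; apply: ler_wpM2l; [rewrite mulr_ge0|exact: live_visits_le].
apply: (bm_integral_le Pr1); first exact: bm_sum.
  by apply: bmD; [exact: bm_cst|apply/bmZ/bm_sum].
move=> w.
have -> : \sum_(t < n) live t w * (h (X t.+1 w) ^+ 2 - Pop h (X t w) ^+ 2) =
  - \sum_(t < n) live t w * (h (X t w) ^+ 2 - h (X t.+1 w) ^+ 2) +
  \sum_(t < n) live t w * (h (X t w) ^+ 2 - Pop h (X t w) ^+ 2).
  by rewrite -sumrN -big_split/=; apply: eq_bigr => t _; ring.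
apply: lerD.
  rewrite lerNl; apply: (@stopped_telescope_ge _ (fun t => live t w) (fun t => h (X t w) ^+ 2)) => //.
    by move=> t; apply: live_anti.
  move=> t; rewrite sqr_ge0/=; have /andP[h1 h2] := hH (X t w).
  by rewrite ler_sqr ?nnegrE.
rewrite mulr_sumr; apply: ler_sum => t _; rewrite mulrCA ler_wpM2l//.
have /andP[h1 h2] := hH (X t w); have /andP[p1 p2] := Ph_le (X t w).
rewrite subr_sqr -hE; apply: (@le_trans _ _ (\1_B (X t w) * (h (X t w) + Pop h (X t w)))).
  by rewrite ler_wpM2r ?addr_ge0// gerBl mulr_ge0.
by rewrite mulrC ler_wpM2r ?indicE ?ler0n//; lra.
Qed.

(** Once [k] regenerations have occurred, there are at least [a k] visits to [B], up
    to the martingale [M n] and a term bounded by [H <= a k / 4]; if there are fewer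
    than [a k / 2], then [M n <= - a k / 4], and Chebyshev's inequality applies. *)
Lemma few_visits n : 1 <= k -> 4 * H <= a * k -> 0 < a ->
  \int[Pr]_w \1_[set w | \sum_(t < n) \1_B (X t w) < a * k / 2] w <=
  \int[Pr]_w live n w + 80 * H / (a * k).
Proof.
move=> k1 Hak a_gt0.
have ak0 : 0 < a * k by rewrite mulr_gt0//; lra.
have bN : bounded_measurable (fun w => \sum_(t < n) \1_B (X t w) : R).
  by apply: bm_sum => t; exact: bX.
have mev : measurable [set w | (\sum_(t < n) \1_B (X t w) < a * k / 2)%R].
  rewrite -[Y in measurable Y]setTI; apply: measurable_fun_ltr => //.
  by have [] := bN.
have H0 : 0 <= H by have /andP[h1 h2] := hH 0; exact: le_trans h2.
have bev := bm_indic (R := R) mev.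
pose q := (16 / (a * k) ^+ 2).
have q0 : 0 <= q by rewrite divr_ge0// sqr_ge0.
apply: (@le_trans _ _ (\int[Pr]_w (live n w + q * (M n w * M n w)))).
  apply: (bm_integral_le Pr1) => //; first by apply: bmD => //; apply: bmZ; exact: bmM.
  move=> w; rewrite indicE; case: (boolP (w \in _)) => [/set_mem/= small|_] /=; last first.
    by rewrite addr_ge0// mulr_ge0// -expr2 sqr_ge0.
  have [l0'|l1] : live n w = 0 \/ live n w = 1.
  - by rewrite liveP; case: ltP; [right|left].
  - rewrite l0' add0r.
    have ks : k <= \sum_(t < n) live t w * s (X t w) by apply: sum_live_ge.
    have eqS : \sum_(t < n) live t w * \1_B (X t w) = a * (\sum_(t < n) live t w * s (X t w)) +
        \sum_(t < n) live t w * (h (X t w) - h (X t.+1 w)) + M n w.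
      rewrite mulr_sumr -!big_split/=; apply: eq_bigr => t _; rewrite /Z.
      have -> : \1_B (X t w) = s (X t w) * a + (h (X t w) - Pop h (X t w)) :> R by rewrite -hE; ring.
      by ring.
    have leS : \sum_(t < n) live t w * \1_B (X t w) <= \sum_(t < n) \1_B (X t w).
      apply: ler_sum => t _; rewrite ler_piMl ?indicE ?ler0n//.
      by have /andP[] := l01 t w.
    have tg : - H <= \sum_(t < n) live t w * (h (X t w) - h (X t.+1 w)).
      apply: (@stopped_telescope_ge _ (fun t => live t w) (fun t => h (X t w))) => //.
      by move=> t; apply: live_anti.
    have aks : a * k <= a * (\sum_(t < n) live t w * s (X t w)) by rewrite ler_wpM2l.
    have Mle : M n w <= - (a * k / 4).
      move: eqS leS tg aks small Hak; move: (M n w) (a * k) (\sum_(t < n) \1_B _).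
      move: (a * \sum_(_ < _) _) (\sum_(t < n) _ * (_ - _)) (\sum_(_ < _) _ * \1_B _).
      by move=> *; lra.
    have M2 : (a * k / 4) ^+ 2 <= M n w * M n w.
      have A0 : 0 <= a * k / 4 by rewrite divr_ge0// ltW.
      have A1 : a * k / 4 <= - M n w by rewrite lerNr.
      rewrite -expr2 -[leRHS]sqrrN; apply: lerXn2r; rewrite ?nnegrE//.
      exact: le_trans A1.
    rewrite (_ : 1 = q * (a * k / 4) ^+ 2); first by rewrite ler_wpM2l.
    rewrite /q; move: (ak0); move: (a * k) => y y0.
    by field; rewrite gt_eqF.
  - by rewrite l1 lerDl mulr_ge0// -expr2 sqr_ge0.
rewrite (bm_integralD Pr1)//; last by apply: bmZ; exact: bmM.
rewrite lerD2l (bm_integralZ Pr1); last exact: bmM.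
apply: (@le_trans _ _ (q * (3 * H ^+ 2 + 2 * H * a * (k + 1)))).
  by rewrite ler_wpM2l.
have h1 : 3 * H ^+ 2 + 2 * H * a * (k + 1) <= 5 * H * (a * k).
  have HH : 4 * H * H <= H * (a * k) by rewrite mulrAC [leLHS]mulrC ler_wpM2l.
  have Hk : H * a <= H * a * k by rewrite ler_peMr// mulr_ge0.
  have HH0 : 0 <= H * H by rewrite mulr_ge0.
  by rewrite expr2; lra.
apply: (@le_trans _ _ (q * (5 * H * (a * k)))); first by rewrite ler_wpM2l.
rewrite /q le_eqVlt; apply/orP; left; apply/eqP.
by move: (ak0); move: (a * k) => y y0; field; rewrite gt_eqF.
Qed.

End poisson.
End visits.
(** * Lower bounds for the number of visits to shrinking sets *)

Section visits_lower_bound.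
Context {R : realType} {d : measure_display} {T : measurableType d}.
Variables (P : R.-pker R ~> R) (lam : probability R R) (Pr : probability T R)
  (X : nat -> T -> R) (pi : {measure set R -> \bar R}) (E C : set R)
  (e : R) (s : R -> R) (nu : probability R R) (c : R) (J : nat) (u : nat -> R) (D : R).
Hypothesis hX : markov_chain P lam Pr X.
Local Notation bm := (@bounded_measurable R _ R).
Local Notation A := (resolvent_mean P e).
Local Notation U := (sampled P e).
Local Notation K := (taboo P e s nu).
Hypotheses (e0 : 0 <= e) (e1 : e < 1) (bs : bm s) (s0 : forall x, 0 <= s x).
Hypothesis minor : forall f, bm f -> (forall x, 0 <= f x) ->
  forall x, s x * \int[nu]_y f y <= U f x.
Hypothesis inv : forall B, measurable B -> pi B = (\int[pi]_x P x B)%E.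
Hypotheses (ss : pi_summable pi s) (mE : measurable E) (lamE : lam E = 1%E)
  (mC : measurable C) (c0 : 0 <= c)
  (dom : forall x, \1_C x <= c * (1 - survival P e s nu J x)) (piC : (pi C < +oo)%E)
  (tp0 : tail_prob P e s nu n @[n --> \oo] --> (0 : R))
  (vanish : forall x, E x -> A (survival P e s nu n) x @[n --> \oo] --> (0 : R)).
Hypotheses (u_oo : u n @[n --> \oo] --> +oo)
  (rate : \forall n \near \oo, (\sum_(t < n) tail_prob P e s nu t) * u n <= D * n%:R).
Let lam1 : lam setT = 1%E. Proof. exact: probability_setT. Qed.
Let Pr1 : Pr setT = 1%E. Proof. exact: probability_setT. Qed.
Let smA := submarkov_resolvent_mean P e0 e1.

Lemma initial_survival_cvg0 : \int[lam]_x A (survival P e s nu n) x @[n --> \oo] --> (0 : R).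
Proof.
have bsv t : bm (survival P e s nu t) by exact: (bm_survival e0 e1 bs s0 minor).
have bA n : bm (A (survival P e s nu n)) by exact: (sm_bm smA).
have bE : bm \1_E by exact: bm_indic.
pose F n x := A (survival P e s nu n) x * \1_E x.
have bF n : bm (F n) by exact: bmM.
have FE n : \int[lam]_x A (survival P e s nu n) x = \int[lam]_x F n x.
  apply: (bm_integral_eq lam1 mE lamE) => // x Ex.
  by rewrite /F indicE mem_set// mulr1.
rewrite (_ : (fun n => _) = (fun n => \int[lam]_x F n x)); last exact/funext.
have I0 : \int[lam]_x 0 = 0 := bm_integral_cst lam1 0.
rewrite -I0.
apply: (@bm_integral_cvg _ _ _ _ lam1 F _ 1) => // [n x|x].
  rewrite normrM -[leRHS]mulr1; apply: ler_pM => //.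
    apply: (sm_norm smA) => // y.
    by rewrite ger0_norm ?(survival_ge0 e0 e1 bs s0 minor) ?(survival_le1 e0 e1 bs s0 minor).
  by rewrite indicE ger0_norm ?ler0n// lern1 leq_b1.
rewrite /F indicE; case: (boolP (x \in E)) => [/set_mem/vanish h|_].
  by under eq_fun do rewrite mulr1.
by under eq_fun do rewrite mulr0; exact: cvg_cst.
Qed.

(** With [k] a small multiple of [u n], [few_regenerations] makes fewer than [k]
    regenerations unlikely, and [few_visits] then gives about [k * pi B] visits
    to [B]; this number tends to infinity as soon as [pi B] is of order
    [u n `^ (- 1/3)]. *)
Lemma visits_lower_bound (b p : R) : 0 < b -> 0 < p ->
  exists2 g : R, 0 < g & \forall n \near \oo, forall B : set R, measurable B ->
    B `<=` C -> b * u n `^ (- (1 / 3)) <= fine (pi B) ->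
    \int[Pr]_w \1_[set w | \sum_(t < n) \1_B (X t w) < g * u n `^ (2 / 3)] w <= p.
Proof.
move=> b0 p0; pose S := \int[pi]_x s x.
have S0 : 0 <= S by apply: Rintegral_ge0.
pose D1 := Num.max D 1.
have D10 : 0 < D1 by rewrite lt_max ltr01 orbT.
pose eps := p / (24 * D1).
have eps0 : 0 < eps by rewrite divr_gt0// mulr_gt0.
pose H := c * J%:R / (1 - e).
have H0 : 0 <= H by rewrite divr_ge0 ?mulr_ge0 ?subr_ge0 ?(ltW e1).
pose S1 := Num.max S 1.
have S10 : 0 < S1 by rewrite lt_max ltr01 orbT.
exists (b * eps / (2 * S1)).
  by apply: divr_gt0; apply: mulr_gt0.
(* The starting point costs nothing on average over time. *)
have ces : n%:R^-1 * (\sum_(t < n) \int[lam]_x A (survival P e s nu t) x)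
    @[n --> \oo] --> (0 : R).
  have /cvgrPdist_lt ces := cesaro initial_survival_cvg0.
  pose Z (n : nat) : R := n%:R^-1 * (\sum_(t < n) \int[lam]_x A (survival P e s nu t) x).
  rewrite -[(fun n => _)]/Z -(cvg_shiftS Z).
  apply/cvgrPdist_lt => r r0; have := ces _ r0; apply: filterS => n.
  by rewrite /arithmetic_mean/= /series/= big_mkord /Z.
have e1' : 0 < (1 - e)^-1 by rewrite invr_gt0 subr_gt0.
have ev1 : \forall n \near \oo,
    n%:R^-1 * (\sum_(t < n) \int[lam]_x A (survival P e s nu t) x) < p / (24 * (1 - e)^-1).
  have /cvgrPdist_lt/(_ (p / (24 * (1 - e)^-1))) := ces.
  rewrite divr_gt0 ?mulr_gt0// => /(_ isT); apply: filterS => n.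
  by rewrite sub0r normrN; exact: le_lt_trans (ler_norm _).
(* For [u n] beyond [L] and [L `^ (3 / 2)], the number [k = eps * u n] is at least [1]
   and [H] is small compared with [a * k]. *)
pose L := Num.max (eps^-1) (Num.max 1 (Num.max (4 * H / (b * eps / S1)) (320 * H / (p * (b * eps / S1))))).
have ev2 : \forall n \near \oo, Num.max L (L `^ (3 / 2)) <= u n by exact: (cvgryPge u).1.
near=> n => B mB BC piB.
have n0 : (0 < n)%N by near: n; exists 1%N.
have n0R : 0 < n%:R :> R by rewrite ltr0n.
have uL : Num.max L (L `^ (3 / 2)) <= u n by near: n.
have L1 : 1 <= L by rewrite /L !le_max lexx !orbT.
have u1 : 1 <= u n by rewrite (le_trans L1)// (le_trans _ uL)// le_max lexx.
have u0 : 0 < u n by exact: lt_le_trans u1.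
have epsu : 1 <= eps * u n.
  rewrite -ler_pdivrMl// mulr1 (le_trans _ uL)// le_max; apply/orP; left.
  by rewrite /L le_max lexx.
have uL23 : L <= u n `^ (2 / 3).
  have LE : (L `^ (3 / 2)) `^ (2 / 3) = L.
    rewrite -powRrM (_ : 3 / 2 * (2 / 3) = 1); last by field.
    by rewrite powRr1// (le_trans _ L1).
  rewrite -LE; apply: ge0_ler_powR; rewrite ?nnegrE ?powR_ge0//; first by lra.
  by rewrite (le_trans _ uL)// le_max lexx orbT.
have piB0 : 0 < fine (pi B) by rewrite (lt_le_trans _ piB)// mulr_gt0// powR_gt0.
have piBy : (pi B < +oo)%E by apply: le_lt_trans piC; apply: le_measure; rewrite ?inE.
have [a [h [cva bh hH hE]]] := poisson_equation e0 e1 bs s0 minor c0 dom mB BC.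
have piBa : fine (pi B) <= S * a.
  exact: (inv_le_block_visits e0 e1 bs s0 minor inv ss c0 dom mB BC piBy tp0 cva).
have a0 : 0 <= a.
  rewrite -(cvg_lim _ cva)//; apply: limr_ge; first by apply/cvg_ex; eexists; exact: cva.
  apply: nearW => m; apply: sumr_ge0 => t _; apply: Rintegral_ge0 => x _.
  apply: (sm_ge0 (submarkov_iter t (submarkov_taboo e0 e1 bs s0 minor))).
    exact: bm_indic.
  by move=> y; rewrite indicE.
have SS1 : S <= S1 by rewrite /S1 le_max lexx.
have piBS1 : fine (pi B) <= S1 * a by rewrite (le_trans piBa)// ler_wpM2r.
have a_gt0 : 0 < a.
  rewrite lt_neqAle a0 andbT eq_sym; apply: contraTneq piBS1 => ->.
  by rewrite mulr0 -ltNge.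
pose k := eps * u n.
have k0 : 0 <= k by rewrite mulr_ge0// ltW.
have u23 : u n `^ (- (1 / 3)) * u n = u n `^ (2 / 3).
  rewrite -[X in _ * X](powRr1 (ltW u0)) -powRD; last by apply/implyP => _; rewrite gt_eqF.
  by congr (_ `^ _); field.
have ak : b * eps / S1 * u n `^ (2 / 3) <= a * k.
  have h1 : b * u n `^ (- (1 / 3)) * (eps * u n) <= S1 * a * (eps * u n).
    by rewrite ler_wpM2r// (le_trans piB).
  rewrite -u23 (_ : a * k = S1 * a * (eps * u n) / S1); last first.
    by rewrite /k; field; rewrite gt_eqF.
  rewrite (_ : b * eps / S1 * _ = b * u n `^ (- (1 / 3)) * (eps * u n) / S1); last first.
    by field; rewrite gt_eqF.
  by rewrite ler_pM2r ?invr_gt0.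
have beS : 0 < b * eps / S1 by rewrite divr_gt0// mulr_gt0.
have akL : b * eps / S1 * L <= a * k.
  by apply: le_trans ak; rewrite ler_wpM2l// ltW.
have Hak : 4 * H <= a * k.
  apply: le_trans akL; rewrite [leRHS]mulrC -ler_pdivrMr//.
  by rewrite /L !le_max lexx !orbT.
have Hp : 80 * H / (a * k) <= p / 4.
  have ak0 : 0 < a * k by rewrite mulr_gt0// (lt_le_trans ltr01).
  rewrite ler_pdivrMr//.
  have : 320 * H <= p * (a * k).
    apply: (@le_trans _ _ (p * (b * eps / S1 * L))); last by rewrite ler_wpM2l// ltW.
    have pb : 0 < p * (b * eps / S1) by apply: mulr_gt0.
    rewrite mulrA [leRHS]mulrC -ler_pdivrMr//.
    by rewrite /L !le_max lexx !orbT.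
  by move: (a * k) => y; lra.
have fv := few_visits hX e0 e1 bs s0 minor k0 mB bh hH a0 hE n epsu Hak a_gt0.
have fr := few_regenerations hX e0 e1 bs s0 minor k0 n0.
(* The shares of the probability [p] are [p / 2] for the rate, [p / 4] for the
   starting point, whence the factor [24], and [p / 4] for Chebyshev's inequality. *)
have El : \int[Pr]_w live X s k n w <= 3 / 4 * p.
  have h1 : (\sum_(t < n) tail_prob P e s nu t) * (k + 1) <= 2 * D1 * eps * n%:R.
    have t0 : 0 <= \sum_(t < n) tail_prob P e s nu t.
      by apply: sumr_ge0 => t _; exact: (tail_prob_ge0 e0 e1 bs s0 minor).
    apply: (@le_trans _ _ ((\sum_(t < n) tail_prob P e s nu t) * (2 * eps * u n))).
      by rewrite ler_wpM2l// /k; lra.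
    have rn : (\sum_(t < n) tail_prob P e s nu t) * u n <= D1 * n%:R.
      apply: (@le_trans _ _ (D * n%:R)); first by near: n.
      by rewrite ler_wpM2r// le_max lexx.
    rewrite (_ : _ * (2 * eps * u n) = 2 * eps * ((\sum_(t < n) tail_prob P e s nu t) * u n)); last by ring.
    rewrite (_ : 2 * D1 * eps * n%:R = 2 * eps * (D1 * n%:R)); last by ring.
    by rewrite ler_wpM2l// mulr_ge0// ltW.
  have h2 : (1 - e)^-1 * (\sum_(t < n) \int[lam]_x A (survival P e s nu t) x) <= n%:R * (p / 24).
    have : n%:R^-1 * (\sum_(t < n) \int[lam]_x A (survival P e s nu t) x) < p / (24 * (1 - e)^-1).
      by near: n.
    rewrite ltr_pdivlMr ?mulr_gt0// => /ltW.
    move: (\sum_(_ < _) _) (1 - e)^-1 => z r; rewrite -(ler_pM2l n0R).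
    rewrite (_ : n%:R * (n%:R^-1 * z * (24 * r)) = 24 * (r * z)); last by field; rewrite gt_eqF.
    by move: (r * z) (n%:R) => z' n' hz; lra.
  have h3 : 2 * D1 * eps * n%:R = n%:R * (p / 12) by rewrite /eps; field; rewrite gt_eqF.
  have := le_trans fr (lerD h2 h1); rewrite h3.
  move: (\int[Pr]_w _) => z; rewrite -mulrA -mulrDr (ler_pM2l n0R); lra.
apply: (@le_trans _ _ (\int[Pr]_w live X s k n w + 80 * H / (a * k))); last by lra.
apply: le_trans fv.
have bN : bounded_measurable (fun w => \sum_(t < n) \1_B (X t w) : R).
  by apply: bm_sum => t; apply: (chain_bm hX); exact: bm_indic.
have mlt (r : R) : measurable [set w | (\sum_(t < n) \1_B (X t w) < r)%R].
  rewrite -[Y in measurable Y]setTI; apply: measurable_fun_ltr => //.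
  by have [] := bN.
apply: (bm_integral_le Pr1); [exact: bm_indic|exact: bm_indic|].
move=> w; rewrite !indicE ler_nat.
case: (boolP (w \in _)) => // /set_mem/= small; rewrite mem_set//=.
apply: (lt_le_trans small).
rewrite (_ : _ * _ = b * eps / S1 * u n `^ (2 / 3) / 2); last by field; rewrite gt_eqF.
by rewrite ler_pM2r ?invr_gt0.
Unshelve. all: by end_near.
Qed.

End visits_lower_bound.
(** * The Gamma function on the unit interval *)

Section gamma.
Context {R : realType}.
Implicit Types a x : R.

Local Notation primitive a := (fun x : R => expR (- a * ln (1 + x^-1))).

(** The function is the power [a] of [x / (1 + x)], which increases from [0] to
    [1]. *)
Lemma is_derive_gamma_primitive a x : 0 < x ->
  is_derive x 1 (primitive a) (primitive a x * (a / (x * (x + 1)))).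
Proof.
move=> x0.
have y0 : 0 < 1 + x^-1 by rewrite ltr_wpDl ?invr_gt0.
have dV : is_derive x 1 (fun x : R => 1 + x^-1) (- x ^- 2).
  have := is_derive_cst (1 : R) x 1.
  have := @is_deriveV _ id x 1 1; rewrite gt_eqF// => /(_ isT (is_derive_id _ _)).
  move=> d1 d2; have := is_deriveD d2 d1.
  by rewrite add0r scaler1.
have dl : is_derive x 1 (fun x : R => ln (1 + x^-1)) ((1 + x^-1)^-1 * (- x ^- 2)).
  exact: (@is_derive1_comp _ (@ln R) (fun x : R => 1 + x^-1) _ _ _
    (is_derive1_ln y0) dV).
have dm : is_derive x 1 (fun x : R => - a * ln (1 + x^-1))
    (- a * ((1 + x^-1)^-1 * (- x ^- 2))).
  exact: (is_deriveZ (- a) dl).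
have de := @is_derive1_comp _ expR (fun x : R => - a * ln (1 + x^-1)) _ _ _
  (is_derive_expR _) dm.
apply: (is_derive_eq de).
congr (_ * _); field.
by rewrite gt_eqF ?gt_eqF ?ltr_wpDr.
Qed.

Lemma cvg_gamma_primitive a : primitive a x @[x --> +oo] --> (1 : R).
Proof.
have c1 : (fun x : R => 1 + x^-1) x @[x --> +oo] --> (1 : R).
  rewrite -[X in _ --> X]addr0; apply: cvgD; first exact: cvg_cst.
  by apply/gtr0_cvgV0 => //; near=> x; near: x; apply: nbhs_pinfty_gt.
have c2 : ln (1 + x^-1) @[x --> +oo] --> (0 : R).
  rewrite -[X in _ --> X]ln1; apply: (cvg_comp _ _ c1).
  exact: continuous_ln.
have c3 : - a * ln (1 + x^-1) @[x --> +oo] --> (0 : R).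
  by rewrite -[X in _ --> X](mulr0 (- a)); apply: cvgM => //; exact: cvg_cst.
by rewrite -[X in _ --> X]expR0; apply: (cvg_comp _ _ c3); exact: continuous_expR.
Unshelve. all: by end_near. Qed.

(** From [(1 + x) `^ (a + 1) <= (1 + x) ^+ 2 <= 4 * expR x]; the right-hand side has
    an explicit antiderivative. *)
Lemma gamma_integrand_le a x : 0 < a -> a <= 1 -> 0 < x ->
  x `^ (a - 1) * expR (- x) <=
  4 / a * (primitive a x * (a / (x * (x + 1)))).
Proof.
move=> a0 a1 x0.
have x1 : 0 < 1 + x by rewrite ltr_wpDl.
have -> : 4 / a * (primitive a x * (a / (x * (x + 1)))) =
    4 * (primitive a x / (x * (1 + x))).
  by field; rewrite !gt_eqF// addrC.
have lE : ln (1 + x^-1) = ln (1 + x) - ln x.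
  rewrite -ln_div ?posrE//; congr ln; field; by rewrite gt_eqF.
have -> : primitive a x / (x * (1 + x)) =
    x `^ (a - 1) * expR (- ((a + 1) * ln (1 + x))).
  have -> : x * (1 + x) = expR (ln x) * expR (ln (1 + x)).
    by rewrite !lnK ?posrE.
  rewrite /powR gt_eqF// lE.
  rewrite -expRD -expRN -!expRD; congr expR; ring.
rewrite mulrCA ler_wpM2l ?powR_ge0//.
rewrite !expRN ler_pdivlMr ?expR_gt0// mulrC ler_pdivrMr ?expR_gt0//.
apply: (@le_trans _ _ ((1 + x) ^+ 2)).
  rewrite -[X in _ <= X ^+ 2](lnK (x := 1 + x)) ?posrE// -expRM_natl ler_expR.
  apply: ler_wpM2r; last by lra.
  by rewrite ln_ge0// lerDl ltW.
have e1 := expR_ge1Dx (x / 2).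
have e0 : 0 <= 1 + x / 2 by lra.
have := @lerXn2r _ 2 _ _ e0 (expR_ge0 (x / 2)) e1.
have -> : expR (x / 2) ^+ 2 = expR x by rewrite -expRM_natl mulrC divfK.
move=> h; nra.
Qed.

(** The integral over the half line is first an extended real, and an infinite one
    would be read as zero: positivity includes the convergence at both ends. *)
Lemma Gamma_gt0 a : 0 < a -> a <= 1 -> 0 < Gamma a.
Proof.
move=> a0 a1; rewrite /Gamma /Rintegral.
set f := fun x : R => x `^ (a - 1) * expR (- x).
have f_ge0 x : 0 <= f x by rewrite mulr_ge0 ?powR_ge0 ?expR_ge0.
have mf (A : set R) : measurable A -> measurable_fun A (EFin \o f).
  move=> mA; apply/measurable_EFinP; apply: measurable_funM.
    exact: measurable_funTS (measurable_powR _).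
  apply: measurable_funTS; apply: measurableT_comp => //.
pose F i := `[i.+1%:R^-1 : R, +oo[%classic.
have mF i : measurable (F i) by exact: measurable_itv.
have FE : `]0, +oo[%classic = \bigcup_i F i.
  apply/seteqP; split => x /=; rewrite in_itv/= andbT.
    move=> x0; exists (Num.truncn x^-1) => //; rewrite /F/= in_itv/= andbT.
    by rewrite invf_ple ?posrE// ltW// truncnS_gt.
  by move=> [i _]; rewrite /F/= in_itv/= andbT; apply: lt_le_trans.
have ndF : nondecreasing_seq F.
  move=> i j ij; rewrite subsetEset => x; rewrite /F/= !in_itv/= !andbT.
  by apply: le_trans; rewrite lef_pV2 ?posrE// ler_nat.
have leF i : (\int[lebesgue_measure]_(x in F i) (f x)%:E <= (4 / a)%:E)%E.
  have i0 x : i.+1%:R^-1 <= x -> 0 < x :> R by apply: lt_le_trans.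
  pose g x := 4 / a * (primitive a x * (a / (x * (x + 1)))).
  have dG x : 0 < x ->
      is_derive x 1 (fun x => 4 / a * primitive a x) (g x).
    by move=> x0; exact: is_deriveZ (is_derive_gamma_primitive _ x0).
  have g0 x : i.+1%:R^-1 <= x -> 0 <= g x.
    by move=> /i0 x0; rewrite (le_trans (f_ge0 x))// gamma_integrand_le.
  have cg : {within F i, continuous g}.
    apply: derivable_within_continuous => x.
    rewrite in_itv/= andbT => /i0 x0.
    apply: derivableM; first exact: derivable_cst.
    apply: derivableM; first by case: (is_derive_gamma_primitive a x0).
    apply: derivableM; first exact: derivable_cst.
    apply: derivableV; first by rewrite mulf_neq0 ?gt_eqF ?addr_gt0.
    by apply: derivableM => //; apply: derivableD.
  have mg : measurable_fun (F i) g by exact: subspace_continuous_measurable_fun.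
  apply: (@le_trans _ _ (\int[lebesgue_measure]_(x in F i) (g x)%:E)%E).
    apply: ge0_le_integral.
    - exact: mF.
    - by move=> x _; rewrite lee_fin.
    - exact: mf.
    - exact/measurable_EFinP.
    - move=> x; rewrite /F/= in_itv/= andbT => /i0 x0; rewrite lee_fin.
      exact: gamma_integrand_le.
  pose G x := 4 / a * primitive a x.
  rewrite (_ : integral _ _ _ = (4 / a)%:E - (G i.+1%:R^-1)%:E)%E.
    rewrite -EFinB lee_fin gerBl mulr_ge0 ?expR_ge0//.
    by rewrite divr_ge0 ?ltW.
  apply: (@ge0_continuous_FTC2y _ g G _ _ g0 cg).
  - rewrite -[X in _ --> X]mulr1; apply: cvgM; first exact: cvg_cst.
    exact: cvg_gamma_primitive.
  - by move=> x ix; case: (dG x) => //; rewrite (i0 _ (ltW ix)).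
  - have i1 : 0 < i.+1%:R^-1 :> R by rewrite invr_gt0.
    have [d _] := dG _ i1.
    apply: cvg_at_right_filter.
    by apply: differentiable_continuous; apply/derivable1_diffP.
  - move=> x; rewrite in_itv/= andbT => ix.
    by rewrite derive1E; case: (dG x) => //; rewrite (i0 _ (ltW ix)).
have le_oo : (\int[lebesgue_measure]_(x in `]0%R, +oo[) (f x)%:E <= (4 / a)%:E)%E.
  have fc : (\int[lebesgue_measure]_(x in F i) (f x)%:E)%E @[i --> \oo] -->
      (\int[lebesgue_measure]_(x in `]0%R, +oo[) (f x)%:E)%E.
    rewrite FE; apply: ge0_nondecreasing_set_cvg_integral => //.
      by move=> i; exact: mf.
    by move=> i x _; rewrite lee_fin.
  rewrite -(cvg_lim _ fc)//; apply: lime_le; first by apply/cvg_ex; eexists; exact: fc.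
  by apply: nearW => i; exact: leF.
have ge_1 : ((expR (- 1))%:E <= \int[lebesgue_measure]_(x in `]0%R, +oo[) (f x)%:E)%E.
  apply: (@le_trans _ _ (\int[lebesgue_measure]_(x in `]0%R, 1%R]) (f x)%:E)%E); last first.
    apply: ge0_subset_integral => //; first exact: mf.
      by move=> x _; rewrite lee_fin.
    by move=> x /=; rewrite !in_itv/= andbT => /andP[].
  apply: (@le_trans _ _ (\int[lebesgue_measure]_(x in `]0%R, 1%R]) (expR (- 1))%:E)%E).
    rewrite integral_cst//= lebesgue_measure_itv/= lte_fin ltr01 sube0.
    by rewrite mule1.
  apply: ge0_le_integral => //.
  - exact: mf.
  - move=> x /=; rewrite in_itv/= => /andP[x0 x1]; rewrite lee_fin /f.
    rewrite -[leLHS]mul1r ler_pM ?expR_ge0// ?ler_expR ?lerN2//.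
    rewrite /powR gt_eqF// -[leLHS]expR0 ler_expR mulr_le0 ?subr_le0//.
    exact: ln_le0.
rewrite fine_gt0// (lt_le_trans _ ge_1) ?lte_fin ?expR_gt0//=.
by rewrite (le_lt_trans le_oo)// ltry.
Qed.

End gamma.

(** * Regularly varying tails *)

Section regularly_varying_tail.
Context {R : realType}.
Implicit Types (p u : nat -> R) (r : R).

(** Along [2 ^ k * N] the sequence decays geometrically. *)
Lemma doubling_cvg0 p r : nonincreasing_seq p -> (forall n, 0 <= p n) ->
  (\forall n \near \oo, 0 < p n) -> r < 1 ->
  p n.*2 / p n @[n --> \oo] --> r -> p n @[n --> \oo] --> (0 : R).
Proof.
move=> np p0 pp r1 pr.
pose q := (1 + Num.max r 0) / 2.
have q0 : 0 <= q by rewrite /q; case: (leP r 0) => ?; lra.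
have q1 : q < 1 by rewrite /q; case: (leP r 0) => ?; lra.
have rq : r < q by rewrite /q; case: (leP r 0) => ?; lra.
have [N _ NP] : \forall n \near \oo, 0 < p n /\ p n.*2 <= q * p n.
  near=> n.
  have pn : 0 < p n by near: n.
  split => //; rewrite -ler_pdivrMr//; near: n.
  exact: cvgr_le pr _ rq.
have pk k : p (2 ^ k * N)%N <= q ^+ k * p N.
  elim: k => [|k IH]; first by rewrite mul1n mul1r.
  rewrite expnS -mulnA mul2n.
  have [|_ h] := NP (2 ^ k * N)%N; first by rewrite /= leq_pmull// expn_gt0.
  by rewrite (le_trans h)// exprS -mulrA ler_wpM2l.
apply/cvgrPdist_le => e e0.
have [k _ kP] : \forall k \near \oo, q ^+ k * p N <= e.
  have : q ^+ k * p N @[k --> \oo] --> 0 * p N.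
    by apply: cvgM; [apply: cvg_expr; rewrite ger0_norm|exact: cvg_cst].
  by rewrite mul0r => /cvgr_le; exact.
exists (2 ^ k * N)%N => // n /= kn.
rewrite sub0r normrN ger0_norm//.
by rewrite (le_trans (np _ _ kn))// (le_trans (pk k))//; exact: (kP k (leqnn k)).
Unshelve. all: by end_near. Qed.

(** Halving the range of summation gives
[a_n <= a_h + (n - h) p_h] with [h] about [n / 2] and [p_h <= p_n / q] for some
[q > 1 / 2], so that a bound [a_h <= c h p_h] reproduces itself at [n]. *)
Lemma doubling_sum_le p r : nonincreasing_seq p -> (forall n, 0 <= p n) ->
  (\forall n \near \oo, 0 < p n) -> 1 / 2 < r ->
  p n.*2 / p n @[n --> \oo] --> r ->
  exists2 c, 0 <= c & \forall n \near \oo, \sum_(t < n) p t <= c * (n%:R * p n).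
Proof.
move=> np p0 pp r1 pr.
pose q := (1 / 2 + r) / 2.
have q1 : 1 / 2 < q by rewrite /q; lra.
have qr : q < r by rewrite /q; lra.
pose l := (1 / 2 + q) / 2.
have lq : l < q by rewrite /l; lra.
have [N _ NP] : \forall n \near \oo,
    [/\ 0 < p n, q * p n <= p n.*2 & n.+1%:R / 2 <= l * n%:R].
  near=> n.
  have pn : 0 < p n by near: n.
  split => //; first by rewrite -ler_pdivlMr//; near: n; exact: cvgr_ge pr _ qr.
  have : (q / 2 - 1 / 4)^-1 / 2 <= n%:R by near: n; exact: nbhs_infty_ger.
  have d0 : 0 < q / 2 - 1 / 4 by lra.
  rewrite ler_pdivrMr// -[_^-1]div1r ler_pdivrMr// => h.
  by rewrite -[n.+1%:R]natr1 /l; lra.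
(* The first term serves the range up to [2 N + 1], on which the induction starts;
   the second one makes [c * l + 1 / 2 <= c * q]. *)
pose c := Num.max (p 0%N / p N.*2.+1) (1 / (2 * (q - l))).
have c1 : p 0%N / p N.*2.+1 <= c by rewrite le_max lexx.
have c2 : 1 / (2 * (q - l)) <= c by rewrite le_max lexx orbT.
have c0 : 0 <= c by rewrite (le_trans _ c2)// divr_ge0//; lra.
exists c => //; exists N => // n /=.
elim/ltn_ind: n => n IH Nn.
have [nN|Nn2] := leqP n N.*2.+1.
  have pN : 0 < p N.*2.+1 by have [/=|] := NP N.*2.+1; first lia.
  apply: (@le_trans _ _ (n%:R * p 0%N)).
    rewrite mulr_natl -[n in leRHS]card_ord -sumr_const ler_sum// => i _.
    exact: np.
  rewrite mulrCA ler_wpM2l//; move: c1; rewrite ler_pdivrMr// => /le_trans; apply.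
  by rewrite ler_wpM2l// np.
set h := uphalf n.
have hn : (h < n)%N by rewrite /h; lia.
have Nh : (N <= h)%N by rewrite /h; lia.
have n2h : (n <= h.*2)%N by rewrite /h; lia.
have nh : ((n - h) * 2 <= n)%N by rewrite /h; lia.
have hn2 : (h * 2 <= n.+1)%N by rewrite /h; lia.
have [ph qh _] := NP _ Nh; have [pn _ ln] := NP _ Nn.
have qn : q * p h <= p n by rewrite (le_trans qh)// np.
have -> : \sum_(t < n) p t = \sum_(t < h) p t + \sum_(h <= t < n) p t.
  by rewrite -!(big_mkord xpredT) (big_cat_nat (n := h))//= ltnW.
have s1 : \sum_(t < h) p t <= c * (h%:R * p h) by exact: IH.
have s2 : \sum_(h <= t < n) p t <= n%:R / 2 * p h.
  apply: (@le_trans _ _ (\sum_(h <= t < n) p h)).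
    rewrite big_nat_cond [leRHS]big_nat_cond ler_sum// => t.
    by rewrite andbT => /andP[ht _]; exact: np.
  rewrite sumr_const_nat -[leLHS]mulr_natl ler_wpM2r//.
  by rewrite ler_pdivlMr// -natrM ler_nat.
have hl : h%:R <= l * n%:R.
  by rewrite (le_trans _ ln)// ler_pdivlMr// -natrM ler_nat.
rewrite (le_trans (lerD s1 s2))//.
have e1 : c * (h%:R * p h) <= c * (l * n%:R * p h).
  by rewrite ler_wpM2l// ler_wpM2r// ltW.
have e2 : c * (n%:R * (q * p h)) <= c * (n%:R * p n) by rewrite !ler_wpM2l.
suff : c * (l * n%:R * p h) + n%:R / 2 * p h <= c * (n%:R * (q * p h)) by lra.
have e3 : 1 / 2 <= c * (q - l).
  move: c2; rewrite ler_pdivrMr; last by lra.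
  by lra.
have : 0 <= (c * (q - l) - 1 / 2) * (n%:R * p h).
  by rewrite mulr_ge0 ?subr_ge0// mulr_ge0// ltW.
lra.
Unshelve. all: by end_near. Qed.

Lemma slowly_varying_nat (L : R -> R) : slowly_varying L ->
  (\forall n \near \oo, 0 < L n%:R) /\
  L (n.*2)%:R / L n%:R @[n --> \oo] --> (1 : R).
Proof.
move=> [_ Lp Lc]; have cn : n%:R @[n --> \oo] --> (+oo : set_system R).
  exact: cvgr_idn.
split; first exact: cn Lp.
have -> : (fun n => L n.*2%:R / L n%:R) =
    (fun x => L (2 * x) / L x) \o [eta Algebra.natmul 1].
  by apply/funext => n; rewrite /= -natrM mul2n.
exact: cvg_comp _ _ cn (Lc 2 (ltr0Sn _ _)).
Qed.

(** The product [p n * u n] converges, so that [p] inherits from [u] the limit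
    [2 `^ (- beta)] of its doubling ratios. This number is below [1], hence [p]
    tends to zero and [u] to infinity; it is above [1 / 2], hence the sums of [p] up
    to [n] are at most of order [n * p n], that is [n / u n]. *)
Lemma regular_tail p (g beta : R) (L : R -> R) : nonincreasing_seq p ->
    (forall n, 0 <= p n) -> 0 < g -> 0 < beta -> beta < 1 -> slowly_varying L ->
    p ~_\oo (fun n => 1 / (g * n%:R `^ beta * L n%:R)) ->
  let u n := n%:R `^ beta * L n%:R in
  [/\ p n @[n --> \oo] --> (0 : R), u n @[n --> \oo] --> (+oo : set_system R)
    & exists D, \forall n \near \oo, (\sum_(t < n) p t) * u n <= D * n%:R].
Proof.
move=> np p0 g0 b0 b1 /slowly_varying_nat[Lp L2] pe u.
have up : \forall n \near \oo, 0 < u n.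
  near=> n; rewrite mulr_gt0 ?powR_gt0//; last by near: n.
  by rewrite ltr0n; near: n; exact: nbhs_infty_gt.
have pu : p n * u n @[n --> \oo] --> g^-1.
  apply/cvgrPdist_le => e e0.
  have /eqaddoP/(_ (e * g)) := pe.
  rewrite mulr_gt0// => /(_ isT) h.
  near=> n.
  have un : 0 < u n by near: n.
  have : `|p n - 1 / (g * u n)| <= e * g * `|1 / (g * u n)|.
    rewrite mulrA; near: n; exact: h.
  have gu0 : 0 <= 1 / (g * u n) by apply/ltW/divr_gt0 => //; exact: mulr_gt0.
  rewrite (ger0_norm gu0) [X in _ -> X <= _]distrC => le.
  have -> : p n * u n - g^-1 = (p n - 1 / (g * u n)) * u n.
    by field; rewrite !gt_eqF.
  rewrite normrM (ger0_norm (ltW un)) -ler_pdivlMr//.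
  rewrite (le_trans le)// le_eqVlt; apply/orP; left; apply/eqP.
  by field; rewrite !gt_eqF.
have pp : \forall n \near \oo, 0 < p n.
  have g1 : g^-1 / 2 < g^-1 by rewrite gtr_pMr ?invr_gt0//; lra.
  near=> n.
  have un : 0 < u n by near: n.
  have : g^-1 / 2 <= p n * u n by near: n; exact: cvgr_ge pu _ g1.
  by move=> h; rewrite -(pmulr_lgt0 _ un) (lt_le_trans _ h)// divr_gt0 ?invr_gt0.
have u2 : u n / u n.*2 @[n --> \oo] --> 2 `^ (- beta).
  have c : (2 `^ beta * (L n.*2%:R / L n%:R))^-1 @[n --> \oo] --> (2 `^ beta * 1)^-1.
    apply: cvgV; first by rewrite mulr1 gt_eqF ?powR_gt0.
    by apply: cvgM => //; exact: cvg_cst.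
  rewrite powRN -[2 `^ beta]mulr1; apply: cvg_trans c; apply: near_eq_cvg.
  near=> n.
  have n0 : 0 < n%:R :> R by rewrite ltr0n; near: n; exact: nbhs_infty_gt.
  have Ln : 0 < L n%:R by near: n.
  have Ln2 : 0 < L n.*2%:R.
    have : (n <= n.*2)%N by rewrite -addnn leq_addr.
    near: n; case: Lp => N _ NP; exists N => // n /= Nn n2.
    exact: NP (leq_trans Nn n2).
  have e2 : n.*2%:R `^ beta = 2 `^ beta * n%:R `^ beta :> R.
    by rewrite -mul2n natrM powRM.
  rewrite /u e2; field.
  by rewrite !gt_eqF ?powR_gt0.
have ev2 (Q : nat -> Prop) : (\forall n \near \oo, Q n) ->
    \forall n \near \oo, Q n.*2.
  move=> [N _ NP]; exists N => // n /= Nn; apply: NP => /=.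
  by rewrite (leq_trans Nn)// -addnn leq_addr.
have p2 : p n.*2 / p n @[n --> \oo] --> 2 `^ (- beta).
  have pu2 : p n.*2 * u n.*2 @[n --> \oo] --> g^-1.
    by apply/cvgrPdist_le => e e0; apply: (ev2 (fun n => `|g^-1 - p n * u n| <= e));
      move/cvgrPdist_le : pu; exact.
  have c : (p n.*2 * u n.*2) / (p n * u n) * (u n / u n.*2) @[n --> \oo] -->
      g^-1 / g^-1 * 2 `^ (- beta).
    apply: cvgM => //; apply: cvgM => //; apply: cvgV => //.
    by rewrite gt_eqF ?invr_gt0.
  have <- : g^-1 / g^-1 * 2 `^ (- beta) = 2 `^ (- beta).
    by rewrite divff ?mul1r// gt_eqF ?invr_gt0.
  apply: cvg_trans c; apply: near_eq_cvg; near=> n.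
  have pn : 0 < p n by near: n.
  have un : 0 < u n by near: n.
  have un2 : 0 < u n.*2 by near: n; exact: (ev2 (fun n => 0 < u n)).
  by field; rewrite !gt_eqF.
have r1 : 2 `^ (- beta) < 1 :> R.
  by rewrite /powR pnatr_eq0/= -[ltRHS]expR0 ltr_expR mulNr oppr_lt0 mulr_gt0// ln_gt0// ltr1n.
have r2 : 1 / 2 < 2 `^ (- beta) :> R.
  rewrite powRN div1r ltf_pV2 ?posrE ?powR_gt0// /powR pnatr_eq0/=.
  rewrite -[ltRHS](lnK (x := 2)) ?posrE// ltr_expR gtr_pMl// ln_gt0// ltr1n//.
have pc := doubling_cvg0 np p0 pp r1 p2.
split => //.
  apply/cvgryPge => A.
  have A0 : 0 < Num.max A 1 by rewrite lt_max ltr01 orbT.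
  have l0 : 0 < g^-1 / 2 / Num.max A 1 by rewrite !divr_gt0 ?invr_gt0.
  have g1 : g^-1 / 2 < g^-1 by rewrite gtr_pMr ?invr_gt0//; lra.
  near=> n.
  have pn : 0 < p n by near: n.
  have h1 : g^-1 / 2 <= p n * u n by near: n; exact: cvgr_ge pu _ g1.
  have : p n <= g^-1 / 2 / Num.max A 1 by near: n; exact: cvgr_le pc _ l0.
  rewrite ler_pdivlMr// => /le_trans/(_ h1).
  by rewrite ler_pM2l// ge_max => /andP[].
have [c c0 cP] := doubling_sum_le np p0 pp r2 p2.
exists (c * (g^-1 + 1)).
have g1 : g^-1 < g^-1 + 1 by rewrite ltrDl.
near=> n.
have un : 0 < u n by near: n.
have h1 : p n * u n <= g^-1 + 1 by near: n; exact: cvgr_le pu _ g1.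
have h2 : \sum_(t < n) p t <= c * (n%:R * p n) by near: n.
apply: (@le_trans _ _ (c * (n%:R * p n) * u n)).
  by rewrite ler_wpM2r// ltW.
rewrite -!mulrA ler_wpM2l// [leRHS]mulrC ler_wpM2l//.
Unshelve. all: by end_near. Qed.

End regularly_varying_tail.
(** * The tail of the return time to the atom *)

Section resolvent_parameter0.
Context {R : realType} (P : R.-pker R ~> R).

(** The chain observed at all times. *)
Lemma sampled0 f x : bounded_measurable f -> sampled P 0 f x = kernel_op P f x.
Proof.
move=> bf; congr (kernel_op P _ x); apply/funext => y.
by rewrite resolvent_meanE// ?ltr01// subr0 mul1r mul0r addr0.
Qed.

End resolvent_parameter0.

Section atom.
Context {R : realType} (E : set R) (mE : measurable E).
Variables (P : R.-pker R ~> R) (s : R -> R) (nu : probability R R).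
Hypotheses (PE : forall x, E x -> P x E = 1%E) (ms : measurable_fun setT s)
  (s01 : forall x, 0 <= s x <= 1) (nuE : nu E = 1%E)
  (minor : forall x A, E x -> measurable A -> ((s x)%:E * nu A <= P x A)%E).
Local Notation bm := (@bounded_measurable R _ R).

(** The minorization holds on the state space; with [s] cut off outside of it, it
    holds everywhere. *)
Definition state_weight (x : R) : R := s x * \1_E x.
Local Notation se := state_weight.

Lemma bm_state_weight : bm se.
Proof. by apply: bmM; [exact: bmW ms s01|exact: bm_indic]. Qed.

Lemma state_weight_ge0 x : 0 <= se x.
Proof. by rewrite mulr_ge0// ?indicE//; have /andP[] := s01 x. Qed.

Lemma state_weightE x : E x -> se x = s x.
Proof. by move=> Ex; rewrite /se indicE mem_set// mulr1. Qed.

Let nu1 : nu setT = 1%E. Proof. exact: probability_setT. Qed.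
Let PT x : P x setT = 1%E. Proof. exact: prob_kernel. Qed.

Lemma state_weight_minor f : bm f -> (forall x, 0 <= f x) ->
  forall x, se x * \int[nu]_y f y <= sampled P 0 f x.
Proof.
move=> bf f0 x; rewrite sampled0//; have smP := submarkov_kernel P.
have [Ex|nEx] := pselect (E x); last first.
  rewrite /se indicE memNset// mulr0 mul0r.
  exact: (sm_ge0 smP).
rewrite state_weightE//; apply: minorization_on_events => // A mA.
by rewrite -lee_fin kernel_op_indic// EFinM bm_integral_indic//; exact: minor.
Qed.

Let smK : submarkov (taboo P 0 se nu).
Proof.
exact: (submarkov_taboo (lexx 0) ltr01 bm_state_weight state_weight_ge0 state_weight_minor).
Qed.
Local Notation K := (taboo P 0 se nu).

Lemma taboo0E f x : bm f -> K f x = kernel_op P f x - se x * \int[nu]_y f y.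
Proof. by move=> bf; rewrite /taboo sampled0. Qed.

Lemma iter_taboo_eq n f g : bm f -> bm g -> (forall x, E x -> f x = g x) ->
  forall x, E x -> iter n K f x = iter n K g x.
Proof.
move=> bf bg fg; elim: n => [|n IH] x Ex /=; first exact: fg.
have bi h : bm h -> bm (iter n K h) by exact: (sm_bm (submarkov_iter n smK)).
rewrite !taboo0E; try exact: bi.
rewrite (bm_integral_eq nu1 mE nuE (bi _ bf) (bi _ bg))//.
by rewrite /kernel_op (bm_integral_eq (PT x) mE (PE Ex) (bi _ bf) (bi _ bg)).
Qed.

Context {d : measure_display} {T : measurableType d}.
Variables (Pr : probability T R) (X : nat -> T -> R) (xi : nat -> T -> bool).
Hypotheses (hsplit : split_chain P s nu Pr X xi) (hstart : atom_start E Pr X xi).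

Let mX n : measurable_fun setT (X n). Proof. by have [/(_ n)[]] := hsplit. Qed.
Let mxi n : measurable_fun setT (xi n). Proof. by have [/(_ n)[]] := hsplit. Qed.
Let Pr1 : Pr setT = 1%E. Proof. exact: probability_setT. Qed.

Lemma split_history_id m k :
  <<s split_history X xi m k >> = split_history X xi m k.
Proof. exact/sigma_algebra_id/smallest_sigma_algebra. Qed.

Lemma split_history_X m k t A : (t <= m)%N -> measurable A ->
  split_history X xi m.+1 k (X t @^-1` A).
Proof. by move=> tm mA; apply: sub_sigma_algebra; left; exact: past_gen. Qed.

Lemma split_history_xi m k t : (t <= k)%N ->
  split_history X xi m k.+1 [set w | xi t w].
Proof.
move=> tk; apply: sub_sigma_algebra; right; apply: sub_sigma_algebra.
rewrite -bigcup_mkord_ord/=; exists t; first by rewrite /= ltnS.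
by exists [set true] => //; rewrite setTI inordK.
Qed.

Lemma split_history_measurable m k :
  split_history X xi m.+1 k.+1 `<=` measurable.
Proof.
apply: smallest_sub; first exact: sigma_algebra_measurable.
have sm := @sigma_algebra_measurable _ T.
move=> B []; apply: smallest_sub => // A; rewrite -bigcup_mkord_ord/=.
- by move=> [i _ [D mD <-]]; exact: mX.
- by move=> [i _ [D mD <-]]; exact: mxi.
Qed.

Fixpoint no_return n : set T :=
  if n is m.+1 then no_return m `&` [set w | ~~ xi m.+1 w] else [set w | xi 0%N w].

Lemma no_return_history n m k : (n <= k)%N ->
  split_history X xi m k.+1 (no_return n).
Proof.
have sig : sigma_algebra setT (split_history X xi m k.+1).
  exact: smallest_sigma_algebra.
elim: n => [|n IH] nk /=; first exact: split_history_xi.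
rewrite -split_history_id; apply: (@measurableI _ (g_sigma_algebraType (split_history X xi m k.+1))).
  by rewrite /measurable/= split_history_id; apply: IH; exact: ltnW.
rewrite (_ : [set w | _] = ~` [set w | xi n.+1 w]); last first.
  by apply/seteqP; split => w /= /negP.
apply: (@measurableC _ (g_sigma_algebraType (split_history X xi m k.+1))).
by rewrite /measurable/= split_history_id; exact: split_history_xi.
Qed.

Lemma measurable_no_return n : measurable (no_return n).
Proof. exact: (split_history_measurable (@no_return_history n 1 n (leqnn n))). Qed.

Lemma measurable_xi n : measurable [set w | xi n w].
Proof. exact: (split_history_measurable (@split_history_xi 1 n n (leqnn n))). Qed.

Lemma atom_start_xi0 : Pr [set w | xi 0%N w] = 1%E.
Proof.
have mx0 := measurable_xi 0.
apply/eqP; rewrite eq_le probability_le1//=.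
move: hstart; rewrite /atom_start => <-.
by apply: measureIr => //; rewrite -[X in measurable X]setTI; exact: mX.
Qed.

(** After [n] steps without regeneration the chain has the law [nu K^n]: from [x] no
    regeneration occurs with probability [1 - s x], and the next state is then
    drawn from [(P x - s x nu) / (1 - s x)]; the product is [K]. *)
Lemma no_return_law n A : measurable A ->
  Pr (no_return n `&` X n.+1 @^-1` A) = (\int[nu]_x iter n K \1_A x)%:E.
Proof.
elim: n A => [|n IH] A mA /=.
  have [_ /(_ 0%N setT A) + _ _] := hsplit; rewrite setTI => ->//; last first.
    by rewrite -split_history_id; exact: (@measurableT _ (g_sigma_algebraType _)).
  by rewrite atom_start_xi0 mul1e bm_integral_indic.
have bi h : bm h -> bm (iter n K h) by exact: (sm_bm (submarkov_iter n smK)).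
have mD := measurable_no_return n.
have smP := submarkov_kernel P.
pose Y w := X n.+1 w.
have bY (f : R -> R) : bm f -> @bounded_measurable R _ T (fun w => f (Y w)).
  move=> [mf [M fM]]; split; last by exists M.
  by apply: measurableT_comp => //; exact: mX.
have bD : @bounded_measurable R _ T \1_(no_return n) by exact: bm_indic.
have IHf f : bm f -> \int[Pr]_w (\1_(no_return n) w * f (Y w)) = \int[nu]_x iter n K f x.
  move: f; apply: bm_induction.
  - move=> B mB; apply: EFin_inj; rewrite -IH//.
    rewrite -bm_integral_indic//; last first.
      by apply: measurableI => //; rewrite -[X in measurable X]setTI; exact: mX.
    by congr EFin; apply: eq_Rintegral => w _; rewrite indicI.
  - move=> a f g bf bg fE gE.
    under eq_Rintegral do rewrite mulrDr mulrCA.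
    rewrite (bm_integralD Pr1); last 2 first.
    + by apply/bmZ/bmM => //; exact: bY.
    + by apply/bmM => //; exact: bY.
    rewrite (bm_integralZ Pr1) ?fE ?gE; last by apply/bmM => //; exact: bY.
    under [RHS]eq_Rintegral do rewrite (sm_lin (submarkov_iter n smK))//.
    rewrite (bm_integralD nu1) ?(bm_integralZ nu1)//; try exact: bi.
    exact/bmZ/bi.
  - move=> F f M bF FM Ff FE; have bf := bm_limit bF FM Ff.
    have c1 : \int[Pr]_w (\1_(no_return n) w * F k (Y w)) @[k --> \oo] -->
        \int[Pr]_w (\1_(no_return n) w * f (Y w)).
      apply: (@bm_integral_cvg _ _ _ _ Pr1 _ _ M) => [k|k w|w].
      + by apply: bmM => //; exact: bY.
      + rewrite normrM (le_trans _ (FM k (Y w)))// ler_piMl//.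
        by rewrite ger0_norm indicE ?ler0n// lern1 leq_b1.
      + by apply: cvgM; [exact: cvg_cst|exact: Ff].
    have c2 : \int[nu]_x iter n K (F k) x @[k --> \oo] --> \int[nu]_x iter n K f x.
      apply: (@bm_integral_cvg _ _ _ _ nu1 _ _ M) => [k|k x|x]; first exact: bi.
      + by apply: (sm_norm (submarkov_iter n smK)).
      + exact: (sm_cvg (submarkov_iter n smK) bF FM).
    by rewrite -(cvg_lim _ c1)// -(cvg_lim _ c2)//; under eq_fun do rewrite FE.
have bA : bm (\1_A : R -> R) by exact: bm_indic.
(* The probability of [A] for the next state when no regeneration occurs. Its
   formula means nothing outside [E], where it is replaced by zero. *)
pose phi x : R := (fine (P x A) - s x * fine (nu A)) / (1 - s x).
pose phiE x : R := phi x * \1_E x.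
have PAE x : P x A = (fine (P x A))%:E by rewrite -(kernel_op_indic P x mA).
have nuAE : nu A = (fine (nu A))%:E by rewrite -(bm_integral_indic nu1 mA).
have mphi : measurable_fun setT phi.
  apply: measurable_funM; last first.
      have -> : (fun x => (1 - s x)^-1) = (fun x => (1 - s x) `^ (- 1)).
      apply/funext => x; rewrite powR_inv1// subr_ge0.
      by have /andP[] := s01 x.
    apply: (measurableT_comp (measurable_powR (- 1))).
    exact: measurable_funB.
  apply: measurable_funB.
    rewrite (_ : (fun x => _) = kernel_op P \1_A); first by have [] := sm_bm smP bA.
    by apply/funext => x; rewrite -kernel_op_indic.
  by apply: measurable_funM.
have le_nuP B x : E x -> measurable B -> s x * fine (nu B) <= fine (P x B).
  move=> Ex mB; have := minor Ex mB.
  by rewrite -(kernel_op_indic P x mB) -(bm_integral_indic nu1 mB) -EFinM lee_fin.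
have phi01 x : E x -> 0 <= fine (P x A) - s x * fine (nu A) <= 1 - s x.
  move=> Ex; have h1 := le_nuP A x Ex mA; have h2 := le_nuP _ x Ex (measurableC mA).
  have mC (m : {measure set R -> \bar R}) : m setT = 1%E ->
      fine (m (~` A)) = 1 - fine (m A).
    move=> m1; rewrite -(bm_integral_indic m1 mA).
    rewrite -(bm_integral_indic m1 (measurableC mA))/=.
    rewrite -[X in X - _](bm_integral_cst m1) -(bm_integralB m1)//; last exact: bm_cst.
    by apply: eq_Rintegral => y _; rewrite !indicE in_setC; case: (y \in A); rewrite /= ?subrr ?subr0.
  move: h2; rewrite !mC//; lra.
have phiEb x : 0 <= phiE x <= 1.
  rewrite /phiE indicE; case: (boolP (x \in E)) => [|_]; last by rewrite mulr0 lexx ler01.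
  rewrite inE mulr1 => /phi01 /andP[h1 h2]; have /andP[_ s1] := s01 x.
  rewrite /phi divr_ge0 ?h1//=; last by rewrite subr_ge0.
  have [e|sn] := eqVneq (1 - s x) 0; first by rewrite e invr0 mulr0.
  by rewrite ler_pdivrMr ?mul1r// lt_neqAle eq_sym sn subr_ge0.
have bphiE : bm phiE by apply: bmW phiEb; exact: measurable_funM.
have phiEs x : E x -> phiE x * (1 - s x) = K \1_A x.
  move=> Ex; rewrite taboo0E// state_weightE// /phiE indicE mem_set// mulr1.
  have -> : \int[nu]_y \1_A y = fine (nu A) by rewrite -bm_integral_indic.
  have -> : kernel_op P \1_A x = fine (P x A) by rewrite -kernel_op_indic.
  have [e|sn] := eqVneq (1 - s x) 0; last by rewrite /phi divfK.
  have := phi01 x Ex; rewrite e mulr0 -eq_le => /eqP.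
  by [].
have h0 : Pr (no_return n `&` X n.+1 @^-1` (~` E)) = 0%E.
  rewrite IH; last exact: measurableC.
  congr EFin; rewrite (bm_integral_eq nu1 mE nuE (g := fun=> 0)).
  - exact: (bm_integral_cst nu1).
  - exact/bi/bm_indic/measurableC.
  - exact: bm_cst.
  - move=> x Ex; rewrite -[RHS](sm_zero (submarkov_iter n smK) x).
    apply: iter_taboo_eq => //; [exact/bm_indic/measurableC|exact: bm_cst|].
    by move=> y Ey; rewrite indicE memNset.
have [_ _ /(_ n.+1 (no_return n) A) h3 /(_ n) h4] := hsplit.
have mB : measurable (no_return n `&` [set w | ~~ xi n.+1 w]).
  exact: (measurable_no_return n.+1).
rewrite h3//; last exact: no_return_history.
have -> : (\int[Pr]_(w in no_return n `&` [set w | ~~ xi n.+1 w]) (phi (Y w))%:E =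
   \int[Pr]_(w in no_return n `&` [set w | ~~ xi n.+1 w]) (phiE (Y w))%:E)%E.
  apply: ae_eq_integral => //.
  - apply/measurable_EFinP/measurable_funTS; apply: measurableT_comp => //; exact: mX.
  - by apply/measurable_EFinP/measurable_funTS; have [] := bY _ bphiE.
  exists (no_return n `&` X n.+1 @^-1` (~` E)); split => //.
    apply: measurableI => //; rewrite -[X in measurable X]setTI; apply: mX => //.
    exact: measurableC.
  move=> w /= /not_implyP[[Dw _] ne]; split=> //= Ew; apply: ne.
  by rewrite /phiE indicE mem_set// mulr1.
have mxn : measurable [set w | xi n.+1 w] by exact: measurable_xi.
have bxi : @bounded_measurable R _ T \1_[set w | xi n.+1 w] by exact: bm_indic.
have bs : bm s := bmW ms s01.
rewrite integral_mkcond/=.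
transitivity ((\int[Pr]_w (\1_(no_return n) w * phiE (Y w) * (1 - \1_[set w | xi n.+1 w] w)))%:E)%E.
  rewrite (bm_integralE Pr1); last first.
    by apply: bmM; [apply: bmM => //; exact: bY|apply: bmB => //; exact: bm_cst].
  apply: eq_integral => w _; rewrite patchE in_setI indicE.
  rewrite (_ : (w \in [set w | ~~ xi n.+1 w]) = ~~ (w \in [set w | xi n.+1 w])); last first.
    by apply/idP/negP; rewrite !inE/=; [move/negP|move=> /negP].
  rewrite [\1__ w]indicE; case: (w \in no_return n) => /=; rewrite ?mul0r// mul1r.
  by case: (w \in _); rewrite /= ?subrr ?subr0 ?mulr1 ?mulr0.
congr EFin.
transitivity (\int[Pr]_w (\1_(no_return n) w * phiE (Y w) * (1 - s (Y w)))); last first.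
  under eq_Rintegral do rewrite -mulrA.
  rewrite (IHf (fun x => phiE x * (1 - s x))); last first.
    by apply: bmM => //; apply: bmB => //; exact: bm_cst.
  under [RHS]eq_Rintegral do rewrite -iterS iterSr.
  apply: (bm_integral_eq nu1 mE nuE).
  - by apply/bi/bmM => //; apply: bmB => //; exact: bm_cst.
  - by apply/bi; exact: (sm_bm smK).
  move=> x Ex; apply: iter_taboo_eq => //; last exact: (sm_bm smK).
  by apply/bmM => //; apply: bmB => //; exact: bm_cst.
apply: (@integral_factor R d T Pr (split_history X xi n.+2 n.+1)).
- by rewrite split_history_id; exact: split_history_measurable.
- by apply: bm_integrable => //; apply: bmB => //; exact: bm_cst.
- by apply: bm_integrable => //; apply: bmB; [exact: bm_cst|exact: bY].
- move=> B; rewrite split_history_id => hB; have mB' := split_history_measurable hB.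
  have bB : @bounded_measurable R _ T \1_B by exact: bm_indic.
  rewrite (Rintegral_indicM Pr B (fun w => 1 - \1_[set w | xi n.+1 w] w)).
  rewrite (Rintegral_indicM Pr B (fun w => 1 - s (Y w))).
  under eq_Rintegral do rewrite mulrBr.
  under [RHS]eq_Rintegral do rewrite mulrBr.
  have bsY := bY _ bs; have b1 := @bm_cst R _ T 1.
  rewrite !(bm_integralB Pr1); try by apply: bmM.
  congr (_ - _); apply: EFin_inj.
  have -> : (\int[Pr]_w (\1_B w * \1_[set w | xi n.+1 w] w))%:E =
      Pr (B `&` [set w | xi n.+1 w]).
    rewrite -bm_integral_indic//; last exact: measurableI.
    by congr EFin; apply: eq_Rintegral => w _; rewrite indicI.
  rewrite h4// (bm_integralE Pr1); last by apply: bmM.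
  by rewrite [LHS]integral_mkcond; apply: eq_integral => w _; rewrite patchE indicE; case: (w \in B); rewrite ?mul1r ?mul0r.
- apply: bmM.
    by apply: bm_indic; rewrite /measurable/= split_history_id; exact: no_return_history.
  split; last by exists 1 => w; have /andP[? ?] := phiEb (Y w); rewrite ger0_norm.
  move=> _ C mC; rewrite setTI /measurable/= split_history_id.
  apply: (@split_history_X n.+1 n.+1 n.+1 (phiE @^-1` C)) => //.
  by rewrite -[X in measurable X]setTI; have [h _] := bphiE; exact: h.
Qed.

Lemma return_time1_gt n w : (n%:R%:E < @return_time R T xi 1 w)%E <->
  forall k, (0 < k <= n)%N -> ~~ xi k w.
Proof.
rewrite /=; split=> [h k /andP[k0 kn]|h].
  apply/negP => xk; move: h; apply/negP; rewrite -leNgt.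
  apply: (@le_trans _ _ (k%:R%:E)); last by rewrite lee_fin ler_nat.
  by apply: ereal_inf_lbound; exists k => //=; rewrite lte_fin ltr0n.
apply: (@lt_le_trans _ _ (n.+1%:R%:E)); first by rewrite lte_fin ltr_nat.
apply: le_ereal_inf_tmp => _ /= [k [k0 xk] <-]; rewrite lee_fin ler_nat ltnNge.
apply/negP => kn; have := h k; rewrite kn andbT xk -(ltr0n R) -lte_fin.
by move=> /(_ k0).
Qed.

Lemma atom_tailE n :
  fine (Pr [set w | (n%:R%:E < @return_time R T xi 1 w)%E]) = tail_prob P 0 se nu n.
Proof.
have dE : no_return n =
    [set w | xi 0%N w] `&` [set w | forall k, (0 < k <= n)%N -> ~~ xi k w].
  elim: n => [|n IH] /=.
    by apply/seteqP; split => [w /= x0|w /= []//]; split => // k; rewrite leqn0; case: k.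
  rewrite IH -setIA; congr setI; apply/seteqP; split => w /=.
    move=> [h1 h2] k /andP[k0]; rewrite leq_eqVlt => /orP[/eqP->//|kn].
    by apply: h1; rewrite k0.
  move=> h; split; last by apply: h; rewrite ltnS leqnn.
  by move=> k /andP[k0 kn]; apply: h; rewrite k0 ltnW.
have aE : [set w | (n%:R%:E < @return_time R T xi 1 w)%E] =
    [set w | forall k, (0 < k <= n)%N -> ~~ xi k w].
  by apply/seteqP; split => w /return_time1_gt.
have mA : measurable [set w | forall k, (0 < k <= n)%N -> ~~ xi k w].
  rewrite (_ : [set w | _] = \bigcap_(k in [set k | (0 < k <= n)%N]) [set w | ~~ xi k w])//.
  apply: bigcap_measurableType => // k _; rewrite (_ : [set w | _] = ~` [set w | xi k w]).
    exact/measurableC/measurable_xi.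
  by apply/seteqP; split => w /= /negP.
have := @no_return_law n setT measurableT; rewrite preimage_setT setIT.
rewrite indicT /tail_prob => h.
rewrite aE; apply: EFin_inj; rewrite -[RHS]h fineK ?fin_num_measure//.
apply/eqP; rewrite eq_le; apply/andP; split; last first.
  by rewrite le_measure ?inE//; [exact: measurable_no_return|rewrite dE; exact: subIsetr].
have mx0 := measurable_xi 0.
rewrite [leLHS](measureDI Pr mA mx0) dE setIC.
set z := (X in (X + _)%E); have -> : z = 0%E; last by rewrite add0e.
apply/eqP; rewrite -measure_le0 -(full_measureC Pr1 mx0 atom_start_xi0).
by apply: le_measure; rewrite ?inE; [exact: measurableD|exact: measurableC|move=> w []].
Qed.

End atom.
(** * Minorization for positive and null recurrent chains *)

Lemma null_full_measure {R : realType} {d : measure_display} {T : measurableType d}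
    (m : {measure set T -> \bar R}) (E : set T) :
  m setT = 1%E -> measurable E -> m (~` E) = 0%E -> m E = 1%E.
Proof.
move=> m1 mE h; rewrite -m1 -(setUv E) measureU ?setICr//; last exact: measurableC.
by rewrite -[LHS]adde0 -h.
Qed.

Section small_sets.
Context {R : realType} (E : set R) (mE : measurable E) (P : R.-pker R ~> R)
  (psi : {sigma_finite_measure set R -> \bar R}) (C : set R).
Hypotheses (PE : forall x, E x -> P x E = 1%E) (smallC : small_set E P psi C).
Local Notation bm := (@bounded_measurable R _ R).
Local Notation Pop := (kernel_op P).

Lemma small_set_psi : (0 < psi C)%E.
Proof.
have [_ _ [_ _ + _]] := smallC.
rewrite (_ : [set x | _] = C)//; apply/seteqP; split => x /=; rewrite indicE.
  by rewrite ltr0n lt0b => /set_mem.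
by move=> Cx; rewrite mem_set.
Qed.

(** The kernel being stochastic, a minorizing measure is finite, hence a multiple of
    a probability; and it is carried by [E], like the kernel. *)
Lemma small_set_minor : exists m (a : R) (nu : probability R R),
  [/\ 0 < a, nu E = 1%E & forall f, bm f -> (forall x, 0 <= f x) ->
      forall x, C x -> a * \int[nu]_y f y <= iter m.+1 Pop f x].
Proof.
have [mC CE [_ _ _ [m [nu' [m0 nu'0 nuP]]]]] := smallC.
case: m m0 nuP => // m _ nuP.
have [x0 Cx0] : C !=set0.
  by apply/set0P; apply: contraTneq small_set_psi => ->; rewrite measure0 ltxx.
have smPm := submarkov_iter m.+1 (submarkov_kernel P).
have nuC x B : C x -> measurable B -> (nu' B <= (iter m.+1 Pop \1_B x)%:E)%E.
  move=> Cx mB; rewrite -kernel_powE//; have := nuP x B (CE x Cx) mB.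
  by rewrite indicE mem_set// mul1e.
have nuy : (nu' setT < +oo)%E by rewrite (le_lt_trans (nuC x0 _ Cx0 measurableT))// ltry.
pose a := fine (nu' setT).
have aE : nu' setT = a%:E by rewrite fineK// ge0_fin_numE.
have a0 : 0 < a by rewrite -lte_fin -aE.
pose nu : probability R R := mnormalize nu' (dirac x0).
have nuE B : nu B = (a^-1%:E * nu' B)%E.
  rewrite /nu/= /mnormalize gt_eqF//= lt_eqF//= muleC.
  by [].
exists m, a, nu; split=> //.
  have n0 : nu' (~` E) = 0%E.
    apply/eqP; rewrite -measure_le0.
    apply: (le_trans (nuC x0 _ Cx0 (measurableC mE))).
    rewrite (iter_kernel_op_eq0 mE PE)//; last exact: CE.
      exact/bm_indic/measurableC.
    by move=> x Ex; rewrite indicE memNset.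
  have : nu (~` E) = 0%E by rewrite nuE n0 mule0.
  exact: (null_full_measure (probability_setT nu) mE).
move=> f bf f0 x Cx; apply: minorization_on_events => // B mB.
have nu'E : nu' B = (fine (nu' B))%:E.
  rewrite fineK// ge0_fin_numE// (le_lt_trans _ nuy)//.
  by rewrite le_measure ?inE.
have -> : \int[nu]_y \1_B y = a^-1 * fine (nu' B).
  apply: EFin_inj; rewrite (bm_integral_indic (probability_setT nu))//.
  by rewrite EFinM -nu'E; exact: nuE.
by rewrite mulrA divff ?gt_eqF// mul1r -lee_fin -nu'E; exact: nuC.
Qed.

End small_sets.

Section taboo_le.
Context {R : realType} (P : R.-pker R ~> R) (s : R -> R) (nu : probability R R).
Local Notation bm := (@bounded_measurable R _ R).
Local Notation Pop := (kernel_op P).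
Hypotheses (bs : bm s) (s0 : forall x, 0 <= s x)
  (minor : forall f, bm f -> (forall x, 0 <= f x) ->
     forall x, s x * \int[nu]_y f y <= sampled P 0 f x).
Local Notation K := (taboo P 0 s nu).
Let smK : submarkov K. Proof. exact: (submarkov_taboo (lexx 0) ltr01 bs s0 minor). Qed.

Lemma iter_taboo_le f n x : bm f -> (forall x, 0 <= f x) ->
  iter n K f x <= iter n Pop f x.
Proof.
move=> bf f0; have smP := submarkov_kernel P; elim: n x => [//|n IH] x /=.
have bK : bm (iter n K f) by exact: (sm_bm (submarkov_iter n smK)).
have bP : bm (iter n Pop f) by exact: (sm_bm (submarkov_iter n smP)).
apply: le_trans (sm_le smP x bK bP IH).
rewrite /taboo sampled0// gerBl mulr_ge0//.
by apply: Rintegral_ge0 => y _; apply: (sm_ge0 (submarkov_iter n smK)).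
Qed.

End taboo_le.

Section visits.
Context {R : realType} (E : set R) (mE : measurable E) (P : R.-pker R ~> R)
  (psi pi : {sigma_finite_measure set R -> \bar R}) (C : set R).
Hypotheses (PE : forall x, E x -> P x E = 1%E) (psiE : (0 < psi E)%E)
  (hpi : invariant_measure E P pi) (smallC : small_set E P psi C)
  (piC0 : fine (pi C) != 0).
Context {d1 : measure_display} {T1 : measurableType d1} (X1 : nat -> T1 -> R)
  (PP : probability R R -> probability T1 R).
Hypotheses (hPP : markov_family P X1 PP) (hharris : harris_recurrent E psi X1 PP).
Context (lam : probability R R) (lamE : lam E = 1%E)
  {d : measure_display} {T : measurableType d} (Pr : probability T R)
  (X : nat -> T -> R) (hX : markov_chain P lam Pr X).
Variable u : nat -> R.
Local Notation bm := (@bounded_measurable R _ R).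
Local Notation Pop := (kernel_op P).

(** Recurrence enters the statistical argument through this property alone. *)
Definition often_visited := u n @[n --> \oo] --> (+oo : set_system R) /\
  forall b p : R, 0 < b -> 0 < p ->
  exists2 g : R, 0 < g & \forall n \near \oo, forall B : set R, measurable B ->
    B `<=` C -> b * u n `^ (- (1 / 3)) <= fine (pi B) ->
    \int[Pr]_w \1_[set w | \sum_(t < n) \1_B (X t w) < g * u n `^ (2 / 3)] w <= p.

Let inv B : measurable B -> pi B = (\int[pi]_x P x B)%E.
Proof. by have [_ _] := hpi; exact. Qed.
Let mC : measurable C. Proof. by have [] := smallC. Qed.
Let CE : C `<=` E. Proof. by have [] := smallC. Qed.
Let piCy : (pi C < +oo)%E.
Proof. by rewrite ltey; apply: contra_neq piC0 => ->. Qed.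
Let piC_gt0 : 0 < fine (pi C).
Proof. by rewrite lt_neqAle eq_sym piC0 fine_ge0. Qed.

(** The chain sampled at geometric times may reach the minorizing measure of [C] in
    one step, so that the weight can be taken constant on [C]; the mean block length
    is finite by [sum_tail_prob_le]. *)
Lemma positive_often_visited : (pi E < +oo)%E -> (forall n, u n = n%:R) ->
  often_visited.
Proof.
move=> piE uE; have [m [a [nu [a0 nuE nuP]]]] := small_set_minor mE PE smallC.
pose e : R := 1 / 2.
have e0 : 0 <= e by rewrite divr_ge0.
have e1 : e < 1 by rewrite /e; lra.
(* The geometric time equals [m] with probability [(1 - e) * e ^+ m]. *)
pose eta := (1 - e) * e ^+ m * a.
have eta0 : 0 < eta by rewrite !mulr_gt0// ?exprn_gt0// /e; lra.
pose s x := eta * \1_C x.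
have bC : bm \1_C by exact: bm_indic.
have bs : bm s by exact: bmZ.
have C01 x : 0 <= \1_C x :> R by rewrite indicE ler0n.
have s0 x : 0 <= s x by rewrite mulr_ge0// ltW.
have sC x : C x -> s x = eta by move=> Cx; rewrite /s indicE mem_set// mulr1.
have smP := submarkov_kernel P.
have smA := submarkov_resolvent_mean P e0 e1.
have minor f : bm f -> (forall x, 0 <= f x) ->
    forall x, s x * \int[nu]_y f y <= sampled P e f x.
  move=> bf f0 x.
  have bA : bm (resolvent_mean P e f) by exact: (sm_bm smA).
  have A0 y : 0 <= resolvent_mean P e f y by exact: (sm_ge0 smA).
  have [Cx|nCx] := pselect (C x); last first.
    by rewrite /s indicE memNset// mulr0 mul0r; exact: (sm_ge0 smP).
  have lA j y : (1 - e) * e ^+ j * iter j Pop f y <= resolvent_mean P e f y.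
    elim: j y => [|j IH] y.
      rewrite expr0 mulr1 /= resolvent_meanE// lerDl mulr_ge0//.
      exact: (sm_ge0 smP).
    rewrite resolvent_meanE//.
    have bj : bm (iter j Pop f) by exact: (sm_bm (submarkov_iter j smP)).
    have := sm_le smP y (bmZ ((1 - e) * e ^+ j) bj) bA IH.
    rewrite (smZ smP)// => h.
    apply: (@le_trans _ _ (e * sampled P e f y)); last first.
      by rewrite lerDr mulr_ge0// subr_ge0 ltW.
    rewrite [leLHS](_ : _ = e * ((1 - e) * e ^+ j * Pop (iter j Pop f) y)).
      by rewrite ler_wpM2l.
    by rewrite exprS iterS; ring.
  rewrite sC// /eta -mulrA.
  have bm' : bm (iter m Pop f) by exact: (sm_bm (submarkov_iter m smP)).
  have := sm_le smP x (bmZ ((1 - e) * e ^+ m) bm') bA (lA m).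
  rewrite (smZ smP)//; apply: le_trans.
  by rewrite ler_wpM2l ?nuP// mulr_ge0 ?exprn_ge0// subr_ge0 ltW.
have tp0 : tail_prob P e s nu n @[n --> \oo] --> (0 : R).
  apply: (@tail_prob_cvg0 _ P e s nu e0 e1 bs s0 minor E C eta) => //.
    move=> h dd bh hP d0.
    exact: (subharmonic_no_gain mE PE psiE hPP hharris bh hP mC CE (small_set_psi smallC)).
  by move=> x /sC ->.
have van x : E x -> resolvent_mean P e (survival P e s nu n) x @[n --> \oo] --> (0 : R).
  move=> Ex.
  by have [] := survival_vanishes e0 e1 bs s0 minor mE nuE
    (harmonic_constant mE PE psiE hPP hharris) tp0 Ex.
have sC1 : pi_summable pi \1_C.
  by apply: pi_summable_lty => //; rewrite integral_indic// setIT.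
have ss : pi_summable pi s.
  split=> //; have [_ _ ic] := sC1.
  exact: (integrableZl measurableT eta ic).
have SE : \int[pi]_x s x = eta * fine (pi C).
  rewrite RintegralZl//; last by have [] := sC1.
  by rewrite /Rintegral integral_indic// setIT.
have S0 : 0 < \int[pi]_x s x by rewrite SE mulr_gt0.
have piT : (pi setT < +oo)%E.
  have [_ pE _] := hpi.
  rewrite -(setUv E) measureU//; [|exact: measurableC|by rewrite setICr].
  by rewrite [X in (_ + X)%E](_ : _ = 0%E) ?adde0.
have un : u n @[n --> \oo] --> (+oo : set_system R).
  by under eq_fun do rewrite uE; exact: cvgr_idn.
split=> // b p b0 p0.
apply: (@visits_lower_bound R d T P lam Pr X pi E C e s nu eta^-1 1 u
  (fine (pi setT) / \int[pi]_x s x)) => //.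
- by rewrite invr_ge0 ltW.
- move=> x; rewrite /survival/= (taboo1 P s nu e0 e1) opprB addrC subrK /s.
  by rewrite mulrA mulVf ?mul1r// gt_eqF.
- apply: nearW => n; rewrite uE ler_wpM2r// ler_pdivlMr// mulrC.
  exact: (sum_tail_prob_le e0 e1 bs s0 minor inv ss).
Qed.

(** The tail of the return time to the atom is the one of the blocks of the given
    minorization, which yields the rate. A regeneration soon after a visit to [C] is
    obtained from the minorizing measure of [C], from which regeneration is
    certain. *)
Lemma null_often_visited (s : R -> R) (nu : probability R R)
    {d2 : measure_display} {T2 : measurableType d2} (X2 : nat -> T2 -> R)
    (xi : nat -> T2 -> bool) (Patom : probability T2 R) (beta : R) (L : R -> R) :
  measurable_fun setT s -> (forall x, 0 <= s x <= 1) -> nu E = 1%E ->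
  (forall x A, E x -> measurable A -> ((s x)%:E * nu A <= P x A)%E) ->
  split_chain P s nu Patom X2 xi -> atom_start E Patom X2 xi ->
  0 < beta -> beta < 1 -> slowly_varying L -> atom_tail Patom xi beta L ->
  (forall n, u n = n%:R `^ beta * L n%:R) -> often_visited.
Proof.
move=> ms s01 nuE hmin hsplit hstart b0 b1 sL tailL uE.
pose se := state_weight E s.
have e0 : 0 <= 0 :> R by [].
have e1 : 0 < 1 :> R by [].
have bs : bm se := bm_state_weight mE ms s01.
have s0 : forall x, 0 <= se x := state_weight_ge0 E s01.
have minor := state_weight_minor hmin.
have smP := submarkov_kernel P.
have smK := submarkov_taboo e0 e1 bs s0 minor.
have nu1 : nu setT = 1%E by exact: probability_setT.
pose p n := tail_prob P 0 se nu n.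
have pE : p ~_\oo (fun n => 1 / (Gamma (1 - beta) * n%:R `^ beta * L n%:R)).
  rewrite /p; under eq_fun do rewrite -(atom_tailE mE PE ms s01 nuE hmin hsplit hstart).
  exact: tailL.
have np : nonincreasing_seq p.
  by move=> i j ij; exact: (tail_prob_anti e0 e1 bs s0 minor).
have p_ge0 n : 0 <= p n by exact: (tail_prob_ge0 e0 e1 bs s0 minor).
have G0 : 0 < Gamma (1 - beta) by apply: Gamma_gt0; lra.
have [tp0 v_oo [D vrate]] := regular_tail np p_ge0 G0 b0 b1 sL pE.
have {}uE : u = (fun n => n%:R `^ beta * L n%:R) by exact/funext.
have u_oo : u n @[n --> \oo] --> (+oo : set_system R) by rewrite uE; exact: v_oo.
have rate : \forall n \near \oo, (\sum_(t < n) p t) * u n <= D * n%:R.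
  by rewrite uE; exact: vrate.
have van x : E x -> survival P 0 se nu n x @[n --> \oo] --> (0 : R) /\
    resolvent_mean P 0 (survival P 0 se nu n) x @[n --> \oo] --> (0 : R).
  exact: (survival_vanishes e0 e1 bs s0 minor mE nuE
    (harmonic_constant mE PE psiE hPP hharris) tp0).
(* Some set of finite invariant measure is charged by [nu], hence by the transitions
   from [x] in proportion to [s x]. *)
have ss : pi_summable pi se.
  apply: pi_summable_lty => //.
  have [F FT Fpi] := @sigma_finiteT _ _ _ pi.
  have [i nui] : exists i, nu (F i) != 0%E.
    apply: contrapT => /forallNP h; have := nu1; rewrite FT => nuF.
    have : (nu (\bigcup_i F i) <= \sum_(0 <= i <oo) nu (F i))%E.
      apply: measure_sigma_subadditive => [i| |//]; first by have [] := Fpi i.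
      by apply: bigcup_measurable => i _; have [] := Fpi i.
    rewrite eseries0 => [|i _ _]; last by apply/eqP/negPn/negP; exact: h.
    by rewrite nuF lee_fin ler10.
  have [mF piF] := Fpi i.
  pose nF := \int[nu]_x \1_(F i) x.
  have nFE : nu (F i) = nF%:E by rewrite /nF bm_integral_indic.
  have nF0 : 0 < nF.
    rewrite lt_neqAle; apply/andP; split.
      by apply: contra_neq nui => h; rewrite nFE -h.
    by apply: Rintegral_ge0 => x _; rewrite indicE ler0n.
  have : (nF%:E * \int[pi]_x (se x)%:E <= pi (F i))%E.
    rewrite (inv mF) -ge0_integralZl//; last 3 first.
    + by apply/measurable_EFinP; have [] := bs.
    + by move=> x _; rewrite lee_fin.
    + by rewrite lee_fin ltW.
    apply: ge0_le_integral => //.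
    + by move=> x _; rewrite mule_ge0 ?lee_fin// ltW.
    + apply/measurable_EFinP/measurable_funM => //; by have [] := bs.
    + exact: measurable_kernel.
    move=> x _; rewrite -(kernel_op_indic P x mF) -EFinM lee_fin mulrC.
    have := minor _ (bm_indic mF) _ x; rewrite sampled0; last exact: bm_indic.
    by apply => y; rewrite indicE ler0n.
  move=> /le_lt_trans/(_ piF) h; rewrite ltey; apply/negP => /eqP h'.
  by move: h; rewrite h' gt0_muley ?lte_fin.
have [m [a [nu' [a0 nu'E nuP]]]] := small_set_minor mE PE smallC.
have bsv t : bm (survival P 0 se nu t) by exact: (bm_survival e0 e1 bs s0 minor).
have sv0 t x : 0 <= survival P 0 se nu t x by exact: (survival_ge0 e0 e1 bs s0 minor).
have sv1 t x : survival P 0 se nu t x <= 1 by exact: (survival_le1 e0 e1 bs s0 minor).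
have nu'1 : nu' setT = 1%E by exact: probability_setT.
(* Almost every point regenerates, so that some horizon [j] captures half of
   the mass of the minorizing measure. *)
have [j hj] : exists j, \int[nu']_x survival P 0 se nu j x <= 1 / 2.
  have c : \int[nu']_x (survival P 0 se nu j x * \1_E x) @[j --> \oo] --> (0 : R).
    rewrite -[X in _ --> X](bm_integral_cst nu'1).
    apply: (@bm_integral_cvg _ _ _ _ nu'1 _ _ 1) => [t|t x|x].
    - by apply: bmM => //; exact: bm_indic.
    - rewrite ger0_norm ?mulr_ge0// ?indicE ?ler0n//.
      by rewrite mulr_ile1 ?ler0n// lern1 leq_b1.
    - rewrite indicE; case: (boolP (x \in E)) => [/set_mem/van[h _]|_].
        by under eq_fun do rewrite mulr1.
      by under eq_fun do rewrite mulr0; exact: cvg_cst.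
  have l0 : 0 < 1 / 2 :> R by [].
  have /cvgr_le/(_ _ l0)[j _ hj] := c.
  exists j; apply: le_trans (hj j (leqnn j)).
  rewrite le_eqVlt; apply/orP; left; apply/eqP.
  apply: (bm_integral_eq nu'1 mE nu'E) => //.
    by apply: bmM => //; exact: bm_indic.
  by move=> x Ex; rewrite indicE mem_set// mulr1.
split=> // b q b_0 q0.
apply: (@visits_lower_bound R d T P lam Pr X pi E C 0 se nu (2 / a) (m.+1 + j) u D) => //.
- by rewrite divr_ge0// ltW.
- move=> x; rewrite indicE; case: (boolP (x \in C)) => [/set_mem Cx|_]; last first.
    by rewrite mulr_ge0 ?divr_ge0 ?subr_ge0// ltW.
  rewrite -ler_pdivrMl ?divr_gt0// invf_div mulr1.
  rewrite -(iter_survival P 0 se nu m.+1 j).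
  have := iter_taboo_le bs s0 minor m.+1 x (bsv j) (sv0 j).
  have smPm := submarkov_iter m.+1 smP.
  have b1' : bm (fun x => 1 - survival P 0 se nu j x) by apply: bmB => //; exact: bm_cst.
  have := nuP _ b1' _ x Cx.
  rewrite (bm_integralB nu'1)//; last exact: bm_cst.
  rewrite (bm_integral_cst nu'1) (smB smPm)//; last exact: bm_cst.
  have -> : iter m.+1 Pop (fun=> 1) x = 1.
    elim: (m.+1) x {Cx} => [//|k IH] x /=.
    by rewrite (_ : iter k Pop (fun=> 1) = (fun=> 1)) ?kernel_op1//; exact/funext.
  move=> /(_ (fun y => _)) h1 h2.
  have {}h1 := h1 ltac:(by move=> y; rewrite subr_ge0).
  have : a / 2 <= a * (1 - \int[nu']_x survival P 0 se nu j x).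
    by rewrite ler_pM2l//; lra.
  by move: h1 h2; lra.
- by move=> x /van[].
Qed.

End visits.
(** * Perturbing the least squares estimator on a block *)

Section isotonic.
Context {R : realType}.
Implicit Types (x z : nat -> R) (f g : R -> R).

Definition nonincreasing_lse (n : nat) (Q : pred nat) x z f :=
  nonincreasing_fun f /\ forall g, nonincreasing_fun g ->
    \sum_(t < n.+1 | Q t) (z t - f (x t)) ^+ 2 <=
    \sum_(t < n.+1 | Q t) (z t - g (x t)) ^+ 2.

(** Lowering the fit by a small [y] where it is at least [q], right of [a],
    keeps it monotone, provided that its values below [q] are capped; so the
    derivative of the sum of squares in that direction is nonnegative. The values
    taken at the data points are finitely many, so that a small cap changes none of
    them. *)
Lemma lse_block_ge n (Q : pred nat) x z f (a q : R) :
  nonincreasing_lse n Q x z f ->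
  0 <= \sum_(t < n.+1 | [&& Q t, a <= x t & q <= f (x t)]) (z t - q).
Proof.
move=> [fd fo].
have [e e0 eP] : exists2 e : R, 0 < e &
    forall t, (t < n.+1)%N -> f (x t) < q -> f (x t) <= q - e.
  elim: (n.+1) => [|m [e e0 IH]]; first by exists 1.
  have [qm|mq] := leP q (f (x m)).
    exists e => // t; rewrite ltnS leq_eqVlt => /orP[/eqP ->|]; last exact: IH.
    by rewrite ltNge qm.
  exists (Num.min e (q - f (x m))); first by rewrite lt_min e0 subr_gt0.
  move=> t; rewrite ltnS leq_eqVlt => /orP[/eqP -> _|tm tq].
    by rewrite lerBrDr addrC -lerBrDr ge_min lexx orbT.
  by rewrite (le_trans (IH t tm tq))// lerD2l lerN2 ge_min lexx.
set J := fun t : 'I_n.+1 => [&& Q t, a <= x t & q <= f (x t)].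
pose S := \sum_(t < n.+1 | J t) (z t - f (x t)).
have S0 : 0 <= S.
  rewrite leNgt; apply/negP => S0.
  pose N : R := \sum_(t < n.+1 | J t) 1.
  have N0 : 0 <= N by apply: sumr_ge0.
  pose y := Num.min e (- S / (N + 1)).
  have N1 : 0 < N + 1 by rewrite ltr_wpDl.
  have y0 : 0 < y by rewrite lt_min e0 divr_gt0// oppr_gt0.
  have ye : y <= e by rewrite ge_min lexx.
  have yN : y * (N + 1) <= - S by rewrite -ler_pdivlMr// ge_min lexx orbT.
  pose g v := if v < a then f v else
    if q <= f v then f v - y else Num.min (f v) (q - e).
  have gf v : g v <= f v.
    rewrite /g; case: ifP => // _; case: ifP => _; last by rewrite ge_min lexx.
    by rewrite gerBl ltW.
  have gd : nonincreasing_fun g.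
    move=> v w vw; have fvw := fd _ _ vw.
    have [va|av] := ltP v a; first by rewrite {2}/g va (le_trans (gf w)).
    have wa : (w < a) = false by apply/negbTE; rewrite -leNgt (le_trans av).
    have va : (v < a) = false by apply/negbTE; rewrite -leNgt.
    rewrite /g va wa; case: (leP q (f v)) => qv; case: (leP q (f w)) => qw.
    - by rewrite lerB.
    - by rewrite ge_min; apply/orP; right; rewrite lerB.
    - by have := lt_le_trans (le_lt_trans fvw qv) qw; rewrite ltxx.
    - by rewrite le_min !ge_min fvw lexx orbT.
  have := fo g gd.
  have gE (t : 'I_n.+1) : Q t -> (z t - g (x t)) ^+ 2 = (z t - f (x t)) ^+ 2 +
      (if J t then y * (2 * (z t - f (x t)) + y) else 0).
    rewrite /J /g => ->/=; case: (leP a (x t)) => _ /=; last by rewrite addr0.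
    case: (leP q (f (x t))) => qf /=; first by ring.
    by rewrite min_l ?addr0// eP.
  rewrite [leRHS](eq_bigr _ gE) big_split/= lerDl -big_mkcondr/=.
  rewrite (eq_bigl J); last by move=> t; rewrite /J; case: (Q t).
  rewrite -mulr_sumr pmulr_rge0// big_split/= -mulr_sumr -/S.
  rewrite -[X in _ + \sum_(_ < _ | _) X]mul1r -mulr_suml -/N.
  lra.
apply: (le_trans S0); apply: ler_sum => t /and3P[_ _ qt].
by rewrite lerB.
Qed.

Lemma lse_block_le n (Q : pred nat) x z f (a q : R) :
  nonincreasing_lse n Q x z f ->
  \sum_(t < n.+1 | [&& Q t, x t <= a & f (x t) <= q]) (z t - q) <= 0.
Proof.
move=> [fd fo].
have h : nonincreasing_lse n Q (fun t => - x t) (fun t => - z t) (fun v => - f (- v)).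
  split=> [v w vw|g gd]; first by rewrite lerN2 fd// lerN2.
  have gd' : nonincreasing_fun (fun v => - g (- v)).
    by move=> v w vw; rewrite lerN2 gd// lerN2.
  have := fo _ gd'.
  rewrite (eq_bigr (fun t : 'I_n.+1 => (- z t - - f (- - x t)) ^+ 2)); last first.
    by move=> t _; rewrite !opprK; ring.
  rewrite [leRHS](eq_bigr (fun t : 'I_n.+1 => (- z t - g (- x t)) ^+ 2))//.
  by move=> t _; rewrite opprK; ring.
have := lse_block_ge (- a) (- q) h.
rewrite -oppr_le0 -sumrN.
rewrite (eq_bigl (fun t : 'I_n.+1 => [&& Q t, x t <= a & f (x t) <= q])); last first.
  by move=> t; rewrite opprK !lerN2.
by under eq_bigr do rewrite opprB addrC opprK.
Qed.

End isotonic.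
(** * Conditional probabilities *)

Section trace.
Context {R : realType} {d : measure_display} {T : measurableType d}.
Variables (Pr : probability T R) (G : set (set T)) (Gm : <<s G >> `<=` measurable)
  (A : set T) (mA : measurable A).

(** The two hypotheses are arguments because the measure structures on this function
    rest on them. *)
Definition trace_measure (_ : <<s G >> `<=` measurable) (_ : measurable A)
  (B : set (g_sigma_algebraType G)) : \bar R := Pr (B `&` A).
Local Notation mu := (trace_measure Gm mA).

Let mu0 : mu set0 = 0%E.
Proof. by rewrite /trace_measure set0I measure0. Qed.

Let mu_ge0 B : (0 <= mu B)%E.
Proof. exact: measure_ge0. Qed.

Let mu_sigma_additive : semi_sigma_additive mu.
Proof.
move=> F mF tF mUF; rewrite /trace_measure setI_bigcupl.
apply: measure_semi_sigma_additive.
- by move=> n; apply: measurableI => //; apply: Gm; exact: mF.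
- apply/trivIsetP => /= i j _ _ ij.
  rewrite setIACA setIid; move/trivIsetP : tF => /(_ _ _ _ _ ij) ->//.
  by rewrite set0I.
- by rewrite -setI_bigcupl; apply: measurableI => //; exact: Gm.
Qed.

HB.instance Definition _ := isMeasure.Build _ _ _ mu mu0 mu_ge0 mu_sigma_additive.

Let mu_fin : fin_num_fun mu.
Proof.
move=> B mB; rewrite ge0_fin_numE// (@le_lt_trans _ _ 1%E) ?ltry//.
by apply: probability_le1; apply: measurableI => //; exact: Gm.
Qed.

HB.instance Definition _ := Measure_isFinite.Build _ _ _ mu mu_fin.

End trace.

Section conditional_probability.
Context {R : realType} {d : measure_display} {T : measurableType d}.
Variables (Pr : probability T R) (G : set (set T)) (Gm : <<s G >> `<=` measurable)
  (Gs : <<s G >> = G).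
Local Notation GT := (g_sigma_algebraType G).
Let Pr1 : Pr setT = 1%E. Proof. exact: probability_setT. Qed.

(** The density of the trace of [A] on [G]; truncating it at [1] changes none of
    its integrals, since it exceeds [1] on a null event only. A bounded version is
    what allows products of conditional probabilities to be integrated. *)
Lemma conditional_probability_exists A : measurable A -> exists p : T -> R,
  is_cond_exp Pr G \1_A p /\ forall w, 0 <= p w <= 1.
Proof.
move=> mA.
pose mu : {finite_measure set GT -> \bar R} := trace_measure Pr Gm measurableT.
pose nu : {finite_measure set GT -> \bar R} := trace_measure Pr Gm mA.
have numu : nu `<< mu.
  apply/null_content_dominatesP => B mB; rewrite /mu /nu /= /trace_measure setIT => B0.
  apply/eqP; rewrite -measure_le0 -B0; apply: measureIl => //; exact: Gm.
have [f [f0 ffin fi fE]] := radon_nikodym_sigma_finite numu.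
have mfG : measurable_fun setT f by case/integrableP: fi.
have idm : @measurable_fun _ _ T GT setT id by move=> _ B mB; rewrite setTI; exact: Gm.
have intE (g : GT -> \bar R) B : measurable_fun setT g -> (forall w, 0 <= g w)%E ->
    <<s G >> B -> (\int[mu]_(w in B) g w = \int[Pr]_(w in B) g w)%E.
  move=> mg g0 GB.
  rewrite [LHS](_ : _ = \int[pushforward Pr (id : T -> GT)]_(w in B) g w)%E.
    by rewrite ge0_integral_pushforward//; exact: measurable_funTS.
  apply: eq_measure_integral => D mD _.
  by rewrite /mu/= /trace_measure setIT.
pose h (w : T) : R := fine (f w).
have fh w : f w = (h w)%:E by rewrite /h fineK.
have h0 w : 0 <= h w by rewrite -lee_fin -fh.
have mhG : @measurable_fun _ _ GT R setT h.
  by apply/measurable_EFinP; rewrite (_ : EFin \o h = f)//; apply/funext => w; rewrite /= -fh.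
have mh : @measurable_fun _ _ T R setT h.
  by move=> _ D mD; apply: Gm; exact: mhG.
have hint B : G B -> (\int[Pr]_(w in B) (h w)%:E = Pr (A `&` B))%E.
  move=> GB; have GB' : <<s G >> B by rewrite Gs.
  rewrite -(intE (fun w => (h w)%:E))//; last exact/measurable_EFinP.
  under eq_integral do rewrite -fh.
  by rewrite setIC; exact/esym/(fE B GB').
have GT' : G setT by rewrite -Gs; exact: (@measurableT _ GT).
have hi : Pr.-integrable setT (EFin \o h).
  apply/integrableP; split; first exact/measurable_EFinP.
  under eq_integral do rewrite /= ger0_norm//.
  by rewrite hint// setIT (le_lt_trans (probability_le1 _ mA))// ltry.
pose p (w : T) : R := Num.min (h w) 1.
have p01 w : 0 <= p w <= 1 by rewrite le_min h0 ler01 ge_min lexx orbT.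
have mpG : @measurable_fun _ _ GT R setT p.
  by apply: measurable_minr => //; exact: measurable_cst.
have mp : @measurable_fun _ _ T R setT p by move=> _ D mD; apply: Gm; exact: mpG.
have bp : @bounded_measurable R _ T p by exact: (@bmW R d T p 1 mp p01).
have ip := bm_integrable Pr1 bp.
exists p; split => //; split => //.
- by apply: bm_integrable => //; exact: bm_indic.
- by move=> D mD; have := mpG measurableT D mD; rewrite setTI /measurable/= Gs.
move=> B GB; have mB : measurable B by apply: Gm; rewrite Gs.
rewrite integral_indic//.
pose D := B `&` [set w | 1 < h w].
have GD : G D.
  rewrite -Gs; apply: (@measurableI _ GT); first by rewrite /measurable/= Gs.
  have := mhG measurableT `]1, +oo[%classic (measurable_itv _).
  rewrite setTI; congr (measurable _); apply/seteqP; split => w /=; rewrite ?in_itv/= ?andbT//.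
have mD : measurable D by apply: Gm; rewrite Gs.
have hB (B' : set T) : measurable B' -> G B' -> \int[Pr]_(w in B') h w = fine (Pr (A `&` B')).
  by move=> _ GB'; rewrite /Rintegral hint.
have diff : \int[Pr]_(w in B) h w - \int[Pr]_(w in B) p w = \int[Pr]_w (\1_D w * (h w - 1)).
  rewrite (Rintegral_indicM Pr B h) (Rintegral_indicM Pr B p) -RintegralB//.
  - apply: eq_Rintegral => w _; rewrite -mulrBr /p /D !indicE in_setI.
    rewrite (_ : (w \in [set w | 1 < h w]) = (1 < h w)); last first.
      by apply/idP/idP; rewrite inE.
    case: (w \in B); rewrite ?mul0r// ?mul1r; case: (ltP 1 (h w)) => h1.
      by rewrite mul1r.
    by rewrite subrr mul0r.
  - exact: (integrable_bmM (bm_indic mB) hi).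
  - exact: (integrable_bmM (bm_indic mB) ip).
have diff0 : \int[Pr]_w (\1_D w * (h w - 1)) = 0.
  apply/eqP; rewrite eq_le; apply/andP; split; last first.
    apply: Rintegral_ge0 => w _; rewrite indicE.
    case: (boolP (w \in D)) => [/set_mem[_ /= h1]|_]; last by rewrite mul0r.
    by rewrite mul1r subr_ge0 ltW.
  under eq_Rintegral do rewrite mulrBr mulr1.
  rewrite RintegralB//; last 2 first.
  - exact: (integrable_bmM (bm_indic mD) hi).
  - exact: (bm_integrable Pr1 (bm_indic mD)).
  rewrite -(Rintegral_indicM Pr D h) hB// subr_le0 -lee_fin bm_integral_indic//.
  rewrite fineK ?fin_num_measure//; last exact: measurableI.
  by apply: measureIr.
have : \int[Pr]_(w in B) p w = fine (Pr (A `&` B)).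
  by apply/eqP; rewrite -hB// eq_sym -subr_eq0 diff diff0.
move=> pE; rewrite -[LHS]fineK; last first.
  by apply: integrable_fin_num => //; exact: integrableS ip.
by rewrite -[fine _]/(\int[Pr]_(w in B) p w) pE fineK// fin_num_measure//; exact: measurableI.
Qed.

End conditional_probability.
(** * Conditionally independent noise *)

Section sub_sigma_algebras.
Context {R : realType} {d : measure_display} {T : measurableType d}.
Variables (Pr : probability T R).
Let Pr1 : Pr setT = 1%E. Proof. exact: probability_setT. Qed.

(** As [integral_factor], with an integrable factor: it is truncated, and the
    truncation removed by dominated convergence. *)
Lemma integral_factor_integrable (G : set (set T)) (U V H : T -> R) :
  <<s G >> `<=` measurable ->
  bounded_measurable U -> bounded_measurable V ->
  (forall B, <<s G >> B -> \int[Pr]_(w in B) U w = \int[Pr]_(w in B) V w) ->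
  @measurable_fun _ _ (g_sigma_algebraType G) R setT H ->
  Pr.-integrable setT (EFin \o H) ->
  \int[Pr]_w (H w * U w) = \int[Pr]_w (H w * V w).
Proof.
move=> Gm bU bV UV mHG iH.
have mH : measurable_fun setT H by move=> _ B mB; apply: Gm; exact: mHG.
pose h k w := H w * \1_[set y : R | `|y| <= k%:R] (H w).
have mI k : measurable [set y : R | `|y| <= k%:R].
  rewrite (_ : [set y : R | `|y| <= k%:R] = `[- k%:R, k%:R]%classic)//.
  by apply/seteqP; split => y /=; rewrite in_itv/= ler_norml.
have hk k w : `|h k w| <= k%:R.
  rewrite /h indicE; case: (boolP (H w \in _)) => [/set_mem h1|_].
    by rewrite mulr1.
  by rewrite mulr0 normr0.
have hH k w : `|h k w| <= `|H w|.
  by rewrite /h indicE; case: (H w \in _); rewrite ?mulr1// mulr0 normr0.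
have mh k : @measurable_fun _ _ (g_sigma_algebraType G) R setT (h k).
  apply: measurable_funM => //; apply: (measurableT_comp _ mHG).
  exact: measurable_indic.
have bh k : @bounded_measurable R _ (g_sigma_algebraType G) (h k).
  by split=> //; exists k%:R; exact: hk.
have ch w : h k w @[k --> \oo] --> H w.
  apply: cvg_near_cst; near=> k; rewrite /h indicE mem_set ?mulr1//=.
  by near: k; exact: nbhs_infty_ger.
have lim Z : bounded_measurable Z ->
    \int[Pr]_w (h k w * Z w) @[k --> \oo] --> \int[Pr]_w (H w * Z w).
  move=> bZ; have [mZ [M ZM]] := bZ.
  have M0 (w : T) : 0 <= M by exact: le_trans (ZM w).
  have iHZ : Pr.-integrable setT (EFin \o (fun w => H w * Z w)).
    by have := integrable_bmM bZ iH; under eq_fun do rewrite mulrC.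
  have := @dominated_convergence _ _ _ Pr setT measurableT
    (fun k w => (h k w * Z w)%:E) (fun w => (H w * Z w)%:E)
    (fun w => (M%:E * `|(H w)%:E|)%E).
  case.
  - move=> k; apply/measurable_EFinP/measurable_funM => //.
    by move=> _ B mB; apply: Gm; exact: mh.
  - exact/measurable_EFinP/measurable_funM.
  - apply: aeW => w _; apply: cvg_EFin; first exact: nearW.
    by apply: cvgM; [exact: ch|exact: cvg_cst].
  - by apply: integrableZl => //; exact: integrable_abse.
  - apply: aeW => w k _ /=; rewrite lee_fin normrM mulrC ler_pM//.
  - by move=> _ _ /=; have := integrable_fin_num measurableT iHZ => /fineK <- /fine_cvg.
rewrite -(cvg_lim _ (lim U bU))// -(cvg_lim _ (lim V bV))//.
have iU := bm_integrable Pr1 bU; have iV := bm_integrable Pr1 bV.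
by under eq_fun do rewrite (integral_factor Gm iU iV UV (bh _)).
Unshelve. all: by end_near. Qed.

(** The events over which the integrals agree form a Dynkin class. *)
Lemma integral_eq_pi_system (G : set (set T)) (U V : T -> R) :
  <<s G >> `<=` measurable -> setI_closed G -> G setT ->
  Pr.-integrable setT (EFin \o U) -> Pr.-integrable setT (EFin \o V) ->
  (forall B, G B -> \int[Pr]_(w in B) U w = \int[Pr]_(w in B) V w) ->
  forall B, <<s G >> B -> \int[Pr]_(w in B) U w = \int[Pr]_(w in B) V w.
Proof.
move=> Gm GI GT iU iV UV.
have setC_int Z B : Pr.-integrable setT (EFin \o Z) -> measurable B ->
    \int[Pr]_(w in ~` B) Z w = \int[Pr]_w Z w - \int[Pr]_(w in B) Z w.
  move=> iZ mB; rewrite (Rintegral_indicM Pr B Z) (Rintegral_indicM Pr (~` B) Z).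
  rewrite -RintegralB//; last exact: (integrable_bmM (bm_indic mB) iZ).
  apply: eq_Rintegral => w _; rewrite !indicE in_setC.
  by case: (w \in B); rewrite /= ?mul0r ?mul1r ?subrr ?subr0.
apply: (@dynkin_induction _ (g_sigma_algebraType G) G) => //.
- exact: UV.
- by move=> B /Gm mB h; rewrite !setC_int// h UV.
- move=> F mF tF h.
  have mF' n : @measurable d T (F n) by apply: Gm; exact: mF.
  have mU : @measurable d T (\bigcup_k F k) by exact: bigcup_measurable.
  congr fine; rewrite !integral_bigcup//; try exact: integrableS measurableT _ _ _.
  apply: eq_eseriesr => k _.
  have fin Z : Pr.-integrable setT (EFin \o Z) ->
      (\int[Pr]_(w in F k) (Z w)%:E = (\int[Pr]_(w in F k) Z w)%:E)%E.
    by move=> iZ; rewrite fineK//; apply: integrable_fin_num => //; exact: integrableS iZ.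
  by rewrite !fin// h.
Qed.

End sub_sigma_algebras.

Section cond_independence.
Context {R : realType} {d : measure_display} {T : measurableType d}.
Variables (Pr : probability T R) (G : set (set T)) (Gm : G `<=` measurable)
  (Gs : <<s G >> = G) (N : nat) (W : 'I_N -> T -> R).
Hypotheses (mW : forall i, measurable_fun setT (W i))
  (hind : cond_independent Pr G W).
Let Pr1 : Pr setT = 1%E. Proof. exact: probability_setT. Qed.
Let Gm' : <<s G >> `<=` measurable. Proof. by rewrite Gs. Qed.

(** Generators, stable under intersection, of the events that do not involve the
    [t]-th variable. *)
Definition other_events (t : 'I_N) : set (set T) :=
  [set B | exists F (A : 'I_N -> set R), [/\ G F, forall i, measurable (A i),
    A t = setT & B = F `&` \bigcap_(i in [set: 'I_N]) W i @^-1` A i]].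

Lemma other_events_setI t : setI_closed (other_events t).
Proof.
move=> _ _ [F1 [A1 [GF1 mA1 A1t ->]]] [F2 [A2 [GF2 mA2 A2t ->]]].
exists (F1 `&` F2), (fun i => A1 i `&` A2 i); split.
- by rewrite -Gs; apply: (@measurableI _ (g_sigma_algebraType G)); rewrite /measurable/= Gs.
- by move=> i; exact: measurableI.
- by rewrite A1t A2t setTI.
- rewrite setIACA; congr (_ `&` _); apply/seteqP; split => w /=.
    by move=> [h1 h2] i _; split; [exact: h1|exact: h2].
  by move=> h; split=> i _; have [] := h i I.
Qed.

Lemma other_events_G t F : G F -> other_events t F.
Proof.
move=> GF; exists F, (fun=> setT); split=> //.
by apply/seteqP; split => w //= [].
Qed.

Lemma other_events_W t i A : i != t -> measurable A -> other_events t (W i @^-1` A).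
Proof.
move=> it mA; exists setT, (fun j => if j == i then A else setT); split=> //.
- by rewrite -Gs; exact: (@measurableT _ (g_sigma_algebraType G)).
- by move=> j; case: ifP.
- by rewrite eq_sym (negbTE it).
- rewrite setTI; apply/seteqP; split => w /=; last by move=> /(_ i I); rewrite eqxx.
  by move=> wA j _; case: eqP => // ->.
Qed.

Lemma other_events_measurable t : other_events t `<=` measurable.
Proof.
move=> _ [F [A [GF mA _ ->]]]; apply: measurableI; first exact: Gm.
apply: fin_bigcap_measurable => // i _.
by rewrite -[X in measurable X]setTI; exact: mW.
Qed.

(** For a generator [F `&` D], with [D] an event of the other variables, conditional
    independence replaces the indicator of [D] by a product [q] of conditional
    probabilities, in front of a function of the [t]-th variable as well as in front
    of a function known to [G]; and [q] is itself known to [G], so that [g] may be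
    replaced by [V]. *)
Lemma other_events_integral t (g V : T -> R) (f : R -> R) :
  measurable_fun setT f -> (forall w, g w = f (W t w)) -> is_cond_exp Pr G g V ->
  forall B, <<s other_events t >> B -> \int[Pr]_(w in B) g w = \int[Pr]_(w in B) V w.
Proof.
move=> mf gE [ig iV mV hV].
apply: integral_eq_pi_system => //.
- apply: smallest_sub; first exact: sigma_algebra_measurable.
  exact: other_events_measurable.
- exact: other_events_setI.
- by apply: other_events_G; rewrite -Gs; exact: (@measurableT _ (g_sigma_algebraType G)).
move=> _ [F [A [GF mA At ->]]].
set D := \bigcap_(i in _) _.
have mF : measurable F by exact: Gm.
have mD : measurable D.
  by apply: fin_bigcap_measurable => // i _; rewrite -[X in measurable X]setTI; exact: mW.
have mWA i B : measurable B -> measurable (W i @^-1` B).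
  by move=> mB; rewrite -[X in measurable X]setTI; exact: mW.
have mG (H : T -> R) : (forall B, measurable B -> G (H @^-1` B)) ->
    @measurable_fun _ _ (g_sigma_algebraType G) R setT H.
  by move=> h _ B mB; rewrite setTI /measurable/= Gs; exact: h.
have mGT (H : T -> R) : (forall B, measurable B -> G (H @^-1` B)) -> measurable_fun setT H.
  by move=> h _ B mB; rewrite setTI; apply: Gm; exact: h.
have cp i : exists p, is_cond_exp Pr G \1_(W i @^-1` A i) p /\ forall w, 0 <= p w <= 1.
  by apply: conditional_probability_exists => //; exact: mWA.
have [p /all_and2[pc p01]] := choice cp.
have mp i : @measurable_fun _ _ (g_sigma_algebraType G) R setT (p i).
  by apply: mG; have [] := pc i.
pose q w := \prod_(i < N | i != t) p i w.
have q01 w : 0 <= q w <= 1.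
  rewrite prodr_ge0 => [|i _]; last by have /andP[] := p01 i w.
  by rewrite prodr_ile1.
have bqG : @bounded_measurable R _ (g_sigma_algebraType G) q.
  split; last by exists 1 => w; have /andP[q0 q1] := q01 w; rewrite ger0_norm.
  rewrite /q; elim: (index_enum _) => [|i r IH].
    by under eq_fun do rewrite big_nil; exact: measurable_cst.
  under eq_fun do rewrite big_cons.
  by case: (i != t) => //; exact: measurable_funM.
have bq : bounded_measurable q by exact: (bm_sub Gm').
(* Conditional independence with an arbitrary event for the [t]-th variable, which [D]
   leaves free. *)
have key (F' : set T) B : G F' -> measurable B ->
    \int[Pr]_w (\1_F' w * \1_D w * \1_(W t @^-1` B) w) =
    \int[Pr]_w (\1_F' w * q w * \1_(W t @^-1` B) w).
  move=> GF' mB; have mF' := Gm GF'.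
  have [pB [pBc pB01]] := conditional_probability_exists Pr Gm' Gs (mWA t B mB).
  pose A' i := if i == t then B else A i.
  pose p' i := if i == t then pB else p i.
  have mA' i : measurable (A' i) by rewrite /A'; case: ifP.
  have pc' i : is_cond_exp Pr G \1_(W i @^-1` A' i) (p' i).
    by rewrite /A' /p'; case: eqP => [->|_].
  have [_ _ _ /(_ F' GF')] := hind mA' pc'.
  have -> : \bigcap_(i in [set: 'I_N]) W i @^-1` A' i = D `&` W t @^-1` B.
    apply/seteqP; split => w /=.
      move=> h; split; last by have := h t I; rewrite /A' eqxx.
      move=> i _; have := h i I; rewrite /A'; case: eqP => [->|//].
      by rewrite At.
    by move=> [h1 h2] i _; rewrite /A'; case: eqP => [->//|_]; exact: h1.
  move=> h.
  have {}h : \int[Pr]_(w in F') (\prod_i p' i w) = \int[Pr]_(w in F') \1_(D `&` W t @^-1` B) w.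
    by rewrite /Rintegral h.
  transitivity (\int[Pr]_(w in F') \1_(D `&` W t @^-1` B) w).
    rewrite (Rintegral_indicM Pr F' \1_(D `&` W t @^-1` B)).
    by apply: eq_Rintegral => w _; rewrite indicI /= mulrA.
  rewrite -h (Rintegral_indicM Pr F' (fun w => \prod_i p' i w)).
  have [_ ipB mpB hpB] := pBc.
  transitivity (\int[Pr]_w (\1_F' w * q w * pB w)).
    apply: eq_Rintegral => w _; rewrite -mulrA; congr (_ * _).
    rewrite (bigD1 t)//= {1}/p' eqxx mulrC; congr (_ * _).
    by apply: eq_bigr => i /negbTE it; rewrite /p' it.
  apply: (integral_factor Gm') => //.
  - by apply: bm_integrable => //; exact/bm_indic/mWA.
  - by move=> B'; rewrite Gs => GB'; rewrite /Rintegral hpB.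
  - apply: bmM => //; apply: bm_indic; by rewrite /measurable/= Gs.
have GT : G setT by rewrite -Gs; exact: (@measurableT _ (g_sigma_algebraType G)).
have bD : @bounded_measurable R _ T \1_D by exact: bm_indic.
have bF : @bounded_measurable R _ T \1_F by exact: bm_indic.
have bFG : @bounded_measurable R _ (g_sigma_algebraType G) \1_F.
  by apply: bm_indic; rewrite /measurable/= Gs.
pose GW := [set B' | exists2 B, measurable B & B' = W t @^-1` B].
have GWs : <<s GW >> = GW.
  apply: sigma_algebra_id; split.
  - by exists set0 => //; rewrite preimage_set0.
  - move=> _ [B mB ->]; exists (~` B); first exact: measurableC.
    by rewrite setTD preimage_setC.
  - move=> Fs hF.
    have /choice[Bs BsP] n : exists B : set R, measurable B /\ Fs n = W t @^-1` B.
      by have [B mB ->] := hF n; exists B.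
    exists (\bigcup_n Bs n); first by apply: bigcup_measurable => n _; have [] := BsP n.
    by rewrite preimage_bigcup; apply: eq_bigcup => // n _; have [] := BsP n.
have GWm : <<s GW >> `<=` measurable by rewrite GWs => _ [B mB ->]; exact: mWA.
have step1 : \int[Pr]_w (g w * (\1_F w * \1_D w)) = \int[Pr]_w (g w * (\1_F w * q w)).
  apply: (integral_factor_integrable GWm) => //; try exact: bmM.
  - rewrite GWs => _ [B mB ->].
    rewrite (Rintegral_indicM Pr _ (fun w => \1_F w * \1_D w)).
    rewrite (Rintegral_indicM Pr _ (fun w => \1_F w * q w)).
    have := key F B GF mB.
    by under eq_Rintegral do rewrite mulrC; under [X in _ = X -> _]eq_Rintegral do rewrite mulrC.
  - move=> _ B mB; rewrite setTI /measurable/= GWs.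
    exists (f @^-1` B); first by rewrite -[X in measurable X]setTI; exact: mf.
    by apply/seteqP; split => w /=; rewrite gE.
have step2 : \int[Pr]_w (g w * (\1_F w * q w)) = \int[Pr]_w (V w * (\1_F w * q w)).
  under eq_Rintegral do rewrite mulrC; under [RHS]eq_Rintegral do rewrite mulrC.
  apply: (integral_factor Gm') => //; last exact: bmM.
  by move=> B; rewrite Gs => GB; rewrite /Rintegral hV.
have step3 : \int[Pr]_w (V w * (\1_F w * \1_D w)) = \int[Pr]_w (V w * (\1_F w * q w)).
  under eq_Rintegral do rewrite mulrA; under [RHS]eq_Rintegral do rewrite mulrA.
  apply: (integral_factor_integrable Gm') => //.
  - move=> B; rewrite Gs => GB; rewrite (Rintegral_indicM Pr B \1_D) (Rintegral_indicM Pr B q).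
    have := key B setT GB measurableT; rewrite preimage_setT.
    by under eq_Rintegral do rewrite indicT mulr1; under [X in _ = X -> _]eq_Rintegral do rewrite indicT mulr1.
  - by apply: measurable_funM; [exact: mG|have [] := bFG].
  - by have := integrable_bmM bF iV; under eq_fun do rewrite mulrC.
rewrite (Rintegral_indicM Pr _ g) (Rintegral_indicM Pr _ V).
transitivity (\int[Pr]_w (g w * (\1_F w * \1_D w))).
  by apply: eq_Rintegral => w _; rewrite indicI mulrC.
rewrite step1 step2 -step3.
by apply: eq_Rintegral => w _; rewrite indicI mulrC.
Qed.

End cond_independence.
(** * A maximal inequality for the averages of the noise *)

Section cond_variance.
Context {R : realType} {d : measure_display} {T : measurableType d}.
Variables (Pr : probability T R) (G : set (set T)) (Gm : G `<=` measurable)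
  (Gs : <<s G >> = G).

Lemma zero_integrals_ae0 (m : T -> R) : (forall A, measurable A -> G (m @^-1` A)) ->
  Pr.-integrable setT (EFin \o m) ->
  (forall B, G B -> \int[Pr]_(w in B) m w = 0) -> {ae Pr, forall w, m w = 0}.
Proof.
move=> mG im m0; have mm : measurable_fun setT m by apply/measurable_EFinP; case/integrableP: im.
have Gp : G [set w | 0 < m w].
  rewrite (_ : [set w | 0 < m w] = m @^-1` `]0, +oo[%classic); first exact: mG.
  by apply/seteqP; split => w /=; rewrite in_itv/= andbT.
have Gn : G [set w | m w < 0].
  rewrite (_ : [set w | m w < 0] = m @^-1` `]-oo, 0[%classic); first exact: mG.
  by apply/seteqP; split => w /=; rewrite in_itv/=.
have h : (\int[Pr]_w `|(EFin \o m) w| = 0)%E.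
  have iam := integrable_abse im.
  have -> : (\int[Pr]_w `|(EFin \o m) w| = (\int[Pr]_w `|m w|)%:E)%E.
    by rewrite fineK//; exact: (integrable_fin_num measurableT iam).
  congr EFin.
  transitivity (\int[Pr]_w (\1_[set w | 0 < m w] w * m w - \1_[set w | m w < 0] w * m w)).
    apply: eq_Rintegral => w _; rewrite !indicE.
    case: (ltrgtP (m w) 0) => m1.
    - rewrite memNset/= ?mem_set ?mul0r ?mul1r ?sub0r ?ltr0_norm//=.
      by apply/negP; rewrite -leNgt ltW.
    - rewrite mem_set//= memNset/= ?mul0r ?mul1r ?subr0 ?gtr0_norm//.
      by apply/negP; rewrite -leNgt ltW.
    - by rewrite m1 normr0 !mulr0 subr0.
  rewrite RintegralB//; last 2 first.
  - exact: (integrable_bmM (bm_indic (Gm Gp)) im).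
  - exact: (integrable_bmM (bm_indic (Gm Gn)) im).
  by rewrite -!Rintegral_indicM !m0// subrr.
have /ae_eq_integral_abs : measurable_fun setT (EFin \o m) by exact/measurable_EFinP.
move=> /(_ Pr measurableT)[/(_ h) + _]; apply: filterS => w /(_ I) [].
by [].
Qed.

(** The conditional mean in the definition of the conditional variance is an
    arbitrary version of it, hence zero almost everywhere. *)
Lemma cond_var_centered (U V : T -> R) : measurable_fun setT U ->
  is_cond_exp Pr G U (cst 0) -> is_cond_var Pr G U V ->
  is_cond_exp Pr G (fun w => U w ^+ 2) V.
Proof.
move=> mU [iU _ _ U0] [m [_ im mG mE] [iV2 iV VG VE]].
have m0 : {ae Pr, forall w, m w = 0}.
  apply: zero_integrals_ae0 => // B GB; rewrite /Rintegral mE// -U0//.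
  by under eq_integral do rewrite /=; rewrite integral0.
have mm : measurable_fun setT m by apply/measurable_EFinP; case/integrableP: im.
have mU2 : measurable_fun setT (fun w => U w ^+ 2) by exact: measurable_funX.
have mUm2 : measurable_fun setT (fun w => (U w - m w) ^+ 2).
  by apply: measurable_funX; exact: measurable_funB.
have ae D : ae_eq Pr D (EFin \o (fun w => (U w - m w) ^+ 2)) (EFin \o (fun w => U w ^+ 2)).
  by apply: filterS m0 => w h _ /=; rewrite h subr0.
split => //.
  apply/integrableP; split; first exact/measurable_EFinP.
  have /integrableP[_] := iV2; apply: le_lt_trans; rewrite le_eqVlt; apply/orP; left; apply/eqP.
  apply: ae_eq_integral => //.
  - by apply: measurableT_comp => //; exact/measurable_EFinP.
  - by apply: measurableT_comp => //; exact/measurable_EFinP.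
  by apply: filterS (ae setT) => w h wT /=; have /= [->] := h wT.
move=> B GB; rewrite VE//; apply: ae_eq_integral => //; first exact: Gm.
- exact/measurable_funTS/measurable_EFinP.
- exact/measurable_funTS/measurable_EFinP.
Qed.

End cond_variance.

Section maximal_inequality.
Context {R : realType} {d : measure_display} {T : measurableType d}.
Variables (Pr : probability T R) (G : set (set T)) (Gm : G `<=` measurable)
  (Gs : <<s G >> = G) (N : nat) (W : 'I_N -> T -> R) (sigma : R).
Hypotheses (mW : forall i, measurable_fun setT (W i))
  (hind : cond_independent Pr G W)
  (hmean : forall i, is_cond_exp Pr G (W i) (cst 0))
  (hvar : forall i, exists2 v : T -> R, is_cond_exp Pr G (fun w => W i w ^+ 2) v
     & {ae Pr, forall w, v w <= sigma ^+ 2}).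
Let Pr1 : Pr setT = 1%E. Proof. exact: probability_setT. Qed.
Local Notation OT t := (g_sigma_algebraType (other_events G W t)).

Let Om t : <<s other_events G W t >> `<=` measurable.
Proof.
apply: smallest_sub; first exact: sigma_algebra_measurable.
exact: other_events_measurable.
Qed.

Lemma measurable_other_sum t (r : seq 'I_N) : t \notin r ->
  @measurable_fun _ _ (OT t) R setT (fun w => \sum_(i <- r) W i w).
Proof.
elim: r => [_|i r IH]; first by under eq_fun do rewrite big_nil; exact: measurable_cst.
rewrite inE negb_or eq_sym => /andP[it /IH mr].
under eq_fun do rewrite big_cons.
apply: measurable_funD => // _ A mA; rewrite setTI; apply: sub_sigma_algebra.
exact: other_events_W.
Qed.

Variables (O : set T) (GO : G O) (l : seq 'I_N) (ul : uniq l) (eta : R)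
  (eta0 : 0 < eta) (m : nat) (m0 : (0 < m)%N).

Definition partial_noise k w := \sum_(i <- take k l) W i w.
Local Notation S := partial_noise.
Let thr k : R := (maxn k m)%:R.
Let thr_gt0 k : 0 < thr k. Proof. by rewrite ltr0n leq_max m0 orbT. Qed.

(** Counting fewer than [m] summands for [m] leaves the averages of interest
    unchanged and makes the sum of the weights [(maxn k m)^-2] at most [2 / m],
    however long the list is. *)
Fixpoint moderate j : set T :=
  if j is i.+1 then moderate i `&` [set w | `|S i.+1 w| < eta * (maxn i.+1 m)%:R]
  else setT.

Let mod_other t j : t \notin take j l -> <<s other_events G W t >> (moderate j).
Proof.
elim: j => [_|j IH] tj /=; first exact: (@measurableT _ (OT t)).
apply: (@measurableI _ (OT t)).
  apply: IH; apply: contra tj; rewrite -(@take_takel _ j j.+1)//.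
  exact: mem_take.
have mS := measurable_other_sum tj.
have := mS measurableT `]- (eta * thr j.+1), eta * thr j.+1[%classic (measurable_itv _).
rewrite setTI; congr (measurable _).
by apply/seteqP; split => w /=; rewrite in_itv/= ltr_norml.
Qed.

Lemma measurable_partial_noise k : measurable_fun setT (S k).
Proof. exact: measurable_sum. Qed.

Lemma measurable_moderate j : measurable (moderate j).
Proof.
elim: j => [|j IH] /=; first exact: measurableT.
apply: measurableI => //.
have := @measurable_partial_noise j.+1 measurableT
  `]- (eta * thr j.+1), eta * thr j.+1[%classic (measurable_itv _).
rewrite setTI; congr (measurable _).
by apply/seteqP; split => w /=; rewrite in_itv/= ltr_norml.
Qed.

Let moderateP j w : moderate j w -> `|S j w| <= eta * thr j.
Proof.
case: j => [|j] /=; last by move=> [_ /ltW].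
by rewrite /S take0 big_nil normr0 mulr_ge0// ltW.
Qed.

Let sum_weights n : \sum_(k < n) (thr k.+1) ^- 2 <=
  if (n <= m)%N then n%:R / m%:R ^+ 2 else 2 / m%:R - n%:R^-1.
Proof.
have mR : 0 < m%:R :> R by rewrite ltr0n.
elim: n => [|n IH]; first by rewrite big_ord0 mul0r.
rewrite big_ord_recr/=; have [nm|mn] := leqP n.+1 m.
  move: IH; rewrite (ltnW nm) /thr => IH.
  rewrite (maxn_idPr nm) -[n.+1%:R]natr1 mulrDl mul1r lerD2r//.
have n0 : 0 < n%:R :> R by rewrite ltr0n; lia.
have nR : 0 < n.+1%:R :> R by rewrite ltr0n.
have tn : thr n.+1 = n.+1%:R by rewrite /thr (maxn_idPl _)//; lia.
have step : (n.+1%:R ^+ 2)^-1 <= n%:R^-1 - n.+1%:R^-1 :> R.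
  have -> : n%:R^-1 - n.+1%:R^-1 = (n%:R * n.+1%:R)^-1 :> R.
    rewrite -[n.+1%:R]natr1; field.
    by rewrite natr1 !gt_eqF.
  by rewrite lef_pV2 ?posrE ?mulr_gt0// ?exprn_gt0// expr2 ler_pM2r// ler_nat.
case: (leqP n m) IH => [nm|mn'] IH; last first.
  by rewrite tn (le_trans (lerD IH step))// addrA subrK.
have nE : n = m by lia.
have {}IH : \sum_(i < n) thr i.+1 ^- 2 <= n%:R^-1.
  rewrite (le_trans IH)// nE expr2 invfM mulrA divff ?mul1r// gt_eqF//.
by rewrite tn -nE (le_trans (lerD IH step))// addrA -mulr2n mulr_natl.
Qed.

(** By induction on [j], the weighted second moment of the [j]-th sum on the event
    where the previous averages are moderate, plus [eta ^+ 2] times the probability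
    that some average was not, grows at each step by at most [sigma ^+ 2] times a
    weight. The new variable is orthogonal to the past of the summation; and where the
    [j]-th average is the first to be large, the square lost is at least the
    probability gained. Restricted to moderate events, the sums are bounded. *)
Lemma hajek_renyi :
  (Pr (O `\` moderate (size l)) <= (2 * sigma ^+ 2 / (eta ^+ 2 * m%:R))%:E * Pr O)%E.
Proof.
have mO : measurable O by exact: Gm.
have bO : @bounded_measurable R _ T \1_O by exact: bm_indic.
have bmod j : @bounded_measurable R _ T \1_(moderate j).
  exact/bm_indic/measurable_moderate.
pose I j w : R := \1_O w * \1_(moderate j) w.
have bI j : bounded_measurable (I j) by exact: bmM.
have I01 j w : I j w = 0 \/ I j w = 1.
  rewrite /I !indicE; case: (w \in O); case: (w \in _); rewrite ?mulr1 ?mulr0 ?mul0r; by [left|right].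
pose Y j w := I j w * S j w.
have bY j : bounded_measurable (Y j).
  split; first by apply: measurable_funM; [have [] := bI j|exact: measurable_partial_noise].
  exists (eta * thr j) => w; rewrite /Y /I indicE [\1__ w]indicE.
  case: (boolP (w \in moderate j)) => [/set_mem/moderateP h|_]; last first.
    by rewrite mulr0 mul0r normr0 mulr_ge0// ltW.
  case: (w \in O); first by rewrite !mul1r.
  by rewrite !mul0r normr0 mulr_ge0// ltW.
pose p := \int[Pr]_w \1_O w.
have p0 : 0 <= p by apply: Rintegral_ge0 => w _; rewrite indicE ler0n.
suff main j : (j <= size l)%N ->
    (thr j) ^- 2 * (\int[Pr]_w Y j w ^+ 2) + eta ^+ 2 * (p - \int[Pr]_w I j w) <=
    sigma ^+ 2 * p * \sum_(k < j) (thr k.+1) ^- 2.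
  have := main (size l) (leqnn _).
  have a0 : 0 <= thr (size l) ^- 2 * \int[Pr]_w Y (size l) w ^+ 2.
    apply: mulr_ge0; first by rewrite invr_ge0 exprn_ge0// ltW.
    by apply: Rintegral_ge0 => w _; exact: sqr_ge0.
  have sw : \sum_(k < size l) (thr k.+1) ^- 2 <= 2 / m%:R.
    apply: (le_trans (sum_weights (size l))); have mR : 0 < m%:R :> R by rewrite ltr0n.
    case: leqP => [h|_]; last by rewrite gerBl invr_ge0.
    rewrite expr2 invfM mulrA ler_pM2r ?invr_gt0// ler_pdivrMr//.
    by rewrite (@le_trans _ _ m%:R) ?ler_nat// ler_peMl// ler1n.
  move=> h; have {}h : eta ^+ 2 * (p - \int[Pr]_w I (size l) w) <= sigma ^+ 2 * p * (2 / m%:R).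
    have : sigma ^+ 2 * p * \sum_(k < size l) (thr k.+1) ^- 2 <= sigma ^+ 2 * p * (2 / m%:R).
      by rewrite ler_wpM2l// mulr_ge0// sqr_ge0.
    lra.
  have mD : measurable (O `\` moderate (size l)).
    by apply: measurableD => //; exact: measurable_moderate.
  rewrite -(bm_integral_indic Pr1 mO) -(bm_integral_indic Pr1 mD) -/p -EFinM lee_fin.
  have -> : \int[Pr]_w \1_(O `\` moderate (size l)) w = p - \int[Pr]_w I (size l) w.
    rewrite -(bm_integralB Pr1)//; apply: eq_Rintegral => w _.
    rewrite /I !indicE in_setD; case: (w \in O); case: (w \in _) => /=; rewrite ?mulr1 ?mulr0 ?mul0r ?subrr ?subr0//.
  rewrite -(ler_pM2l (x := eta ^+ 2)) ?exprn_gt0//; apply: (le_trans h).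
  rewrite le_eqVlt; apply/orP; left; apply/eqP; field.
  by rewrite pnatr_eq0 -lt0n m0 gt_eqF.
elim: j => [_|j IH jl].
  rewrite big_ord0 mulr0; under eq_Rintegral do rewrite /Y /S take0 big_nil mulr0 expr0n/=.
  rewrite (bm_integral_cst Pr1) mulr0 add0r.
  under [X in p - X]eq_Rintegral do rewrite /I /= indicT mulr1.
  by rewrite subrr mulr0.
have {}IH := IH (ltnW jl).
pose t := tnth (in_tuple l) (Ordinal jl).
have tE : take j.+1 l = rcons (take j l) t.
  by rewrite (take_nth t)//; congr rcons; rewrite {2}/t (tnth_nth t).
have tj : t \notin take j l.
  by have := take_uniq j.+1 ul; rewrite tE rcons_uniq => /andP[].
have SE w : S j.+1 w = S j w + W t w.
  by rewrite /S tE -cats1 big_cat/= big_seq1.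
have [_ iW2 _ _] := hmean t.
have [v vc vs] := hvar t; have [iWW iv mv hv] := vc.
have [iW _ _ hW] := hmean t.
(* The past of the summation up to [t] does not involve the [t]-th variable. *)
have IO : <<s other_events G W t >> (O `&` moderate j).
  apply: (@measurableI _ (OT t)); last exact: mod_other.
  by apply: sub_sigma_algebra; exact: other_events_G.
have mIO : @measurable d T (O `&` moderate j) by exact: (Om IO).
have IE w : I j w = \1_(O `&` moderate j) w by rewrite /I indicI.
have bYO : @bounded_measurable R _ (OT t) (Y j).
  have [_ [M YM]] := bY j; split; last by exists M.
  rewrite (_ : Y j = (fun w => \1_(O `&` moderate j) w * S j w)).
    by apply: measurable_funM; [exact: measurable_indic|exact: measurable_other_sum].
  by apply/funext => w; rewrite /Y IE.
have cross : \int[Pr]_w (Y j w * W t w) = 0.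
  rewrite (integral_factor (Om (t := t)) iW iW2 _ bYO).
    under eq_Rintegral do rewrite /= mulr0.
    by rewrite (bm_integral_cst Pr1).
  apply: (other_events_integral Gm Gs mW hind (f := id)) => //.
have square : \int[Pr]_w (I j w * W t w ^+ 2) <= sigma ^+ 2 * p.
  have -> : \int[Pr]_w (I j w * W t w ^+ 2) = \int[Pr]_w (I j w * v w).
    under eq_Rintegral do rewrite IE; under [RHS]eq_Rintegral do rewrite IE.
    rewrite -(Rintegral_indicM Pr _ (fun w => W t w ^+ 2)) -(Rintegral_indicM Pr _ v).
    apply: (other_events_integral Gm Gs mW hind (f := fun x => x ^+ 2) (t := t)) => //.
  have mv' : measurable_fun setT v by apply/measurable_EFinP; case/integrableP: iv.
  have mle : measurable [set w | v w <= sigma ^+ 2].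
    have := mv' measurableT `]-oo, sigma ^+ 2]%classic (measurable_itv _).
    by rewrite setTI; congr (measurable _); apply/seteqP; split => w /=; rewrite in_itv.
  pose v1 w := \1_[set w | v w <= sigma ^+ 2] w * v w.
  have iv1 : Pr.-integrable setT (EFin \o v1) by exact: (integrable_bmM (bm_indic mle) iv).
  have iIv := integrable_bmM (bI j) iv.
  have iIv1 := integrable_bmM (bI j) iv1.
  have iO := bm_integrable Pr1 (bmZ (sigma ^+ 2) bO).
  have -> : \int[Pr]_w (I j w * v w) = \int[Pr]_w (I j w * v1 w).
    congr fine; apply: ae_eq_integral => //.
    - by case/integrableP: iIv.
    - by case/integrableP: iIv1.
    by apply: filterS vs => w vw _ /=; rewrite /v1 indicE mem_set// mul1r.
  rewrite /p -(bm_integralZ Pr1)//; apply: le_Rintegral => // w _.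
  rewrite /v1 IE !indicE in_setI; case: (w \in O); last by rewrite mul0r mulr0.
  rewrite mulr1; case: (w \in moderate j); last by rewrite mul0r sqr_ge0.
  rewrite mul1r; case: (boolP (w \in _)) => [/set_mem /= vw|_]; first by rewrite mul1r.
  by rewrite mul0r sqr_ge0.
pose Z w := I j w * S j.+1 w ^+ 2.
have iYW : Pr.-integrable setT (EFin \o (fun w => Y j w * W t w)) by exact: (integrable_bmM (bY j) iW).
have iIW : Pr.-integrable setT (EFin \o (fun w => I j w * W t w ^+ 2)) by exact: (integrable_bmM (bI j) iWW).
have bY2 k : bounded_measurable (fun w => Y k w ^+ 2) by under eq_fun do rewrite expr2; exact: bmM.
have iY2 := bm_integrable Pr1 (bY2 j).
have ZE : \int[Pr]_w Z w = \int[Pr]_w Y j w ^+ 2 + 2 * \int[Pr]_w (Y j w * W t w) +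
    \int[Pr]_w (I j w * W t w ^+ 2).
  rewrite -RintegralZl// -!RintegralD//; last 2 first.
  - exact: (integrableD measurableT iY2 (integrableZl measurableT 2 iYW)).
  - exact: (integrableZl measurableT 2 iYW).
  apply: eq_Rintegral => w _; rewrite /Z /Y SE.
  by case: (I01 j w) => ->; ring.
have iZ : Pr.-integrable setT (EFin \o Z).
  have -> : Z = (fun w => Y j w ^+ 2 + 2 * (Y j w * W t w) + I j w * W t w ^+ 2).
    by apply/funext => w; rewrite /Z /Y SE; case: (I01 j w) => ->; ring.
  exact: (integrableD measurableT
    (integrableD measurableT iY2 (integrableZl measurableT 2 iYW)) iIW).
set c := thr j.+1 ^- 2.
have c0 : 0 <= c by rewrite invr_ge0 exprn_ge0// ltW.
have cc : c <= thr j ^- 2.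
  have le_thr : thr j <= thr j.+1.
    by rewrite ler_nat geq_max !leq_max leqnn !orbT leqnSn.
  by rewrite /c lef_pV2 ?posrE ?exprn_gt0// lerXn2r// nnegrE ltW.
have lower : c * (\int[Pr]_w Y j.+1 w ^+ 2) +
    eta ^+ 2 * (\int[Pr]_w I j w - \int[Pr]_w I j.+1 w) <= c * \int[Pr]_w Z w.
  have iYj := bm_integrable Pr1 (bmZ c (bY2 j.+1)).
  have bd : bounded_measurable (fun w => eta ^+ 2 * (I j w - I j.+1 w)).
    by apply/bmZ/bmB.
  have iId := bm_integrable Pr1 bd.
  have e1 : c * (\int[Pr]_w Y j.+1 w ^+ 2) = \int[Pr]_w (c * Y j.+1 w ^+ 2).
    by rewrite (bm_integralZ Pr1 c (bY2 j.+1)).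
  have e2 : eta ^+ 2 * (\int[Pr]_w I j w - \int[Pr]_w I j.+1 w) =
      \int[Pr]_w (eta ^+ 2 * (I j w - I j.+1 w)).
    by rewrite (bm_integralZ Pr1) ?(bm_integralB Pr1)//; exact: bmB.
  rewrite e1 e2 -RintegralZl// -RintegralD//; apply: le_Rintegral => //.
  - exact: (integrableD measurableT iYj iId).
  - exact: (integrableZl measurableT c iZ).
  move=> w _ /=; rewrite /Z /Y /I /= indicI /=.
  rewrite !indicE; case: (w \in O); last first.
    by rewrite !mul0r subrr !mulr0 expr0n/= mulr0 addr0.
  case: (w \in moderate j); last first.
    by rewrite !(mul0r, mulr0) subrr mulr0 expr0n/= mulr0 addr0.
  rewrite !mul1r; case: (boolP (w \in _)) => [_|].
    by rewrite mul1r subrr mulr0 addr0.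
  rewrite notin_setE/= => /negP; rewrite -leNgt => h.
  rewrite mul0r expr0n/= mulr0 add0r subr0 mulr1 mulrC /c ler_pdivlMr ?exprn_gt0//.
  by rewrite -exprMn -[leRHS]real_normK ?num_real// lerXn2r ?nnegrE ?normr_ge0// mulr_ge0// ltW.
have Y0 : 0 <= \int[Pr]_w Y j w ^+ 2 by apply: Rintegral_ge0 => w _; exact: sqr_ge0.
rewrite big_ord_recr/= mulrDr -/c.
rewrite cross mulr0 addr0 in ZE.
have h1 : c * \int[Pr]_w Y j w ^+ 2 <= thr j ^- 2 * \int[Pr]_w Y j w ^+ 2 by rewrite ler_wpM2r.
have h2 : c * \int[Pr]_w (I j w * W t w ^+ 2) <= sigma ^+ 2 * p * c.
  by rewrite mulrC ler_wpM2r.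
rewrite ZE mulrDr in lower.
lra.
Qed.

End maximal_inequality.
(** * Averages of the noise over initial segments of a random order *)

Lemma filter_prefix (I : Type) (J : pred I) (l : seq I) :
  pairwise (fun i j => J j ==> J i) l -> [seq i <- l | J i] = take (count J l) l.
Proof.
elim: l => [//|i l IH] /= /andP[il /IH {}IH].
case: (boolP (J i)) => [Ji|nJ]; first by rewrite /= IH.
have nl : ~~ has J l.
  by elim: l il {IH} => [//|j l IH] /= /andP[ji /IH]; rewrite negb_or (contra (implyP ji)).
have c0 : count J l = 0%N by apply/eqP; rewrite -leqn0 leqNgt -has_count.
by rewrite IH c0 add0n !take0.
Qed.

Section random_order.
Context {R : realType} {d : measure_display} {T : measurableType d}.
Variables (Pr : probability T R) (G : set (set T)) (Gm : G `<=` measurable)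
  (Gs : <<s G >> = G) (N : nat) (W : 'I_N -> T -> R) (sigma : R).
Hypotheses (mW : forall i, measurable_fun setT (W i))
  (hind : cond_independent Pr G W)
  (hmean : forall i, is_cond_exp Pr G (W i) (cst 0))
  (hvar : forall i, exists2 v : T -> R, is_cond_exp Pr G (fun w => W i w ^+ 2) v
     & {ae Pr, forall w, v w <= sigma ^+ 2}).
Variables (Y : 'I_N -> T -> R) (D : 'I_N -> set T).
Hypotheses (mY : forall i A, measurable A -> G (Y i @^-1` A)) (mD : forall i, G (D i)).
Let Pr1 : Pr setT = 1%E. Proof. exact: probability_setT. Qed.
Local Notation GT := (g_sigma_algebraType G).
Local Notation key := ({ffun 'I_N -> bool} * {ffun 'I_N * 'I_N -> bool})%type.

(** The selected indices and their order take finitely many values; on each of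
    the corresponding events, which belong to [G], the order is fixed. *)
Definition order_key (w : T) : key :=
  ([ffun i => w \in D i], [ffun ij => Y ij.1 w <= Y ij.2 w]).

Definition ordered_indices (k : key) : seq 'I_N :=
  sort (fun i j => k.2 (i, j)) [seq i <- enum 'I_N | k.1 i].

Lemma order_key_event k : G [set w | order_key w = k].
Proof.
have mYG i : @measurable_fun _ _ GT R setT (Y i).
  by move=> _ A mA; rewrite setTI /measurable/= Gs; exact: mY.
rewrite -Gs.
have -> : [set w | order_key w = k] =
    (\bigcap_(i in [set: 'I_N]) [set w | (w \in D i) = k.1 i]) `&`
    (\bigcap_(ij in [set: 'I_N * 'I_N]) [set w | (Y ij.1 w <= Y ij.2 w) = k.2 ij]).
  apply/seteqP; split => w /=; first by move=> <-; split => i _ /=; rewrite ffunE.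
  move=> [h1 h2]; rewrite [k]surjective_pairing /order_key; congr pair.
    by apply/ffunP => i; rewrite ffunE; exact: h1.
  by apply/ffunP => i; rewrite ffunE; exact: h2.
apply: (@measurableI _ GT).
- apply: (@fin_bigcap_measurable _ GT) => // i _.
  have mDi : @measurable _ GT (D i) by rewrite /measurable/= Gs.
  case: (k.1 i).
    rewrite (_ : [set w | _] = D i)//.
    by apply/seteqP; split => w /=; [move/set_mem|move=> ?; rewrite mem_set].
  rewrite (_ : [set w | _] = ~` D i); first exact: measurableC.
  apply/seteqP; split => w /=; first by move=> h /mem_set; rewrite h.
  by move=> h; rewrite memNset.
- apply: (@fin_bigcap_measurable _ GT) => // -[i j] _ /=.
  have := measurable_fun_ler (mYG i) (mYG j) measurableT (Y := [set k.2 (i, j)]).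
  by rewrite setTI; apply.
Qed.

Lemma uniq_ordered_indices k : uniq (ordered_indices k).
Proof. by rewrite sort_uniq filter_uniq// enum_uniq. Qed.

(** Filtering a sorted list by a downward closed condition keeps a prefix of it: the
    noise over such a random set is one of the partial sums of a list that depends on
    [G] only. *)
Lemma initial_segment w (J : {set 'I_N}) :
  (forall i, i \in J -> D i w) ->
  (forall i j, i \in J -> D j w -> Y j w <= Y i w -> j \in J) ->
  let l := ordered_indices (order_key w) in
  (#|J| <= size l)%N /\
  \sum_(i in J) W i w = \sum_(i <- take #|J| l) W i w.
Proof.
move=> JD Jc l.
have memD i : (i \in [seq i <- enum 'I_N | (order_key w).1 i]) = (w \in D i).
  by rewrite mem_filter mem_enum andbT ffunE.
have memJ i : (i \in l) = (w \in D i) by rewrite mem_sort memD.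
have pJ : perm_eq [seq i <- l | i \in J] (enum J).
  apply: uniq_perm; rewrite ?enum_uniq// ?filter_uniq ?uniq_ordered_indices// => i.
  rewrite mem_filter mem_enum memJ; case: (boolP (i \in J)) => //= /JD h.
  by rewrite mem_set.
have cJ : count (mem J) l = #|J|.
  by rewrite -size_filter (perm_size pJ) -cardE.
have fJ : [seq i <- l | i \in J] = take #|J| l.
  rewrite -cJ; apply: filter_prefix.
  have tr : transitive (fun i j : 'I_N => Y i w <= Y j w) by move=> i j k; exact: le_trans.
  have tot : total (fun i j : 'I_N => Y i w <= Y j w) by move=> i j; exact: le_total.
  have lE : l = sort (fun i j : 'I_N => Y i w <= Y j w) [seq i <- enum 'I_N | (order_key w).1 i].
    rewrite /l /ordered_indices; congr (sort _ _).
    by apply/funext => i; apply/funext => j; rewrite ffunE.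
  have : pairwise (fun i j : 'I_N => Y i w <= Y j w) l.
    by rewrite -(sorted_pairwise tr) lE; apply: sort_sorted.
  move=> /(sub_in_pairwise (P := fun i => i \in l)); apply.
    move=> i j il _ Yij; apply/implyP => jJ; apply: (Jc j i) => //.
    by apply/set_mem; rewrite -memJ.
  exact/allP.
split; first by rewrite -cJ count_size.
by rewrite -fJ (perm_big _ pJ)/= big_enum.
Qed.

(** The set [J] may depend on the noise; its order does not. So [hajek_renyi] applies
    on each event on which the order is fixed, and its bounds add up to that of the
    whole space. *)
Lemma block_noise (eta : R) (m : nat) : 0 < eta -> (0 < m)%N ->
  exists B : set T, [/\ measurable B,
    (Pr B <= (2 * sigma ^+ 2 / (eta ^+ 2 * m%:R))%:E)%E &
    forall w, ~ B w -> forall J : {set 'I_N},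
      (forall i, i \in J -> D i w) ->
      (forall i j, i \in J -> D j w -> Y j w <= Y i w -> j \in J) ->
      (m <= #|J|)%N -> `|\sum_(i in J) W i w| < eta * #|J|%:R].
Proof.
move=> eta0 m0; pose c := 2 * sigma ^+ 2 / (eta ^+ 2 * m%:R).
pose Mk (k : key) := moderate W (ordered_indices k) eta m (size (ordered_indices k)).
pose cell (k : key) := [set w | order_key w = k].
have mM k : measurable (Mk k) by exact: measurable_moderate.
have mcell k : measurable (cell k) by apply: Gm; exact: order_key_event.
pose B := [set w | ~ Mk (order_key w) w].
have BE : B = \bigcup_(k in [set: key]) (cell k `\` Mk k).
  apply/seteqP; split => w /=; first by exists (order_key w).
  by move=> [k _ [<-]].
have mB : measurable B.
  by rewrite BE; apply: fin_bigcup_measurable => // k _; exact: measurableD.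
exists B; split=> //.
  rewrite -(bm_integral_indic Pr1 mB) lee_fin -/c.
  have bc (k : key) : @bounded_measurable R _ T \1_(cell k `\` Mk k).
    by apply: bm_indic; exact: measurableD.
  have bcell (k : key) : @bounded_measurable R _ T \1_(cell k) by exact: bm_indic.
  have sumE (A : key -> set T) w : (forall k, A k `<=` cell k) ->
      \sum_(k : key) \1_(A k) w = \1_(A (order_key w)) w :> R.
    move=> Ac; rewrite (bigD1 (order_key w))//= big1 ?addr0// => k kw.
    rewrite indicE memNset// => /Ac /=; move: kw; rewrite eq_sym => /eqP; exact.
  have -> : \int[Pr]_w \1_B w = \sum_(k : key) \int[Pr]_w \1_(cell k `\` Mk k) w.
    rewrite -(bm_integral_sum Pr1)//; apply: eq_Rintegral => w _.
    rewrite (sumE (fun k => cell k `\` Mk k)); last by move=> k w' [].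
    rewrite !indicE; congr ((_ : bool)%:R); apply/idP/idP => /set_mem h; apply: mem_set => //.
    by case: h.
  have -> : c = \sum_(k : key) c * \int[Pr]_w \1_(cell k) w.
    rewrite -mulr_sumr -(bm_integral_sum Pr1)//.
    transitivity (c * \int[Pr]_w 1); first by rewrite (bm_integral_cst Pr1) mulr1.
    congr (_ * _); apply: eq_Rintegral => w _.
    rewrite (sumE cell); last by move=> k.
    by rewrite indicE mem_set.
  apply: ler_sum => k _.
  have := hajek_renyi Gm Gs mW hind hmean hvar (order_key_event k)
    (uniq_ordered_indices k) eta0 m0.
  rewrite -(bm_integral_indic Pr1 (mcell k)).
  have mck : measurable (cell k `\` Mk k) by exact: measurableD.
  by rewrite -(bm_integral_indic Pr1 mck) -EFinM lee_fin.
move=> w /contrapT Mw J JD Jc mJ.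
have [Jl ->] := initial_segment JD Jc.
set l := ordered_indices _ in Jl *.
have : moderate W l eta m #|J| w.
  have : moderate W l eta m (size l) w by exact: Mw.
  move: Jl => /subnKC <-; elim: (size l - #|J|)%N => [|k IH]; first by rewrite addn0.
  by rewrite addnS /= => -[/IH].
have J0 : (0 < #|J|)%N by exact: leq_trans mJ.
by move: (#|J|) J0 mJ => [//|j] _ mj /= [_]; rewrite (maxn_idPl mj).
Qed.

End random_order.
(** * Local behaviour at the point of interest *)

Section local.
Context {R : realType}.

Lemma derive_on_near (C : set R) (f : R -> R) (x l e : R) :
  is_derive_on C f x l -> 0 < e ->
  exists2 r : R, 0 < r & forall y, C y -> y != x -> `|y - x| < r ->
    `|(f y - f x) / (y - x) - l| < e.
Proof.
move=> /cvgrPdist_lt/(_ e) h e0; have {}h := h e0.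
have : nbhs x (fun y => C y -> y != x -> `|l - (f y - f x) / (y - x)| < e).
  move: h; rewrite near_withinE; apply: filterS => y h Cy yx; apply: h; split => //.
  by apply/eqP.
move=> /nbhs_ballP[r /= r0 rP]; exists r => // y Cy yx yr.
by rewrite distrC; apply: rP => //; rewrite /ball/= distrC.
Qed.

Lemma derive_on_Lipschitz (x0 delta : R) (f : R -> R) : 0 < delta ->
  bounded_derive_on `[x0 - delta, x0 + delta] f ->
  exists c r : R, [/\ 0 < c, 0 < r & forall y, `|y - x0| <= r ->
    `|f y - f x0| <= c * `|y - x0|].
Proof.
move=> d0 [f' [df _]].
have Cx0 : `[x0 - delta, x0 + delta]%classic x0 by rewrite /= in_itv/= gerBl lerDl ltW.
have [r r0 rP] := derive_on_near (df _ Cx0) ltr01.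
exists (`|f' x0| + 1), (Num.min (r / 2) delta); split.
- by rewrite ltr_wpDl.
- by rewrite lt_min d0 divr_gt0.
move=> y; rewrite le_min => /andP[yr yd].
have [->|yx] := eqVneq y x0; first by rewrite !subrr normr0 mulr0.
have Cy : `[x0 - delta, x0 + delta]%classic y.
  by rewrite /= in_itv/= -ler_distl.
have := rP y Cy yx; rewrite (le_lt_trans yr); last lra.
move=> /(_ isT) h; have y0 : 0 < `|y - x0| by rewrite normr_gt0 subr_eq0.
rewrite -ler_pdivrMr// -normf_div.
have := ler_normD ((f y - f x0) / (y - x0) - f' x0) (f' x0); rewrite subrK.
lra.
Qed.

Variables (pi : {measure set R -> \bar R}) (x0 delta : R) (d0 : 0 < delta).
Local Notation C := `[x0 - delta, x0 + delta]%classic.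
Hypothesis hF : bounded_derive_on C (localized_cdf pi C).

(** The distribution function has a nonzero slope, so that small one-sided
    neighbourhoods of [x0] carry at least a proportion of their length. *)
Lemma localized_mass : exists b r : R, [/\ 0 < b, 0 < r, fine (pi C) != 0 &
  forall t, 0 < t -> t <= r ->
    b * t <= fine (pi (C `&` `]x0 - t, x0])) /\
    b * t <= fine (pi (C `&` `]x0, x0 + t]))].
Proof.
have [F' [dF [a [b [a0 ab]]]]] := hF.
have Cx0 : C x0 by rewrite /= in_itv/= gerBl lerDl ltW.
have /andP[aF _] := ab _ Cx0.
have a2 : 0 < a / 2 by rewrite divr_gt0.
have [r r0 rP] := derive_on_near (dF _ Cx0) a2.
set F := localized_cdf pi C in rP.
have slope y : `|y - x0| <= Num.min (r / 2) delta -> a / 2 * `|y - x0| <= `|F y - F x0|.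
  rewrite le_min => /andP[yr yd].
  have [->|yx] := eqVneq y x0; first by rewrite !subrr normr0 mulr0.
  have Cy : C y by rewrite /= in_itv/= -ler_distl.
  have := rP y Cy yx; rewrite (le_lt_trans yr); last lra.
  move=> /(_ isT) h; have y0 : 0 < `|y - x0| by rewrite normr_gt0 subr_eq0.
  rewrite -ler_pdivlMr// -normf_div.
  have := lerB_dist (F' x0) ((F y - F x0) / (y - x0)); rewrite distrC.
  lra.
pose r1 := Num.min (r / 2) delta.
have r10 : 0 < r1 by rewrite lt_min d0 divr_gt0.
have piC0 : fine (pi C) != 0.
  apply/eqP => C0; have := slope (x0 + r1).
  rewrite addrAC subrr add0r gtr0_norm// lexx => /(_ isT).
  rewrite /F /localized_cdf C0 invr0 !mulr0 subrr normr0 leNgt.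
  by rewrite mulr_gt0.
have piCy : (pi C < +oo)%E by rewrite ltey; apply: contra_neq piC0 => ->.
have piC_gt0 : 0 < fine (pi C) by rewrite lt_neqAle eq_sym piC0 fine_ge0.
have mC : measurable C by exact: measurable_itv.
have fin (A : set R) : measurable A -> pi (C `&` A) \is a fin_num.
  move=> mA; rewrite ge0_fin_numE// (le_lt_trans _ piCy)//.
  by apply: measureIl.
have cdfB y z : y <= z -> fine (pi (C `&` `]y, z])) = fine (pi C) * (F z - F y).
  move=> yz; rewrite /F /localized_cdf -mulrBl mulrC divfK//.
  have -> : C `&` `]-oo, z]%classic = (C `&` `]-oo, y]) `|` (C `&` `]y, z]).
    rewrite -setIUr; congr (_ `&` _); apply/seteqP; split => w /=; rewrite !in_itv/=.
      by move=> wz; case: (leP w y) => wy; [left|right].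
    by move=> [wy|/andP[]//]; exact: le_trans yz.
  rewrite measureU; [|exact: measurableI|exact: measurableI|].
    by rewrite fineD ?fin// addrAC subrr add0r.
  rewrite setIACA setIid (_ : `]-oo, y] `&` `]y, z] = set0) ?setI0//.
  apply/seteqP; split => w //=; rewrite !in_itv/= => -[wy /andP[yw _]].
  by have := lt_le_trans yw wy; rewrite ltxx.
have Fmono y z : y <= z -> F y <= F z.
  by move=> yz; rewrite -subr_ge0 -(pmulr_rge0 _ piC_gt0) -cdfB.
exists (fine (pi C) * (a / 2)), r1; split=> //; first exact: mulr_gt0.
move=> t t0 tr; split.
- have xt : x0 - t <= x0 by rewrite gerBl ltW.
  rewrite cdfB// -mulrA ler_pM2l//.
  have := slope (x0 - t); rewrite addrAC subrr add0r normrN gtr0_norm// => /(_ tr).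
  by rewrite ler0_norm ?opprB// subr_le0 Fmono// gerBl ltW.
- have xt : x0 <= x0 + t by rewrite lerDl ltW.
  rewrite cdfB// -mulrA ler_pM2l//.
  have := slope (x0 + t); rewrite addrAC subrr add0r gtr0_norm// => /(_ tr).
  by rewrite ger0_norm// subr_ge0 Fmono// lerDl ltW.
Qed.

End local.

(** * The estimator on blocks *)

Section blocks.
Context {R : realType}.
Variables (n : nat) (x : nat -> R).

(** The bound on visits counts the times [t < n], the estimator uses one more. *)
Lemma card_ge_visits (B : set R) (J : {set 'I_n.+1}) :
  (forall t : 'I_n.+1, B (x t) -> t \in J) ->
  \sum_(t < n) \1_B (x t) <= #|J|%:R :> R.
Proof.
move=> BJ; apply: (@le_trans _ _ (\sum_(t < n.+1) \1_B (x t))).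
  by rewrite big_ord_recr/= lerDl indicE ler0n.
rewrite -sum1_card natr_sum [leRHS]big_mkcond/=; apply: ler_sum => t _.
rewrite indicE; case: (boolP (x t \in B)) => [/set_mem/BJ ->//|_].
by case: ifP.
Qed.

End blocks.

Section fit.
Context {R : realType}.
Variables (n : nat) (Q : pred nat) (x z W : nat -> R) (f0 f : R -> R) (x0 eta : R).
Hypotheses (lse : nonincreasing_lse n Q x z f) (f0d : nonincreasing_fun f0)
  (zE : forall t, z t = f0 (x t) + W t).

Definition upper_block (a : R) : {set 'I_n.+1} :=
  [set t : 'I_n.+1 | [&& Q t, a <= x t & f x0 <= f (x t)]].

Definition lower_block (a : R) : {set 'I_n.+1} :=
  [set t : 'I_n.+1 | [&& Q t, x t <= a & f (x t) <= f x0]].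

(** On the block where the fit is at least its value at [x0], the average of the
    observations is at least this value; it is also at most the regression
    function at the left end of the block, up to the average noise. *)
Lemma fit_le a : (0 < #|upper_block a|)%N ->
  `|\sum_(t in upper_block a) W t| < eta * #|upper_block a|%:R -> f x0 <= f0 a + eta.
Proof.
set J := upper_block a => J0 hW; have JR : 0 < #|J|%:R :> R by rewrite ltr0n.
have := lse_block_ge a (f x0) lse.
rewrite (eq_bigl (fun t => t \in J)); last by move=> t; rewrite inE.
have -> : \sum_(t in J) (z t - f x0) =
    \sum_(t in J) (f0 (x t) - f x0) + \sum_(t in J) W t.
  by rewrite -big_split/=; apply: eq_bigr => t _; rewrite zE addrAC.
have : \sum_(t in J) (f0 (x t) - f x0) <= (f0 a - f x0) * #|J|%:R.
  rewrite mulr_natr -sumr_const; apply: ler_sum => t; rewrite inE => /and3P[_ ax _].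
  by rewrite lerD2r; exact: f0d.
have := ler_norm (\sum_(t in J) W t).
move=> h1 h2 h3; rewrite -subr_ge0 -(pmulr_lge0 _ JR).
lra.
Qed.

Lemma fit_ge a : (0 < #|lower_block a|)%N ->
  `|\sum_(t in lower_block a) W t| < eta * #|lower_block a|%:R -> f0 a - eta <= f x0.
Proof.
set J := lower_block a => J0 hW; have JR : 0 < #|J|%:R :> R by rewrite ltr0n.
have := lse_block_le a (f x0) lse.
rewrite (eq_bigl (fun t => t \in J)); last by move=> t; rewrite inE.
have -> : \sum_(t in J) (z t - f x0) =
    \sum_(t in J) (f0 (x t) - f x0) + \sum_(t in J) W t.
  by rewrite -big_split/=; apply: eq_bigr => t _; rewrite zE addrAC.
have : (f0 a - f x0) * #|J|%:R <= \sum_(t in J) (f0 (x t) - f x0).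
  rewrite mulr_natr -sumr_const; apply: ler_sum => t; rewrite inE => /and3P[_ ax _].
  by rewrite lerD2r; exact: f0d.
have := ler_norm (- \sum_(t in J) W t); rewrite normrN.
move=> h1 h2 h3; rewrite -subr_ge0 -(pmulr_lge0 _ JR).
lra.
Qed.

End fit.
(** * Rate of convergence *)

Section cube_root.
Context {R : realType}.
Implicit Types u a : R.

Lemma powR_neg_third u : 0 < u -> u `^ (- (1 / 3)) = (u `^ (1 / 3))^-1.
Proof. by move=> u0; rewrite powRN. Qed.

Lemma powR_two_thirds u : 0 <= u -> u `^ (2 / 3) = (u `^ (1 / 3)) ^+ 2.
Proof.
move=> u0; rewrite -powR_mulrn ?powR_ge0// -powRrM; congr (u `^ _).
by field.
Qed.

Lemma powR_third_ge u a : 0 <= a -> a ^+ 3 <= u -> a <= u `^ (1 / 3).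
Proof.
move=> a0 au; have <- : (a ^+ 3) `^ (1 / 3) = a.
  by rewrite -powR_mulrn// -powRrM mulrC divfK ?powRr1// pnatr_eq0.
have u0 : 0 <= u by rewrite (le_trans _ au)// exprn_ge0.
by apply: ge0_ler_powR; rewrite ?nnegrE ?exprn_ge0// divr_ge0.
Qed.

End cube_root.

Theorem theorem4p1 (R : realType)
  (* state space, kernel, maximal irreducibility measure, invariant measure *)
  (E : set R) (mE : measurable E)
  (P : R.-pker R ~> R) (hPE : forall x, E x -> P x E = 1%E)
  (psi : {sigma_finite_measure set R -> \bar R})
  (hpsi : maximal_irreducibility_measure E P psi)
  (pi : {sigma_finite_measure set R -> \bar R})
  (hpi : invariant_measure E P pi)
  (* the laws P_mu of the chain *)
  (d1 : measure_display) (T1 : measurableType d1) (X1 : nat -> T1 -> R)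
  (PP : probability R R -> probability T1 R)
  (hPP : markov_family P X1 PP)
  (* minorization *)
  (s : R -> R) (nu : probability R R)
  (ms : measurable_fun setT s) (hs01 : forall x, 0 <= s x <= 1)
  (hnuE : nu E = 1%E)
  (hmin : forall x A, E x -> measurable A -> ((s x)%:E * nu A <= P x A)%E)
  (hsnu : (0 < \int[nu]_x (s x)%:E)%E)
  (* initial distribution, split chain started from it and from the atom *)
  (lam : probability R R) (hlam : lam E = 1%E)
  (d2 : measure_display) (T2 : measurableType d2)
  (X2 : nat -> T2 -> R) (xi : nat -> T2 -> bool)
  (Plam Patom : probability T2 R)
  (hPlam : split_chain P s nu Plam X2 xi) (hPlam0 : split_start s lam Plam X2 xi)
  (hPatom : split_chain P s nu Patom X2 xi) (hPatom0 : atom_start E Patom X2 xi)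
  (* (1) and the rate u *)
  (hharris : harris_recurrent E psi X1 PP)
  (haper : aperiodic E P psi)
  (u : nat -> R)
  (hrec :
    ((pi E < +oo)%E /\ forall n, u n = n%:R) \/
    (exists (beta : R) (L : R -> R),
      [/\ beta_null_recurrent E P psi pi X1 PP beta, slowly_varying L,
          atom_tail Patom xi beta L
        & forall n, u n = n%:R `^ beta * L n%:R]))
  (* the observed process *)
  (d : measure_display) (T : measurableType d) (Pr : probability T R)
  (X : nat -> T -> R) (hX : markov_chain P lam Pr X)
  (f0 : R -> R) (W : nat -> T -> R) (mW : forall t, measurable_fun setT (W t))
  (Z : nat -> T -> R) (hZ : forall t w, Z t w = f0 (X t w) + W t w)
  (* (2) *)
  (sigma : R) (hsigma : 0 < sigma)
  (hind : forall n, cond_independent Pr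
    (g_sigma_preimage (fun i : 'I_n.+1 => X i)) (fun i : 'I_n.+1 => W i))
  (hmean : forall n t, (t <= n)%N ->
    is_cond_exp Pr (g_sigma_preimage (fun i : 'I_n.+1 => X i)) (W t) (cst 0))
  (hvar : forall n t, (t <= n)%N -> exists2 v : T -> R,
    is_cond_var Pr (g_sigma_preimage (fun i : 'I_n.+1 => X i)) (W t) v
    & {ae Pr, forall w, v w <= sigma ^+ 2})
  (* (3) *)
  (x0 delta : R) (hdelta : 0 < delta)
  (C : interval R) (hC : C = `[x0 - delta, x0 + delta])
  (hsmall : small_set E P psi [set` C])
  (* (4) *)
  (hx0 : interior (measure_support pi) x0)
  (* (5) *)
  (hf0 : nonincreasing_fun f0)
  (hf0' : bounded_derive_on [set` C] f0)
  (hF' : bounded_derive_on [set` C] (localized_cdf pi [set` C]))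
  (* (6) *)
  (hocc : exists K : R, \forall g \near within [set g | 0 <= g] (nbhs (0 : R)),
    (\int[Plam]_w
       (\sum_(0 <= t <oo | ((t%:R : R)%:E <= return_time xi 1 w)%E)
          (\1_[set y | y \in C /\ (y <= x0 + g)%R] (X2 t w) -
           \1_[set y | y \in C /\ (y <= x0 - g)%R] (X2 t w))%:E)
     <= (K * g)%:E)%E)
  (* (7) *)
  (hblock : (\int[Plam]_w (block_visits X2 xi [set` C] 1 w ^+ 2) < +oo)%E)
  (* the estimator *)
  (fhat : nat -> T -> R -> R)
  (hfhat : forall n w,
    isotonic_lse C n (fun t => X t w) (fun t => Z t w) (fhat n w)) :
  bigO_P Pr (fun n w => fhat n w x0 - f0 x0) (fun n => u n `^ (- (1 / 3))).
Proof.
move=> e e0.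
have [psiirr _] := hpsi; have [psiE _ _] := psiirr.
have hF := hF'; have hf := hf0'; have sC := hsmall; rewrite hC in hF hf sC.
have [b [r1 [b0 r10 piC0 mass]]] := localized_mass hdelta hF.
have [c [r2 [c0 r20 lip]]] := derive_on_Lipschitz hdelta hf.
have [u_oo visits] : often_visited pi `[x0 - delta, x0 + delta]%classic Pr X u.
  have [[piE uE]|[beta [L [hnull sL tailL uE]]]] := hrec.
    exact: (positive_often_visited mE hPE psiE hpi sC piC0 hPP hharris hlam hX piE uE).
  have [_ b0' b1 _] := hnull.
  exact: (null_often_visited mE hPE psiE hpi sC piC0 hPP hharris hlam hX ms hs01 hnuE
    hmin hPatom hPatom0 b0' b1 sL tailL uE).
have e4 : 0 < e / 4 by rewrite divr_gt0.
have [g g0 gP] := visits b (e / 4) b0 e4.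
(* The inequality [2 sigma^2 / ((M' r)^2 m) <= e / 4] below holds for this [M'], since
   [2 m >= g / r^2] and [M' <= M'^2]. *)
pose M' := 16 * sigma ^+ 2 / (g * e) + 1.
have M'1 : 1 <= M' by rewrite lerDr divr_ge0 ?mulr_ge0 ?sqr_ge0// ltW.
exists (c + M'); first by rewrite addr_gt0// (lt_le_trans ltr01).
(* For [u n] beyond [A ^+ 3], the scale [r] is smaller than [r1] and [r2], and the
   guaranteed number [g / r^2] of visits is at least [1]. *)
pose A := Num.max 1 (Num.max (Num.max r1^-1 r2^-1) g^-1).
have A1 : 1 <= A by rewrite le_max lexx.
near=> n.
have un : A ^+ 3 <= u n by near: n; move/cvgryPge : u_oo; exact.
have u0 : 0 < u n by rewrite (lt_le_trans _ un)// exprn_gt0// (lt_le_trans ltr01).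
have gn : forall B : set R, measurable B -> B `<=` `[x0 - delta, x0 + delta] ->
    b * u n `^ (- (1 / 3)) <= fine (pi B) ->
    \int[Pr]_w \1_[set w | \sum_(t < n) \1_B (X t w) < g * u n `^ (2 / 3)] w <= e / 4.
  by near: n.
have yA := powR_third_ge (le_trans ler01 A1) un.
rewrite powR_neg_third//.
rewrite powR_neg_third// (powR_two_thirds (ltW u0)) in gn.
set y := u n `^ (1 / 3) in yA gn *.
have y1 : 1 <= y by exact: le_trans yA.
have y0 : 0 < y by exact: lt_le_trans y1.
pose r := y^-1.
have r0 : 0 < r by rewrite invr_gt0.
have rr1 : r <= r1.
  rewrite invf_ple ?posrE//; apply: le_trans yA.
  by rewrite !le_max lexx orbT.
have rr2 : r <= r2.
  rewrite invf_ple ?posrE//; apply: le_trans yA.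
  by rewrite !le_max lexx !orbT.
have gy : 1 <= g * y ^+ 2.
  have gy1 : 1 <= g * y.
    rewrite -ler_pdivrMl// mulr1; apply: le_trans yA.
    by rewrite !le_max lexx !orbT.
  by rewrite expr2 mulrA (le_trans gy1)// ler_peMr// (le_trans ler01).
pose m := Num.truncn (g * y ^+ 2).
have m0 : (0 < m)%N by rewrite truncn_gt0.
have mR : 0 < m%:R :> R by rewrite ltr0n.
have mle : m%:R <= g * y ^+ 2 by rewrite truncn_le// mulr_ge0 ?exprn_ge0// ltW.
have mge : g * y ^+ 2 <= 2 * m%:R.
  have := truncnS_gt (g * y ^+ 2); rewrite -/m -natr1 => h.
  have : 1 <= m%:R :> R by rewrite ler1n.
  by move: h; clear; lra.
pose eta := M' * r.
have eta0 : 0 < eta by rewrite mulr_gt0// (lt_le_trans ltr01).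
have noise_p : 2 * sigma ^+ 2 / (eta ^+ 2 * m%:R) <= e / 4.
  have M'M : M' <= M' ^+ 2 by rewrite expr2 ler_peMr// (le_trans ler01).
  have hM : 16 * sigma ^+ 2 <= M' ^+ 2 * (g * e).
    have ge0 : 0 < g * e by exact: mulr_gt0.
    rewrite -ler_pdivrMr// (le_trans _ M'M)//.
    by rewrite /M' lerDl.
  have em : 0 < eta ^+ 2 * m%:R by apply: mulr_gt0 => //; exact: exprn_gt0.
  rewrite ler_pdivrMr//.
  have -> : eta ^+ 2 = M' ^+ 2 / y ^+ 2 by rewrite /eta exprMn exprVn.
  have h2 : M' ^+ 2 * (g * e) <= 2 * (M' ^+ 2 / y ^+ 2 * m%:R * e).
    have -> : M' ^+ 2 * (g * e) = M' ^+ 2 * e / y ^+ 2 * (g * y ^+ 2).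
      by field; rewrite gt_eqF.
    have -> : 2 * (M' ^+ 2 / y ^+ 2 * m%:R * e) = M' ^+ 2 * e / y ^+ 2 * (2 * m%:R).
      by field; rewrite gt_eqF.
    by rewrite ler_wpM2l// divr_ge0 ?exprn_ge0 ?mulr_ge0 ?exprn_ge0// ltW// (lt_le_trans ltr01).
  have -> : e / 4 * (M' ^+ 2 / y ^+ 2 * m%:R) = M' ^+ 2 / y ^+ 2 * m%:R * e / 4 by ring.
  by move: (le_trans hM h2); set q := M' ^+ 2 / y ^+ 2 * m%:R * e; clear; lra.
have [mX _ _] := hX.
pose G := past X n.
have Gm : G `<=` measurable by exact: past_measurable.
have Gs : <<s G >> = G by exact: past_id.
have hind' : cond_independent Pr G (fun i : 'I_n.+1 => W i) by exact: hind.
have hmean' (i : 'I_n.+1) : is_cond_exp Pr G (W i) (cst 0).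
  by apply: hmean; rewrite -ltnS.
have hvar' (i : 'I_n.+1) : exists2 v : T -> R, is_cond_exp Pr G (fun w => W i w ^+ 2) v
     & {ae Pr, forall w, v w <= sigma ^+ 2}.
  have [|v vc vs] := hvar n i; first by rewrite -ltnS.
  by exists v => //; exact: (cond_var_centered Gm (mW i) (hmean' i) vc).
have GX (i : 'I_n.+1) B : measurable B -> G (X i @^-1` B).
  by move=> mB; apply: past_gen => //; rewrite -ltnS.
have Pr1 : Pr setT = 1%E by exact: probability_setT.
have mVis (B : set R) : measurable B ->
    measurable [set w | \sum_(t < n) \1_B (X t w) < g * y ^+ 2].
  move=> mB; have mf : measurable_fun setT (fun w => \sum_(t < n) (\1_B (X t w) : R)).
    by apply: measurable_sum => t; apply: measurableT_comp => //; exact: measurable_indic.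
  have := mf measurableT `]-oo, g * y ^+ 2[%classic (measurable_itv _).
  by rewrite setTI; congr (measurable _); apply/seteqP; split => w /=; rewrite in_itv.
have mC : measurable [set` C] by exact: measurable_itv.
(* The upper bound uses the visits to [B1] and the increasing order of the values of
   the chain, the lower bound those to [B2] and the decreasing order. *)
pose B1 : set R := [set` C] `&` `]x0 - r, x0].
pose B2 : set R := [set` C] `&` `]x0, x0 + r].
have mB1 : measurable B1 by apply: measurableI => //; exact: measurable_itv.
have mB2 : measurable B2 by apply: measurableI => //; exact: measurable_itv.
pose V1 := [set w | \sum_(t < n) \1_B1 (X t w) < g * y ^+ 2].
pose V2 := [set w | \sum_(t < n) \1_B2 (X t w) < g * y ^+ 2].
have [ms1 ms2] := mass r r0 rr1.
have PV1 : (Pr V1 <= (e / 4)%:E)%E.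
  rewrite -(bm_integral_indic Pr1 (mVis _ mB1)) lee_fin; apply: gn => //.
    by rewrite /B1 hC => v [].
  by rewrite /B1 hC.
have PV2 : (Pr V2 <= (e / 4)%:E)%E.
  rewrite -(bm_integral_indic Pr1 (mVis _ mB2)) lee_fin; apply: gn => //.
    by rewrite /B2 hC => v [].
  by rewrite /B2 hC.
have GI (i : 'I_n.+1) (B : set R) : measurable B -> G [set w | B (X i w)] by exact: GX.
have [N1 [mN1 PN1 hN1]] := block_noise Gm Gs (fun i : 'I_n.+1 => mW i) hind' hmean' hvar'
  (Y := fun i => X i) (D := fun i => [set w | ([set` C] `&` `[x0 - r, +oo[) (X i w)])
  GX (fun i => GI i _ (measurableI _ _ mC (measurable_itv _))) eta0 m0.
have GNX (i : 'I_n.+1) B : measurable B -> G ((fun w => - X i w) @^-1` B).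
  move=> mB; apply: (GX i (-%R @^-1` B)).
  by rewrite -[X in measurable X]setTI; apply: oppr_measurable.
have [N2 [mN2 PN2 hN2]] := block_noise Gm Gs (fun i : 'I_n.+1 => mW i) hind' hmean' hvar'
  (Y := fun i w => - X i w) (D := fun i => [set w | ([set` C] `&` `]-oo, x0 + r]) (X i w)])
  GNX (fun i => GI i _ (measurableI _ _ mC (measurable_itv _))) eta0 m0.
exists ((V1 `|` V2) `|` (N1 `|` N2)); split.
- by apply: measurableU; apply: measurableU => //; exact: mVis.
- have mV1 := mVis _ mB1; have mV2 := mVis _ mB2.
  have eE : e%:E = ((e / 4)%:E + (e / 4)%:E + ((e / 4)%:E + (e / 4)%:E))%E.
    by rewrite -!EFinD; congr EFin; clear; lra.
  have p4 : ((2 * sigma ^+ 2 / (eta ^+ 2 * m%:R))%:E <= (e / 4)%:E)%E by rewrite lee_fin.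
  rewrite eE; apply: le_trans (measureU2 _ _ _) _; [exact: measurableU|exact: measurableU|].
  apply: leeD; (apply: le_trans (measureU2 _ _ _) _; [by []|by []|apply: leeD => //]).
    exact: le_trans PN1 p4.
  exact: le_trans PN2 p4.
move=> w /not_orP[/not_orP[nV1 nV2] /not_orP[nN1 nN2]].
have [fd fo _] := hfhat n w.
have lse : nonincreasing_lse n (fun t => X t w \in C) (X ^~ w) (Z ^~ w) (fhat n w) by split.
have zE t : Z t w = f0 (X t w) + W t w by exact: hZ.
have up : fhat n w x0 <= f0 (x0 - r) + eta.
  pose J := upper_block n (fun t => X t w \in C) (X ^~ w) (fhat n w) x0 (x0 - r).
  have mJ : (m <= #|J|)%N.
    rewrite -(ler_nat R) (le_trans mle)//.
    apply: (@le_trans _ _ (\sum_(t < n) \1_B1 (X t w))); first by rewrite leNgt; exact/negP.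
    apply: (card_ge_visits (x := X ^~ w)) => t -[Ct /=]; rewrite in_itv/= => /andP[xr xx].
    by rewrite inE; apply/and3P; split => //; [exact: ltW|exact: fd].
  apply: (fit_le lse hf0 zE); first exact: leq_trans mJ.
  apply: (hN1 _ nN1) => // [i|i j].
  - by rewrite inE => /and3P[h1 h2 _]; split => //=; rewrite in_itv/= h2.
  - rewrite !inE => /and3P[h1 h2 h3] [h4 /=]; rewrite in_itv/= andbT => h5 h6.
    apply/and3P; split => //; apply: (le_trans h3); exact: fd.
have lo : f0 (x0 + r) - eta <= fhat n w x0.
  pose J := lower_block n (fun t => X t w \in C) (X ^~ w) (fhat n w) x0 (x0 + r).
  have mJ : (m <= #|J|)%N.
    rewrite -(ler_nat R) (le_trans mle)//.
    apply: (@le_trans _ _ (\sum_(t < n) \1_B2 (X t w))); first by rewrite leNgt; exact/negP.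
    apply: (card_ge_visits (x := X ^~ w)) => t -[Ct /=]; rewrite in_itv/= => /andP[xr xx].
    by rewrite inE; apply/and3P; split => //; apply: fd; exact: ltW.
  apply: (fit_ge lse hf0 zE); first exact: leq_trans mJ.
  apply: (hN2 _ nN2) => // [i|i j].
  - by rewrite inE => /and3P[h1 h2 _]; split => //=; rewrite in_itv/= h2.
  - rewrite !inE lerN2 => /and3P[h1 h2 h3] [h4 /=]; rewrite in_itv/= => h5 h6.
    apply/and3P; split => //; apply: le_trans h3; exact: fd.
have l1 := lip (x0 - r); have l2 := lip (x0 + r).
rewrite addrAC subrr add0r normrN (gtr0_norm r0) in l1.
rewrite addrAC subrr add0r (gtr0_norm r0) in l2.
have := l1 rr2; have := l2 rr2.
rewrite !ler_norml => /andP[l3 _] /andP[_ l4].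
have -> : (c + M') / y = c * r + eta by rewrite mulrDl.
by move: up lo l3 l4; clear; move=> *; apply/andP; split; lra.
Unshelve. all: by end_near. Qed.
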